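(* Let $\lambda>0$. The following are equivalent for a function $f:(0,\infty)\to\mathbb R$. (i) $f$ is a generalized Stieltjes function of order $\lambda$ corresponding to a measure $\mu$ having moments of all orders; (ii) $c_k^{\lambda}(f)$ is completely monotonic for all $k\geq 0$ and the function $x^{\lambda-1}f(x)$ admits for any $n$ an asymptotic expansion $$x^{\lambda-1}f(x)=\sum_{k=0}^{n-1}\frac{\alpha_k}{x^{k+1}}+r_n(x),$$ in which $x^nr_n(x)\to 0$ as $x\to\infty$. In the affirmative case, $\alpha_k=(-1)^k(\lambda)_ks_k(\mu)/k!$ where $s_k(\mu)$ is the $k$'th moment of $\mu$, and $r_n$ has the representation $$r_n(x)=(-1)^nx^{\lambda-1}\int_0^{\infty}e^{-xt}t^{\lambda-1}\xi_n(t)\,dt,$$ where $\xi_n$ belongs to $C^\infty([0,\infty))$, and satisfies $\xi_n^{(j)}(0)=0$ for $j\leq n-1$ and $0\leq\xi_n^{(n)}(t)\leq s_n(\mu)$ for $t\geq 0$. Furthermore, $$c_n^{\lambda}(f)(x)=x^{1-\lambda}\left(x^nr_n(x)\right)^{(n)}=c_n^{\lambda}\left(\mathcal L\left(t^{\lambda-1}(-1)^n\xi_n(t)\right)\right)(x).$$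
   Context: A function $f:(0,\infty)\to\mathbb R$ is a generalized Stieltjes function of order $\lambda>0$ if $$f(x)=\int_0^{\infty}\frac{d\mu(t)}{(x+t)^{\lambda}}+c,$$ where $\mu$ is a positive measure on $[0,\infty)$ making the integral converge for $x>0$ and $c\geq 0$; $\mu$ is the measure to which $f$ corresponds. A measure $\mu$ has moments of all orders if every polynomial is integrable with respect to $\mu$; its $k$'th moment is $s_k(\mu)=\int_0^\infty t^k\,d\mu(t)$. A function $g\in C^\infty((0,\infty))$ is completely monotonic if $(-1)^ng^{(n)}(x)\geq 0$ for all $n\geq 0$ and all $x>0$. For $k\geq 0$ and $f\in C^\infty((0,\infty))$, $c_k^{\lambda}(f)(x)=x^{1-\lambda}\left(x^{\lambda-1+k}f(x)\right)^{(k)}$, where $^{(k)}$ denotes the $k$-th derivative. $(\lambda)_k=\lambda(\lambda+1)\cdots(\lambda+k-1)$, $(\lambda)_0=1$, and $\mathcal L(h(t))(x)=\int_0^\infty e^{-xt}h(t)\,dt$ is the Laplace transform.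
   Formalization: In (i) the constant c is taken to be 0 (for c>0, e.g. f=1, λ=1, (i) does not give (ii)); the bound on ξ_n^(n) is s_n(μ)/Γ(λ) instead of s_n(μ), which fails for 1<λ<2 (e.g. μ=δ_0, λ=3/2, n=0). *)

(* Defs.v *)
From HB Require Import structures.
From mathcomp Require Import all_boot all_order all_algebra.
From mathcomp Require Import all_classical all_reals all_analysis.

Set Implicit Arguments.
Unset Strict Implicit.
Unset Printing Implicit Defensive.

Import Order.TTheory GRing.Theory Num.Theory.
Import numFieldNormedType.Exports.

Local Open Scope classical_set_scope.
Local Open Scope ring_scope.

(* A function on (0, oo) is a function R -> R of which only the values at
   x > 0 matter; a measure on [0, oo) is a Borel measure on R against which one
   integrates over `[0, +oo[ only. *)

Section Defs.
Context {R : realType}.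
Implicit Types (lambda c x t : R) (f g h : R -> R)
  (mu : {measure set R -> \bar R}) (alpha : nat -> R) (k n : nat).

Local Notation leb := (@lebesgue_measure R).

(* [f] corresponds to [mu], with additive constant [c]. *)
Definition generalized_Stieltjes lambda mu c f : Prop :=
  0 <= c /\
  forall x, 0 < x ->
    mu.-integrable `[0, +oo[ (fun t => ((x + t) `^ (- lambda))%:E) /\
    f x = \int[mu]_(t in `[0, +oo[) ((x + t) `^ (- lambda)) + c.

Definition has_all_moments mu : Prop :=
  forall p : {poly R}, mu.-integrable `[0, +oo[ (fun t => (p.[t])%:E).

Definition moment mu k : R := \int[mu]_(t in `[0, +oo[) (t ^+ k).

Definition smooth_on_pos g : Prop :=
  forall n x, 0 < x -> derivable (derive1n n g) x 1.

Definition completely_monotonic g : Prop :=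
  smooth_on_pos g /\ forall n x, 0 < x -> 0 <= (-1) ^+ n * derive1n n g x.

(* Since [c_op lambda 0 f] is [f] on (0, oo), complete monotonicity of it
   includes the smoothness of [f]. *)
Definition c_op lambda k f : R -> R := fun x =>
  x `^ (1 - lambda) *
  derive1n k (fun y => y `^ (lambda - 1 + k%:R) * f y) x.

Definition rising lambda k : R := \prod_(i < k) (lambda + i%:R).

Definition Laplace h : R -> R := fun x =>
  \int[leb]_(t in `[0, +oo[) (expR (- (x * t)) * h t).

(* It enters through 1 / (x + t)^lambda =
   Gamma(lambda)^-1 * int_0^oo e^{-(x + t) s} s^(lambda - 1) ds: the n-th
   derivative at 0 of the function representing the n-th remainder is
   s_n(mu) / Gamma(lambda). *)
Definition Gamma lambda : R :=
  \int[leb]_(t in `]0, +oo[) (expR (- t) * t `^ (lambda - 1)).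

Definition remainder lambda f alpha n : R -> R := fun x =>
  x `^ (lambda - 1) * f x - \sum_(k < n) alpha k / x ^+ k.+1.

Definition asymptotic_expansion lambda f alpha : Prop :=
  forall n, x ^+ n * remainder lambda f alpha n x @[x --> +oo] --> (0 : R).

(* Calculus on the closed half-line [0, oo): the difference quotient at x is
   restricted to points y of [0, oo), so that at x = 0 this is the right
   derivative, and no value of [g] at a negative point is used. *)
Definition dquot g x : R -> R := fun y => (y - x)^-1 * (g y - g x).

Definition deriv_nneg g : R -> R := fun x =>
  lim (dquot g x y @[y --> within `[0, +oo[ x^']).

Definition derivn_nneg n g : R -> R := iter n deriv_nneg g.

Definition smooth_on_nneg g : Prop :=
  forall n x, 0 <= x ->
    cvg (dquot (derivn_nneg n g) x y @[y --> within `[0, +oo[ x^']).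

End Defs.

(* Main.v *)
Require Import Defs.
From HB Require Import structures.
From mathcomp Require Import all_boot all_order all_algebra.
From mathcomp Require Import all_classical all_reals all_analysis.
From mathcomp Require Import measurable_realfun.
From mathcomp Require Import ring lra.

Set Implicit Arguments.
Unset Strict Implicit.
Unset Printing Implicit Defensive.

Import Order.TTheory GRing.Theory Num.Theory.
Import numFieldNormedType.Exports.

Local Open Scope classical_set_scope.
Local Open Scope ring_scope.

(* Put [H u = u^(-lambda) f (1 / u)]. Then
   [(-1)^n H^(n) u = u^(-lambda - n) c_n^lambda(f) (1 / u)], so that (ii) says
   that [H] is completely monotone and that [H u] has an asymptotic expansion as
   [u -> 0], while (i) says that [H u] is the integral of [(1 + u t)^(-lambda)].

   (i) -> (ii): [c_k^lambda(f)] is [(lambda)_k] times the integral of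
   [t^k (x + t)^(-lambda - k)], and the remainders of the binomial series of
   [(1 + a)^(-lambda)] alternate in sign. The functions [xi_n] are the alternating
   Taylor remainders of [s |-> int e^(-s t) dmu t], divided by [Gamma lambda].

   (ii) -> (i): after subtracting its limit at infinity (an atom at 0), [H] is given
   by Taylor's formula with base point at infinity,
   [H u = int_u^oo (s - u)^n / n! (-1)^(n+1) H^(n+1)(s) ds]. Since [H^(n+1)] is
   expressed by [c_(n+1)^lambda(f)], which is completely monotone as well, a second
   Taylor formula writes [H u] as the integral of a density against
   [int_0^oo s^(-lambda-1) (1 - u/s)_+^n (1 - 1/(r s))_+^n ds]. As [n -> oo] this
   kernel is, up to a relative error [O(1/n)], a multiple of [(u + 1/r)^(-lambda)];
   hence [H] is the limit of integrals of [(1 + u r)^(-lambda)] against positive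
   densities of bounded mass, and Helly's theorem gives the measure. The asymptotic
   expansion and Fatou's lemma give the moments one after the other. *)

(** * Derivatives on the positive half-line *)

Section DerivativeSequences.
Context {R : realType}.
Implicit Types (f g h : R -> R) (G : nat -> R -> R) (x y d : R) (n k : nat).

(** Hypothesis (ii) acts on two levels. The signs of the values of all [c_k] make [H] completely
    monotone; the signs of the derivatives of a single [c_(n+1)] drive the second Taylor formula,
    applied to [c_(n+1)] at the point [1/s]. Its factor [(r - 1/s)^n] is [r^n (1 - 1/(r s))^n], and
    [(s - u)^n] is [s^n (1 - u/s)^n]. As [H^(n+1)(s)] carries [s^(-lambda-n-1)], that [s^n] leaves
    the power [s^(-lambda-1)] of the kernel. Since [(1 - y)_+^n] is close to [e^(-n y)], the kernel
    is close to [int s^(-lambda-1) e^(-n (u + 1/r)/s) ds], which scaling in [s] shows to be a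
    constant times [(n (u + 1/r))^(-lambda)]. The factor [n^(-lambda) r^lambda] is moved into the
    density.

    The densities have mass at most [2 alpha_0]: [H <= alpha_0] because [H] increases to [alpha_0]
    as [u -> 0], where [(1 + u r)^(-lambda)] tends to 1, and the factor 2 absorbs the relative
    error. The expansion also excludes an additive constant [c > 0], since it makes [x^lambda f(x)]
    converge at infinity. *)

Lemma is_derive_eq_pos f g x d : (forall y, 0 < y -> f y = g y) -> 0 < x ->
  is_derive x 1 f d -> is_derive x 1 g d.
Proof.
move=> fg x0; apply: near_eq_is_derive; near=> y; rewrite fg//.
by near: y; exact: lt_nbhsr.
Unshelve. all: by end_near. Qed.

(** A candidate for all derivatives at once: one induction on the order then yields both the closed
    form of [derive1n] and smoothness, and only values at positive points enter. *)
Definition derivative_sequence G : Prop :=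
  forall n x, 0 < x -> is_derive x 1 (G n) (G n.+1 x).

Lemma derivative_sequenceP g G : derivative_sequence G ->
  (forall x, 0 < x -> g x = G 0%N x) ->
  forall n x, 0 < x -> derive1n n g x = G n x.
Proof.
move=> dG gG; elim=> [|n IH] x x0; first exact: gG.
rewrite derive1nS derive1E.
have dn := is_derive_eq_pos (fun y (y0 : 0 < y) => esym (IH y y0)) x0 (dG n x x0).
exact: derive_val.
Qed.

Lemma derivative_sequence_smooth g G : derivative_sequence G ->
  (forall x, 0 < x -> g x = G 0%N x) -> smooth_on_pos g.
Proof.
move=> dG gG n x x0.
have gn y : 0 < y -> G n y = derive1n n g y.
  by move=> y0; rewrite (derivative_sequenceP dG gG).
by have [] := is_derive_eq_pos gn x0 (dG n x x0).
Qed.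

Lemma smooth_derivative_sequence g :
  smooth_on_pos g -> derivative_sequence (fun n => derive1n n g).
Proof.
move=> sg n x x0; rewrite derive1nS derive1E.
exact/derivableP/sg.
Qed.

Lemma eq_derive1n_pos f g n x : (forall y, 0 < y -> f y = g y) -> 0 < x ->
  derive1n n f x = derive1n n g x.
Proof.
move=> fg; elim: n x => [|n IH] x x0; first exact: fg.
rewrite !derive1nS !derive1E; apply: near_eq_derive.
by near=> y; apply: IH; near: y; exact: lt_nbhsr.
Unshelve. all: by end_near. Qed.

Lemma smooth_on_pos_eq f g : (forall y, 0 < y -> f y = g y) ->
  smooth_on_pos f -> smooth_on_pos g.
Proof.
move=> fg /smooth_derivative_sequence sf.
by apply: derivative_sequence_smooth sf _ => x x0; exact/esym/fg.
Qed.

(** Leibniz' rule for the product with the identity. At [n = 0] the truncated predecessor is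
    multiplied by 0. *)
Lemma derivative_sequence_id_mul G : derivative_sequence G ->
  derivative_sequence (fun n x => x * G n x + n%:R * G n.-1 x).
Proof.
move=> dG n x x0.
have dn := dG n x x0.
have dxn : is_derive x 1 (id * G n) (x *: G n.+1 x + G n x *: 1).
  exact: is_deriveM.
suff dn1 : is_derive x 1 (n%:R \*: G n.-1) (n%:R * G n x).
  have dD := is_deriveD dxn dn1.
  apply: is_derive_eq.
  rewrite /= /GRing.scale/= -natr1; ring.
case: n dn {dxn} => [|n] dn /=.
  have -> : (0%:R \*: G 0%N : R -> R) = cst 0.
    by apply/funext => y /=; rewrite scale0r.
  by rewrite mul0r; exact: is_derive_cst.
have dn' := dG n x x0.
exact: is_deriveZ.
Qed.

(** Smoothness of finite order, by recursion on the derivative: closure under products becomes an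
    induction on the order, whereas a [derivative_sequence] for a product would call for the full
    Leibniz formula. *)
Fixpoint derivable_upto n g : Prop :=
  if n is m.+1 then
    (forall x, 0 < x -> derivable g x 1) /\ derivable_upto m (derive1 g)
  else True.

Lemma smooth_derivable_upto g :
  smooth_on_pos g <-> forall n, derivable_upto n g.
Proof.
split=> [sg n|].
  have : forall k, derivable_upto n (derive1n k g).
    elim: n => // n IH k; split; first by move=> x; exact: sg.
    by rewrite -derive1nS.
  by move/(_ 0%N).
move=> + n; elim: n g => [|n IH] g dg x x0.
  by have [/(_ x x0)] := dg 1%N.
have -> : derive1n n.+1 g = derive1n n (derive1 g) by rewrite /derive1n iterSr.
by apply: IH => // m; have [] := dg m.+1.
Qed.

Lemma derivable_upto_eq n f g : (forall y, 0 < y -> f y = g y) ->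
  derivable_upto n f -> derivable_upto n g.
Proof.
elim: n f g => // n IH f g fg [df dn]; split.
  move=> x x0; have := is_derive_eq_pos fg x0 (derivableP (df x x0)).
  by case.
apply: IH dn => y y0.
exact: (@eq_derive1n_pos _ _ 1%N).
Qed.

Lemma derivable_uptoS n g : derivable_upto n.+1 g -> derivable_upto n g.
Proof. by elim: n g => // n IH g [dg dn]; split => //; exact: IH. Qed.

Lemma derivable_uptoD n f g :
  derivable_upto n f -> derivable_upto n g -> derivable_upto n (f \+ g).
Proof.
elim: n f g => // n IH f g [df dn] [dg dn']; split.
  by move=> x x0; apply: derivableD; [exact: df|exact: dg].
apply: derivable_upto_eq (IH _ _ dn dn') => y y0.
by rewrite /= !derive1E deriveD//; [exact: df|exact: dg].
Qed.

Lemma derivable_uptoM n f g :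
  derivable_upto n f -> derivable_upto n g -> derivable_upto n (f \* g).
Proof.
elim: n f g => // n IH f g fn gn; have [df dn] := fn; have [dg dn'] := gn; split.
  by move=> x x0; apply: derivableM; [exact: df|exact: dg].
apply: derivable_upto_eq (derivable_uptoD
  (IH _ _ (derivable_uptoS fn) dn') (IH _ _ (derivable_uptoS gn) dn)) => y y0.
by rewrite /= !derive1E deriveM//; [exact: df|exact: dg].
Qed.

Lemma smooth_on_posM f g :
  smooth_on_pos f -> smooth_on_pos g -> smooth_on_pos (f \* g).
Proof.
move=> /smooth_derivable_upto sf /smooth_derivable_upto sg.
by apply/smooth_derivable_upto => n; exact: derivable_uptoM.
Qed.

Lemma is_derive_scale f x d c :
  is_derive x 1 f d -> is_derive x 1 (fun y => c * f y) (c * d).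
Proof. by move=> df; have := is_deriveZ c df. Qed.

Lemma derivative_sequence_powR (a : R) : derivative_sequence
  (fun n x => (\prod_(i < n) (a - i%:R)) * x `^ (a - n%:R)).
Proof.
move=> n x x0; rewrite big_ord_recr/= -mulrA; apply: is_derive_scale.
have := is_derive1_powR (a - n%:R) x0.
by rewrite -addrA -opprD natr1.
Qed.

Lemma smooth_powR (a : R) : smooth_on_pos (fun x => x `^ a).
Proof.
apply: derivative_sequence_smooth (derivative_sequence_powR a) _ => x x0.
by rewrite big_ord0 mul1r subr0.
Qed.

Lemma derive1nD_pos f g n x : smooth_on_pos f -> smooth_on_pos g -> 0 < x ->
  derive1n n (f \+ g) x = derive1n n f x + derive1n n g x.
Proof.
move=> /smooth_derivative_sequence df /smooth_derivative_sequence dg x0.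
apply: (@derivative_sequenceP _ (fun n y => derive1n n f y + derive1n n g y)) => //.
by move=> m y y0; have := df m y y0; have := dg m y y0 => ? ?; exact: is_deriveD.
Qed.

End DerivativeSequences.

Section PowR.
Context {R : realType}.
Implicit Types x r s : R.

Lemma powRD_gt0 x r s : 0 < x -> x `^ (r + s) = x `^ r * x `^ s.
Proof. by move=> x0; rewrite powRD// (gt_eqF x0) implybT. Qed.

Lemma powRB_gt0 x r s : 0 < x -> x `^ (r - s) = x `^ r / x `^ s.
Proof. by move=> x0; rewrite powRD_gt0// powRN. Qed.

End PowR.

(** * The operators [c_op] and their recursion *)

Section CompletelyMonotonicOperator.
Context {R : realType}.
Implicit Types (lambda : R) (f : R -> R) (x : R) (n k : nat).

Lemma risingS lambda k :
  rising lambda k.+1 = rising lambda k * (lambda + k%:R).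
Proof. by rewrite /rising big_ord_recr. Qed.

Lemma rising_gt0 lambda k : 0 < lambda -> 0 < rising lambda k.
Proof. by move=> l0; apply: prodr_gt0 => i _; rewrite ltr_wpDr. Qed.

Lemma rising0 lambda : rising lambda 0 = 1.
Proof. by rewrite /rising big_ord0. Qed.

Lemma risingSl lambda k :
  rising lambda k.+1 = lambda * rising (lambda + 1) k.
Proof.
rewrite /rising big_ord_recl/= addr0; congr (_ * _).
by apply: eq_bigr => i _; rewrite -addrA nat1r.
Qed.

Lemma c_op0 lambda f x : 0 < x -> c_op lambda 0 f x = f x.
Proof.
move=> x0; rewrite /c_op /= addr0 mulrA -powRD_gt0//.
by rewrite addrA subrK subrr powRr0 mul1r.
Qed.

Lemma smooth_c_base lambda k f : smooth_on_pos f ->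
  smooth_on_pos (fun y => y `^ (lambda - 1 + k%:R) * f y).
Proof. by move=> sf; apply: smooth_on_posM => //; exact: smooth_powR. Qed.

(* Leibniz' rule for [y * (y^(lambda-1+k) f)] turns the definition into the
   recursion [c_(k+1) = x c_k' + (lambda + k) c_k]. *)
Lemma is_derive_c_op lambda k f x : smooth_on_pos f -> 0 < x ->
  is_derive x 1 (c_op lambda k f)
    ((c_op lambda k.+1 f x - (lambda + k%:R) * c_op lambda k f x) / x).
Proof.
move=> sf x0.
pose F i y := y `^ (lambda - 1 + i%:R) * f y.
have sF i : smooth_on_pos (F i) by exact: smooth_c_base.
pose D n := derive1n n (F k).
have dD : derivative_sequence D by exact/smooth_derivative_sequence/sF.
have FS y : 0 < y -> F k.+1 y = y * D 0%N y + 0%:R * D 0%N y.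
  move=> y0; rewrite mul0r addr0 /D /= /F -natr1.
  have -> : lambda - 1 + (k%:R + 1) = 1 + (lambda - 1 + k%:R) by ring.
  by rewrite (@powRD_gt0 _ _ 1)// powRr1 ?ltW// mulrA.
have FSk : derive1n k.+1 (F k.+1) x = x * D k.+1 x + k.+1%:R * D k x.
  by rewrite (derivative_sequenceP (derivative_sequence_id_mul dD) FS).
have dk := dD k x x0.
have dp := is_derive1_powR (1 - lambda) x0.
have dM : is_derive x 1 (c_op lambda k f)
    (x `^ (1 - lambda) *: D k.+1 x + D k x *: ((1 - lambda) * x `^ (1 - lambda - 1))).
  exact: (@is_deriveM _ _ (fun y => y `^ (1 - lambda)) (D k)).
apply: (@is_derive_eq _ _ _ _ _ _ _ _ dM).
rewrite /c_op -/(F k) -/(F k.+1) FSk -/(D k) /GRing.scale/=.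
rewrite [x `^ (1 - lambda - 1)]powRB_gt0// powRr1 ?ltW// -natr1.
by field; rewrite gt_eqF.
Qed.

End CompletelyMonotonicOperator.

(** * Remainders of the binomial series and asymptotic expansions *)

Ltac prove_measurable := repeat first
  [ exact: measurable_cst | exact: measurable_id | assumption
  | apply: measurable_funX | apply: measurable_funD | apply: measurable_funB
  | apply: measurable_funM
  | apply: (measurableT_comp (measurable_powR _))
  | apply: (measurableT_comp (@measurable_expR _))
  | apply: (measurableT_comp (oppr_measurable _))
  | apply: measurable_funN | exact: measurable_fst | exact: measurable_snd ].

Section RealAnalysis.
Context {R : realType}.
Implicit Types (f df : R -> R) (a b x : R).

Lemma MVT_closed f df a b : a < b ->
  (forall x, a <= x <= b -> is_derive x 1 f (df x)) ->
  exists2 c, a < c < b & f b - f a = df c * (b - a).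
Proof.
move=> ab dfx; have [| |c] := @MVT R f df a b ab.
- move=> x; rewrite in_itv/= => /andP[/ltW ax /ltW xb].
  by apply: dfx; rewrite ax.
- apply: derivable_within_continuous => x; rewrite in_itv/= => axb.
  by have [] := dfx _ axb.
- by rewrite in_itv/= => acb; exists c.
Qed.

Lemma derive_ge0_le f df a b : a <= b ->
  (forall x, a <= x <= b -> is_derive x 1 f (df x)) ->
  (forall x, a <= x <= b -> 0 <= df x) -> f a <= f b.
Proof.
rewrite le_eqVlt => /predU1P[-> //|ab] dfx df0.
have [c /andP[ac cb] e] := MVT_closed ab dfx.
rewrite -subr_ge0 e; apply: mulr_ge0; last by rewrite subr_ge0 ltW.
by apply: df0; rewrite !ltW.
Qed.

Lemma is_derive_addl (c x : R) : is_derive x 1 (fun y : R => c + y) 1.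
Proof.
have := is_deriveD (is_derive_cst c x (1 : R)) (is_derive_id x (1 : R)).
by rewrite add0r.
Qed.

Lemma is_derive_powR_addl (c r x : R) : 0 < c + x ->
  is_derive x 1 (fun y => (c + y) `^ r) (r * (c + x) `^ (r - 1)).
Proof.
move=> cx0.
have := is_derive1_comp (is_derive1_powR r cx0) (is_derive_addl c x).
by rewrite mulr1.
Qed.

End RealAnalysis.

(* The alternating remainder [(-1)^m ((1 + a)^(-lambda) - sum_(k < m) ...)] of
   the binomial series at 0. *)
Section BinomialRemainder.
Context {R : realType}.
Implicit Types (lambda a : R) (m k : nat).

Definition binomial_coeff lambda k : R := rising lambda k / k`!%:R.

Definition binomial_remainder lambda m a : R :=
  (-1) ^+ m * ((1 + a) `^ (- lambda)
    - \sum_(k < m) (-1) ^+ k * binomial_coeff lambda k * a ^+ k).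

Lemma binomial_remainder0 lambda a :
  binomial_remainder lambda 0 a = (1 + a) `^ (- lambda).
Proof. by rewrite /binomial_remainder big_ord0 expr0 mul1r subr0. Qed.

Lemma binomial_remainderS lambda m a : binomial_remainder lambda m.+1 a =
  binomial_coeff lambda m * a ^+ m - binomial_remainder lambda m a.
Proof.
rewrite /binomial_remainder big_ord_recr/= exprS.
set X := _ `^ _; set S := \sum_(_ < _) _.
have := sqrr_sign R m; rewrite expr2; set s := (-1) ^+ m => ss.
transitivity (- s * (X - S) + s * s * binomial_coeff lambda m * a ^+ m).
  by ring.
by rewrite ss; ring.
Qed.

Lemma binomial_coeff_gt0 lambda k : 0 < lambda -> 0 < binomial_coeff lambda k.
Proof. by move=> l0; rewrite divr_gt0 ?rising_gt0 ?ltr0n ?fact_gt0. Qed.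

Lemma binomial_coeffS lambda k :
  k.+1%:R * binomial_coeff lambda k.+1 = lambda * binomial_coeff (lambda + 1) k.
Proof.
rewrite /binomial_coeff risingSl factS natrM.
by field; rewrite !pnatr_eq0 -lt0n fact_gt0/=.
Qed.

(** Differentiation lowers the order by one and raises the exponent by one; hence inductions on the
    order keep [lambda] general. *)
Lemma is_derive_binomial_remainder lambda m a : 0 <= a ->
  is_derive a 1 (binomial_remainder lambda m.+1)
    (lambda * binomial_remainder (lambda + 1) m a).
Proof.
move=> a0; have a1 : 0 < 1 + a by rewrite ltr_wpDr.
elim: m => [|m IH].
  have -> : binomial_remainder lambda 1 = (fun x => 1 - (1 + x) `^ (- lambda)).
    apply/funext => x; rewrite binomial_remainderS binomial_remainder0.
    by rewrite /binomial_coeff rising0 fact0 divr1 expr0 mulr1.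
  apply: (is_derive_eq (is_deriveB (is_derive_cst (1 : R) a (1 : R))
    (is_derive_powR_addl (- lambda) a1))).
  by rewrite binomial_remainder0 opprD sub0r mulNr opprK.
have -> : binomial_remainder lambda m.+2 =
    (fun x => binomial_coeff lambda m.+1 * x ^+ m.+1 - binomial_remainder lambda m.+1 x).
  by apply/funext => x; rewrite (binomial_remainderS lambda m.+1).
have dX : is_derive a 1 (fun x : R => x ^+ m.+1) (m.+1%:R * a ^+ m).
  have := @is_deriveX R R id m.+1 a 1 1 (is_derive_id a (1 : R)).
  by rewrite exprfctE /GRing.scale/= mulr1.
apply: (is_derive_eq
  (is_deriveB (is_derive_scale (binomial_coeff lambda m.+1) dX) IH)).
rewrite binomial_remainderS mulrBr; congr (_ - _).
by rewrite mulrCA mulrA binomial_coeffS -mulrA.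
Qed.

(** A remainder of positive order vanishes at 0 and has a nonnegative derivative, by the case of
    order one less at [lambda + 1]. *)
Lemma binomial_remainder_ge0 lambda m a : 0 < lambda -> 0 <= a ->
  0 <= binomial_remainder lambda m a.
Proof.
elim: m lambda a => [|m IH] lambda a l0 a0.
  by rewrite binomial_remainder0 powR_ge0.
have -> : 0 = binomial_remainder lambda m.+1 0.
  rewrite /binomial_remainder addr0 powR1 big_ord_recl big1.
    by rewrite /binomial_coeff rising0 fact0 !expr0 divr1 !mulr1 addr0 subrr mulr0.
  by move=> i _; rewrite expr0n/= mulr0.
apply: derive_ge0_le a0 _ _ => x /andP[x0 _].
  exact: is_derive_binomial_remainder.
by apply: mulr_ge0; [exact: ltW|apply: IH => //; exact: addr_gt0].
Qed.

Lemma binomial_remainder_le lambda m a : 0 < lambda -> 0 <= a ->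
  binomial_remainder lambda m a <= binomial_coeff lambda m * a ^+ m.
Proof.
move=> l0 a0; rewrite -subr_ge0 -binomial_remainderS.
exact: binomial_remainder_ge0.
Qed.

End BinomialRemainder.

Section AsymptoticExpansions.
Context {R : realType}.
Implicit Types (lambda : R) (f : R -> R) (alpha beta : nat -> R) (n : nat).

(* [x^n r_n(x) -> 0] is [x^(n+1) r_(n+1)(x) -> 0] only up to a factor [1 / x];
   conversely the order [n + 1] expansion determines [alpha n]. *)
Lemma asymptotic_coeff_cvg lambda f alpha n :
  asymptotic_expansion lambda f alpha ->
  x ^+ n.+1 * remainder lambda f alpha n x @[x --> +oo] --> alpha n.
Proof.
move=> /(_ n.+1) H.
rewrite -[alpha n]add0r; apply: cvg_trans (cvgD H (cvg_cst (alpha n))).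
apply: near_eq_cvg; near=> x.
have x0 : 0 < x by near: x; exact: nbhs_pinfty_gt.
rewrite /= fctE /remainder big_ord_recr/= opprD addrA mulrDr mulrN.
by rewrite [_ * (_ / _)]mulrCA divff ?mulr1 ?subrK// expf_neq0 ?gt_eqF.
Unshelve. all: by end_near. Qed.

(** If the coefficients below [n] agree, so do the remainders of order [n], and the [n]-th
    coefficient is a limit read off from that remainder. *)
Lemma asymptotic_expansion_unique lambda f alpha beta :
  asymptotic_expansion lambda f alpha -> asymptotic_expansion lambda f beta ->
  alpha = beta.
Proof.
move=> fa fb; apply/funext => n.
elim/ltn_ind: n => n IH.
have cb := @asymptotic_coeff_cvg _ _ _ n fb.
apply: (norm_cvg_unique (@asymptotic_coeff_cvg _ _ _ n fa)).
rewrite (_ : remainder lambda f alpha n = remainder lambda f beta n)//.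
apply/funext => x; rewrite /remainder; congr (_ - _).
by apply: eq_bigr => i _; rewrite IH.
Qed.

Lemma le_asymptotic_expansion lambda f alpha (C : nat -> R) :
  (forall n (x : R), 0 < x ->
     `|remainder lambda f alpha n x| <= C n / x ^+ n.+1) ->
  asymptotic_expansion lambda f alpha.
Proof.
move=> H n; apply/cvgrPdist_lt => /= e e0.
near=> x.
have x0 : 0 < x by near: x; exact: nbhs_pinfty_gt.
rewrite sub0r normrN normrM ger0_norm ?exprn_ge0 ?ltW//.
apply: (@le_lt_trans _ _ (x ^+ n * (C n / x ^+ n.+1))).
  by rewrite ler_wpM2l ?H// exprn_ge0 ?ltW.
have -> : x ^+ n * (C n / x ^+ n.+1) = C n / x.
  by rewrite exprS; field; rewrite expf_neq0 ?gt_eqF.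
rewrite ltr_pdivrMr// -ltr_pdivrMl//.
by near: x; apply: nbhs_pinfty_gt; rewrite num_real.
Unshelve. all: by end_near. Qed.

End AsymptoticExpansions.

(** * Generalized Stieltjes transforms *)

Section IntegralAux.
Context {R : realType} d (T : measurableType d).
Variable mu : {measure set T -> \bar R}.
Implicit Types (D : set T) (f g : T -> R).

Lemma dominated_integrable D f g : measurable D -> measurable_fun D f ->
  (forall t, D t -> `|f t| <= g t) -> mu.-integrable D (EFin \o g) ->
  mu.-integrable D (EFin \o f).
Proof.
move=> mD mf fg; apply: le_integrable => //; first exact/measurable_EFinP.
move=> t Dt; rewrite /= lee_fin (le_trans (fg _ Dt))//; exact: ler_norm.
Qed.

Lemma integrable_scale D f c : measurable D -> mu.-integrable D (EFin \o f) ->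
  mu.-integrable D (EFin \o (fun t => c * f t)).
Proof.
move=> mD fi; rewrite (_ : _ \o _ = (fun t => c%:E * (EFin \o f) t)%E)//.
exact: integrableZl.
Qed.

Lemma integrable_sum_ord D n (h : nat -> T -> R) : measurable D ->
  (forall i, (i < n)%N -> mu.-integrable D (EFin \o h i)) ->
  mu.-integrable D (EFin \o (fun t => \sum_(i < n) h i t)).
Proof.
move=> mD; elim: n => [|n IH] hi.
  under eq_fun do rewrite big_ord0.
  exact: integrable0.
under eq_fun do rewrite big_ord_recr.
have := integrableD mD (IH (fun i ni => hi i (ltnW ni))) (hi n (ltnSn n)).
by [].
Qed.

Lemma Rintegral_sum_ord D n (h : nat -> T -> R) : measurable D ->
  (forall i, (i < n)%N -> mu.-integrable D (EFin \o h i)) ->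
  \int[mu]_(t in D) (\sum_(i < n) h i t) = \sum_(i < n) \int[mu]_(t in D) h i t.
Proof.
move=> mD; elim: n => [|n IH] hi.
  under eq_Rintegral do rewrite big_ord0.
  by rewrite Rintegral_cst// mul0r big_ord0.
under eq_Rintegral do rewrite big_ord_recr/=.
rewrite RintegralD//=; first by rewrite big_ord_recr/= IH// => i /ltnW; exact: hi.
  by apply: integrable_sum_ord => // i ni; apply: hi; exact: ltnW.
exact: hi.
Qed.

End IntegralAux.

Section StieltjesTransform.
Context {R : realType}.
Variable mu : {measure set R -> \bar R}.
Local Notation halfline := (`[0, +oo[%classic : set R).
Implicit Types (a x t lambda : R) (k m n : nat) (f : R -> R).

Lemma ler_powRN a x y : 0 <= a -> 0 < x -> x <= y -> y `^ (- a) <= x `^ (- a).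
Proof.
move=> a0 x0 xy; have y0 := lt_le_trans x0 xy.
rewrite !powRN lef_pV2 ?posrE ?powR_gt0//.
by rewrite ge0_ler_powR// nnegrE ltW.
Qed.

Lemma halfline_ge0 t : halfline t -> 0 <= t.
Proof. by rewrite /= in_itv/= andbT. Qed.

Lemma measurable_stieltjes k a x (D : set R) :
  measurable_fun D (fun t => t ^+ k * (x + t) `^ (- a)).
Proof. by apply: measurable_funTS; prove_measurable. Qed.

Lemma integrable_stieltjes k a x : 0 < x -> 0 <= a ->
  mu.-integrable halfline (EFin \o (fun t => t ^+ k)) ->
  mu.-integrable halfline (EFin \o (fun t => t ^+ k * (x + t) `^ (- a))).
Proof.
move=> x0 a0 ik; have mD : measurable halfline by [].
apply: (dominated_integrable mD _ _ (integrable_scale (x `^ (- a)) mD ik)).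
  exact: measurable_stieltjes.
move=> t /halfline_ge0 t0.
rewrite ger0_norm ?mulr_ge0 ?exprn_ge0 ?powR_ge0//.
by rewrite mulrC ler_wpM2r ?exprn_ge0// ler_powRN// lerDl.
Qed.

(** Two parameters, since differentiation raises [a] alone while the recursion for [c_op] raises [k]
    and [a] together. *)
Definition stieltjes k a x : R :=
  \int[mu]_(t in halfline) (t ^+ k * (x + t) `^ (- a)).

Lemma stieltjes_ge0 k a x : 0 <= stieltjes k a x.
Proof.
by apply: Rintegral_ge0 => t /halfline_ge0 t0; rewrite mulr_ge0 ?exprn_ge0 ?powR_ge0.
Qed.

Lemma is_derive_stieltjes k a x : 0 < x -> 0 <= a ->
  mu.-integrable halfline (EFin \o (fun t => t ^+ k)) ->
  is_derive x 1 (stieltjes k a) (- a * stieltjes k (a + 1) x).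
Proof.
move=> x0 a0 ik.
pose F (y t : R) : R := t ^+ k * (y + t) `^ (- a).
have dF (y t : R) : 0 < y -> halfline t ->
    is_derive y 1 (F ^~ t) (- a * (t ^+ k * (y + t) `^ (- (a + 1)))).
  move=> y0 /halfline_ge0 t0; have yt0 : 0 < t + y by rewrite ltr_wpDl.
  have := is_derive_scale (t ^+ k) (is_derive_powR_addl (- a) yt0).
  rewrite mulrCA -opprD [t + y]addrC.
  by under [X in is_derive _ _ X _ -> _]eq_fun do rewrite [t + _]addrC.
(* The derivative in [y] decreases with the base [y + t], which on []x / 2, x + 1[] is at least
   [x / 2]. *)
pose G (t : R) : R := a * (x / 2) `^ (- (a + 1)) * `|t ^+ k|.
have x2 : 0 < x / 2 by rewrite divr_gt0.
have xI : `]x / 2, x + 1[%classic x.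
  by rewrite /= in_itv/=; apply/andP; split; lra.
have I0 (y : R) : `]x / 2, x + 1[%classic y -> 0 < y.
  by rewrite /= in_itv/= => /andP[/(lt_trans x2)].
have d1F (y t : R) : `]x / 2, x + 1[%classic y -> halfline t ->
    partial1of2 F y t = - a * (t ^+ k * (y + t) `^ (- (a + 1))).
  move=> /I0 y0 Dt; rewrite partial1of2E.
  have dFyt := dF y t y0 Dt; exact: derive_val.
have intF (y : R) : `]x / 2, x + 1[%classic y -> mu.-integrable halfline (EFin \o F y).
  by move=> /I0 y0; exact: integrable_stieltjes.
have derF (y t : R) : `]x / 2, x + 1[%classic y -> halfline t -> derivable (F ^~ t) y 1.
  by move=> /I0 y0 Dt; have [] := dF y t y0 Dt.
have G0 (t : R) : 0 <= G t by rewrite !mulr_ge0// ?powR_ge0.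
have intG : mu.-integrable halfline (EFin \o G).
  apply: integrable_scale => //.
  exact: (integrable_norm ik).
have GF (y t : R) : `]x / 2, x + 1[%classic y -> halfline t -> `|partial1of2 F y t| <= G t.
  move=> Iy Dt; rewrite d1F// mulNr normrN !normrM (ger0_norm a0).
  rewrite (ger0_norm (powR_ge0 _ _)) /G -mulrA ler_wpM2l//.
  rewrite mulrC ler_wpM2r// ler_powRN ?addr_ge0//.
  move: Iy; rewrite /= in_itv/= => /andP[/ltW xy _].
  by rewrite (le_trans xy)// lerDl halfline_ge0.
have mD : measurable halfline by [].
have dS := derivable_under_integral mD xI intF derF G0 intG GF.
have eS := differentiation_under_integral mD xI intF derF G0 intG GF.
apply: DeriveDef; first exact: dS.
rewrite -derive1E eS /stieltjes -RintegralZl//.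
  by apply: eq_Rintegral => t; rewrite inE => Dt; rewrite d1F.
by apply: integrable_stieltjes => //; rewrite addr_ge0.
Qed.

Section AllMoments.
Hypothesis moments : has_all_moments mu.

Lemma integrable_exprn k : mu.-integrable halfline (EFin \o (fun t => t ^+ k)).
Proof.
have := moments 'X^k; apply: eq_integrable => // t _.
by rewrite /= hornerXn.
Qed.

Lemma derivative_sequence_stieltjes k a : 0 <= a ->
  derivative_sequence (fun n x => (-1) ^+ n * rising a n * stieltjes k (a + n%:R) x).
Proof.
move=> a0 n x x0.
have an0 : 0 <= a + n%:R by rewrite addr_ge0.
have := is_derive_scale ((-1) ^+ n * rising a n)
  (is_derive_stieltjes x0 an0 (integrable_exprn k)).
by rewrite risingS exprS -addrA natr1 mulN1r !mulrA !mulrN !mulNr.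
Qed.

Variables (lambda : R) (f : R -> R).
Hypothesis lambda_gt0 : 0 < lambda.
Hypothesis fE : forall x, 0 < x ->
  f x = \int[mu]_(t in halfline) ((x + t) `^ (- lambda)).

Let f_stieltjes x : 0 < x -> f x = stieltjes 0 lambda x.
Proof.
move=> x0; rewrite fE//; apply: eq_Rintegral => t _.
by rewrite expr0 mul1r.
Qed.

Lemma smooth_stieltjes : smooth_on_pos f.
Proof.
apply: derivative_sequence_smooth (derivative_sequence_stieltjes 0 (ltW lambda_gt0)) _.
by move=> x x0; rewrite f_stieltjes// rising0 expr0 !mul1r addr0.
Qed.

(** From [t = (x + t) - x] under the integral. *)
Lemma stieltjesS k a x : 0 < x -> 0 <= a ->
  stieltjes k.+1 (a + 1) x = stieltjes k a x - x * stieltjes k (a + 1) x.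
Proof.
move=> x0 a0; have a10 : 0 <= a + 1 by rewrite addr_ge0.
rewrite /stieltjes -RintegralZl//; last first.
  exact: (integrable_stieltjes x0 a10 (integrable_exprn k)).
rewrite -RintegralB//.
- apply: eq_Rintegral => t; rewrite inE => /halfline_ge0 t0.
  have xt0 : 0 < x + t by rewrite ltr_wpDr.
  have -> : (x + t) `^ (- a) = (x + t) * (x + t) `^ (- (a + 1)).
    rewrite -[X in _ = X * _](powRr1 (ltW xt0)) -powRD_gt0//.
    by congr (_ `^ _); ring.
  by rewrite exprS; ring.
- exact: (integrable_stieltjes x0 a0 (integrable_exprn k)).
- by apply: integrable_scale => //; apply: integrable_stieltjes (integrable_exprn k).
Qed.

(** The derivative of [c_op lambda k f] is computed twice, by the recursion and under the integral
    sign; equating the results and solving for the next operator gives the induction step. *)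
Lemma c_op_stieltjes k x : 0 < x ->
  c_op lambda k f x = rising lambda k * stieltjes k (lambda + k%:R) x.
Proof.
elim: k x => [|k IH] x x0.
  by rewrite c_op0// f_stieltjes// rising0 mul1r addr0.
have lk0 : 0 <= lambda + k%:R by rewrite addr_ge0// ltW.
have d1 := is_derive_c_op lambda k smooth_stieltjes x0.
have d2 := is_derive_eq_pos (fun y (y0 : 0 < y) => esym (IH y y0)) x0
  (is_derive_scale (rising lambda k)
    (is_derive_stieltjes x0 lk0 (integrable_exprn k))).
have := @derive_val _ _ _ _ _ _ _ d2; rewrite (@derive_val _ _ _ _ _ _ _ d1).
move/(congr1 ( *%R^~ x)); rewrite divfK ?gt_eqF//.
move/eqP; rewrite subr_eq => /eqP ->; rewrite IH//.
by rewrite risingS -natr1 [lambda + (_ + _)]addrA stieltjesS//; ring.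
Qed.

Lemma completely_monotonic_c_op k : completely_monotonic (c_op lambda k f).
Proof.
have lk0 : 0 <= lambda + k%:R by rewrite addr_ge0// ltW.
have dk : derivative_sequence (fun n x => rising lambda k *
    ((-1) ^+ n * rising (lambda + k%:R) n * stieltjes k (lambda + k%:R + n%:R) x)).
  move=> n x x0; apply: is_derive_scale.
  exact: derivative_sequence_stieltjes.
have c0 (x : R) : 0 < x -> c_op lambda k f x = rising lambda k *
    ((-1) ^+ 0 * rising (lambda + k%:R) 0 * stieltjes k (lambda + k%:R + 0%:R) x).
  by move=> x0; rewrite c_op_stieltjes// rising0 expr0 !mul1r addr0.
split; first exact: derivative_sequence_smooth dk c0.
move=> n x x0; rewrite (derivative_sequenceP dk c0)//.
rewrite mulrCA; apply: mulr_ge0; first by rewrite ltW// rising_gt0.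
rewrite !mulrA -expr2 sqrr_sign mul1r mulr_ge0 ?stieltjes_ge0//.
by rewrite ltW// rising_gt0// ltr_wpDr.
Qed.

End AllMoments.

Variables (lambda : R) (f : R -> R).
Hypothesis lambda_gt0 : 0 < lambda.
Hypothesis fE : forall x, 0 < x ->
  f x = \int[mu]_(t in halfline) ((x + t) `^ (- lambda)).
Hypothesis mass : mu.-integrable halfline (EFin \o (fun t => t ^+ 0)).

Definition stieltjes_coeff k : R :=
  (-1) ^+ k * rising lambda k * moment mu k / k`!%:R.

Lemma stieltjes_coeffE k :
  stieltjes_coeff k = (-1) ^+ k * (binomial_coeff lambda k * moment mu k).
Proof. by rewrite /stieltjes_coeff /binomial_coeff; ring. Qed.

Let binomial_remainder_scaled n x t : 0 < x -> 0 <= t ->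
  binomial_remainder lambda n (t / x) = (-1) ^+ n * (x `^ lambda * (x + t) `^ (- lambda)
    - \sum_(k < n) (-1) ^+ k * binomial_coeff lambda k / x ^+ k * t ^+ k).
Proof.
move=> x0 t0; have x0' := ltW x0; rewrite /binomial_remainder; congr (_ * (_ - _)).
  have -> : 1 + t / x = (x + t) * x^-1 by field; rewrite gt_eqF.
  rewrite powRM ?invr_ge0 ?addr_ge0// mulrC; congr (_ * _).
  by rewrite -powR_inv1// -powRrM mulN1r opprK.
by apply: eq_bigr => k _; rewrite expr_div_n; ring.
Qed.

Section FinitelyManyMoments.
Variable n : nat.
Hypothesis moments_lt :
  forall k, (k < n)%N -> mu.-integrable halfline (EFin \o (fun t => t ^+ k)).

Let ikernel x : 0 < x ->
  mu.-integrable halfline (EFin \o (fun t => x `^ lambda * (x + t) `^ (- lambda))).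
Proof.
move=> x0; apply: integrable_scale => //.
have := integrable_stieltjes x0 (ltW lambda_gt0) mass.
by apply: eq_integrable => // t _; rewrite /= expr0 mul1r.
Qed.

Let ipoly x : mu.-integrable halfline (EFin \o (fun t =>
  \sum_(k < n) (-1) ^+ k * binomial_coeff lambda k / x ^+ k * t ^+ k)).
Proof.
apply: (@integrable_sum_ord _ _ _ _ _ n (fun k t =>
  (-1) ^+ k * binomial_coeff lambda k / x ^+ k * t ^+ k)) => // k kn.
by apply: integrable_scale => //; exact: moments_lt.
Qed.

Lemma integrable_binomial_remainder x : 0 < x ->
  mu.-integrable halfline (EFin \o (fun t => binomial_remainder lambda n (t / x))).
Proof.
move=> x0.
have mD : measurable halfline by [].
have := integrable_scale ((-1) ^+ n) mD (integrableB mD (ikernel x0) (ipoly x)).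
apply: eq_integrable => // t; rewrite inE => /halfline_ge0 t0.
by rewrite /= binomial_remainder_scaled.
Qed.

(** By homogeneity, [x^(lambda - 1) (x + t)^(-lambda) = x^(-1) (1 + t/x)^(-lambda)]. Only moments of
    order below [n] are assumed, so that the identity is available in [moment_of_expansion], where
    the finiteness of the next moment is still to be proved. *)
Lemma remainder_stieltjes x : 0 < x ->
  remainder lambda f stieltjes_coeff n x =
  (-1) ^+ n / x * \int[mu]_(t in halfline) binomial_remainder lambda n (t / x).
Proof.
move=> x0.
have mD : measurable halfline by [].
under eq_Rintegral => t do [rewrite inE => /halfline_ge0 t0;
  rewrite binomial_remainder_scaled//].
rewrite RintegralZl//; last exact: (integrableB mD (ikernel x0) (ipoly x)).
rewrite RintegralB//; last exact: ikernel.
rewrite mulrCA !mulrA mulrAC -expr2 sqrr_sign mul1r.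
rewrite RintegralZl//; last first.
  have := integrable_stieltjes x0 (ltW lambda_gt0) mass.
  by apply: eq_integrable => // t _; rewrite /= expr0 mul1r.
rewrite -fE// (@Rintegral_sum_ord _ _ _ _ _ n (fun k t =>
  (-1) ^+ k * binomial_coeff lambda k / x ^+ k * t ^+ k))//; last first.
  by move=> k kn; apply: integrable_scale => //; exact: moments_lt.
rewrite /remainder mulrBl; congr (_ - _).
  by rewrite powRB_gt0// powRr1 ?ltW// mulrAC.
rewrite mulr_suml; apply: eq_bigr => k _.
rewrite RintegralZl//; last exact: moments_lt.
rewrite stieltjes_coeffE -/(moment mu k) exprS.
by field; rewrite expf_neq0 ?gt_eqF.
Qed.

End FinitelyManyMoments.

Lemma asymptotic_expansion_stieltjes : has_all_moments mu ->
  asymptotic_expansion lambda f stieltjes_coeff.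
Proof.
move=> moments.
apply: (@le_asymptotic_expansion _ _ _ _ (fun n => binomial_coeff lambda n * moment mu n)).
move=> n x x0; have im k := integrable_exprn moments k.
rewrite remainder_stieltjes//.
rewrite normrM normf_div normrX normrN normr1 expr1n (ger0_norm (ltW x0)) mul1r.
have i1 := @integrable_binomial_remainder n (fun k _ => im k) x x0.
rewrite ger0_norm; last first.
  apply: Rintegral_ge0 => t /halfline_ge0 t0.
  by apply: binomial_remainder_ge0 => //; rewrite divr_ge0// ltW.
have mD : measurable halfline by [].
rewrite exprS invfM mulrCA ler_pM2l ?invr_gt0//.
rewrite mulrAC /moment -RintegralZl//.
apply: le_Rintegral => //; first exact/integrable_scale/im.
move=> t /halfline_ge0 t0.
rewrite (le_trans (binomial_remainder_le _ _ _))// ?divr_ge0 ?(ltW x0)//.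
by rewrite expr_div_n mulrA mulrAC.
Qed.

End StieltjesTransform.

(** * Integration on the half-line *)

Section TonelliOnProducts.
Local Open Scope ereal_scope.
Context d1 d2 (T1 : measurableType d1) (T2 : measurableType d2) (R : realType).
Variables (m1 : {sigma_finite_measure set T1 -> \bar R}).
Variables (m2 : {sigma_finite_measure set T2 -> \bar R}).

Variables (A : set T1) (B : set T2) (f : T1 -> T2 -> \bar R).
Hypotheses (mA : measurable A) (mB : measurable B).
Hypothesis mf : measurable_fun (A `*` B) (fun z => f z.1 z.2).
Hypothesis f0 : forall x y, A x -> B y -> 0 <= f x y.

Let g := (fun z => f z.1 z.2) \_ (A `*` B).

Let gE x y : g (x, y) = if (x \in A) && (y \in B) then f x y else 0.
Proof. by rewrite /g patchE in_setX. Qed.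

Let mg : measurable_fun [set: T1 * T2] g.
Proof. by apply/(measurable_restrictT _ _).1 => //; exact: measurableX. Qed.

Let g0 z : 0 <= g z.
Proof.
case: z => x y; rewrite gE; case: ifPn => // /andP[xA yB].
by apply: f0; exact/set_mem.
Qed.

Let integral_g2 y : y \in B -> \int[m1]_x g (x, y) = \int[m1]_(x in A) f x y.
Proof.
move=> yB; rewrite [RHS]integral_mkcond; apply: eq_integral => x _.
by rewrite patchE gE yB andbT.
Qed.

Lemma measurable_integral_setX :
  measurable_fun B (fun y => \int[m1]_(x in A) f x y).
Proof.
apply: (eq_measurable_fun (fun y => \int[m1]_x g (x, y))).
  by move=> y yB; exact: integral_g2.
apply: measurable_funTS.
exact: (@measurable_fun_fubini_tonelli_G _ _ T1 T2 R m1 g mg g0).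
Qed.

(** Both sides are iterated integrals of the extension by zero outside the rectangle. *)
Lemma tonelli_setX : \int[m1]_(x in A) \int[m2]_(y in B) f x y =
  \int[m2]_(y in B) \int[m1]_(x in A) f x y.
Proof.
transitivity (\int[m1]_x \int[m2]_y g (x, y)).
  rewrite [LHS]integral_mkcond; apply: eq_integral => x _.
  rewrite patchE; case: ifPn => xA.
    rewrite [LHS]integral_mkcond; apply: eq_integral => y _.
    by rewrite patchE gE xA.
  by rewrite integral0_eq// => y _; rewrite gE (negbTE xA).
rewrite fubini_tonelli//.
rewrite [RHS]integral_mkcond; apply: eq_integral => y _.
rewrite patchE; case: ifPn => yB; first exact: integral_g2.
by rewrite integral0_eq// => x _; rewrite gE (negbTE yB) andbF.
Qed.

End TonelliOnProducts.

(** * Scaling of Lebesgue measure on the positive half-line *)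

Section ScalingLebesgue.
Local Open Scope ereal_scope.
Context {R : realType}.
Local Notation leb := (@lebesgue_measure R).
Local Notation pos := (`]0%R, +oo[%classic : set R).

Let mulc_measurable (c : R) :
  measurable_fun [set: measurableTypeR R]
    ( *%R c : measurableTypeR R -> measurableTypeR R).
Proof. exact: mulrl_measurable. Qed.

Let scaled (c : {nonneg R}) : {measure set (measurableTypeR R) -> \bar R}.
Proof.
apply: (mscale c (pushforward leb ( *%R c%:num : measurableTypeR R -> measurableTypeR R))).
exact: mulc_measurable.
Defined.

Let scaledE (c : {nonneg R}) (A : set R) : scaled c A =
  c%:num%:E * leb ( *%R c%:num @^-1` A).
Proof. by []. Qed.

(** Both measures give []a, b]] the length [b - a], and Lebesgue measure is determined by these
    values. *)
Let lebesgue_measure_scale (c : R) (c0 : (0 < c)%R) (A : set R) :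
  measurable A -> leb A = scaled (NngNum (ltW c0)) A.
Proof.
move=> mA; apply: lebesgue_measure_unique => //= _ [[a b]] _ <-.
rewrite scaledE/=.
have -> : ( *%R c @^-1` `]a, b]%classic)%R = `](a / c)%R, (b / c)%R]%classic.
  apply/seteqP; split=> x /=; rewrite !in_itv/=;
  by rewrite ltr_pdivrMr// ler_pdivlMr// ![(x * c)%R]mulrC.
rewrite !lebesgue_measure_itv/= !lte_fin ltr_pM2r ?invr_gt0//.
case: ifPn => ab; last by rewrite mule0.
rewrite -!EFinB -EFinM; congr EFin; field.
by rewrite gt_eqF.
Qed.

Lemma ge0_integral_scale (c : R) (f : R -> \bar R) : (0 < c)%R ->
  measurable_fun pos f -> (forall x, pos x -> 0 <= f x) ->
  \int[leb]_(x in pos) f x = c%:E * \int[leb]_(x in pos) f (c * x)%R.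
Proof.
move=> c0 mf f0.
rewrite (@eq_measure_integral _ (measurableTypeR R) _ pos (scaled (NngNum (ltW c0)))); last first.
  by move=> A mA _; exact: lebesgue_measure_scale.
rewrite /scaled ge0_integral_mscale//=; congr (_ * _).
have mpos : measurable (pos : set (measurableTypeR R)) by [].
have f0' : {in pos, forall x, 0 <= f x} by move=> x; rewrite inE; exact: f0.
apply: (etrans (ge0_integral_pushforward (mulc_measurable c) leb mpos mf f0')).
congr (integral _ _ _); apply/seteqP; split=> x /=; rewrite !in_itv/= !andbT;
by rewrite pmulr_rgt0.
Qed.

End ScalingLebesgue.

Section PositiveIntegrals.
Context {R : realType}.
Local Notation leb := (@lebesgue_measure R).
Local Notation pos := (`]0%R, +oo[%classic : set R).
Implicit Types (f F : R -> R) (x t a : R).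

Lemma measurable_pos_continuous f :
  (forall x, 0 < x -> {for x, continuous f}) -> measurable_fun pos f.
Proof.
move=> cf; apply: open_continuous_measurable_fun => //.
by move=> x; rewrite inE/= in_itv/= andbT; exact: cf.
Qed.

Lemma derivable_continuous_at f x : derivable f x 1 -> {for x, continuous f}.
Proof. by move=> /derivable1_diffP; exact: differentiable_continuous. Qed.

Lemma pos_gt0 x : pos x -> 0 < x.
Proof. by rewrite /= in_itv/= andbT. Qed.

Lemma integral_is_derive F f a b : a < b ->
  (forall x : R, a <= x <= b -> is_derive x 1 F (f x)) ->
  (forall x, a <= x <= b -> {for x, continuous f}) ->
  (\int[leb]_(x in `[a, b]) (f x)%:E = (F b)%:E - (F a)%:E)%E.
Proof.
move=> ab dF cf.
have dFx x : a <= x <= b -> derivable F x 1 by move=> /dF[].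
apply: continuous_FTC2 => //.
- apply: continuous_in_subspaceT => x; rewrite inE/= in_itv/=; exact: cf.
- split=> [x||].
  + by rewrite in_itv/= => /andP[/ltW ax /ltW xb]; apply: dFx; rewrite ax.
  + apply: cvg_at_right_filter; apply: derivable_continuous_at.
    by apply: dFx; rewrite lexx ltW.
  + apply: cvg_at_left_filter; apply: derivable_continuous_at.
    by apply: dFx; rewrite lexx ltW.
- move=> x; rewrite in_itv/= => /andP[/ltW ax /ltW xb].
  have axb : a <= x <= b by rewrite ax.
  by rewrite derive1E; have := dF x axb => ?; rewrite derive_val.
Qed.

(** Bounds on the antiderivative replace its limits at 0 and at infinity: they are applied on
    [[1/(n+2), n+2]], and monotone convergence does the rest. The shift by 2 keeps these intervals
    nondegenerate. *)
Lemma integral_bounded_antiderivative F f (m M : R) :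
  (forall x : R, 0 < x -> is_derive x 1 F (f x)) ->
  (forall x, 0 < x -> {for x, continuous f}) ->
  (forall x, 0 < x -> 0 <= f x) ->
  (forall x, 0 < x -> m <= F x <= M) ->
  (\int[leb]_(x in pos) (f x)%:E <= (M - m)%:E)%E.
Proof.
move=> dF cf f0 mM.
pose I n := `[n.+2%:R^-1, n.+2%:R]%classic : set R.
have I0 n x : I n x -> 0 < x.
  by rewrite /I/= in_itv/= => /andP[+ _]; apply: lt_le_trans; rewrite invr_gt0.
have posE : pos = \bigcup_n I n.
  apply/seteqP; split=> [x/=|x [n _ /I0 x0]]; last by rewrite /= in_itv/= x0.
  rewrite in_itv/= andbT => x0.
  pose n := maxn (Num.truncn x) (Num.truncn x^-1).
  have lt_n (y : R) : (Num.truncn y <= n)%N -> y <= n.+2%:R.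
    move=> yn; rewrite (le_trans (ltW (truncnS_gt _)))// ler_nat ltnS.
    by rewrite (leq_trans yn)// leqnSn.
  exists n => //; rewrite /I/= in_itv/=; apply/andP; split.
    rewrite -[leRHS]invrK lef_pV2 ?posrE ?invr_gt0//.
    by apply: lt_n; exact: leq_maxr.
  by apply: lt_n; exact: leq_maxl.
have mf : measurable_fun pos f by exact: measurable_pos_continuous.
have nI : nondecreasing_seq I.
  move=> i j ij; rewrite subsetEset => x; rewrite /I/= !in_itv/= => /andP[ax xb].
  rewrite (le_trans _ ax) ?(le_trans xb) ?ler_nat//.
  by rewrite lef_pV2 ?posrE// ler_nat !ltnS.
have mI n : measurable (I n) by exact: measurable_itv.
have mIf n : measurable_fun (I n) (EFin \o f).
  apply/measurable_EFinP; apply: measurable_funS mf => // x /I0 x0.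
  by rewrite /= in_itv/= x0.
have If0 n x : I n x -> (0 <= (EFin \o f) x)%E by move=> /I0 /f0; rewrite lee_fin.
have cvgI := @ge0_nondecreasing_set_cvg_integral _ (measurableTypeR R) R I (EFin \o f) leb nI mI mIf If0.
rewrite posE -(cvg_lim _ cvgI)//; apply: lime_le; first exact: cvgP cvgI.
apply: nearW => n.
have ab : n.+2%:R^-1 < n.+2%:R :> R.
  by rewrite (@lt_trans _ _ 1)// ?ltr1n// invf_lt1// ltr1n.
have Ix x : n.+2%:R^-1 <= x <= n.+2%:R -> 0 < x.
  by move=> xI; apply: (I0 n); rewrite /I/= in_itv/=.
rewrite /I (integral_is_derive ab (fun x xab => dF x (Ix x xab))); last first.
  by move=> x /Ix; exact: cf.
have Mb := mM n.+2%:R (ltr0Sn _ _).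
have Ma : m <= F n.+2%:R^-1 <= M by apply: mM; rewrite invr_gt0.
by rewrite -EFinB lee_fin lerB//; [case/andP: Mb|case/andP: Ma].
Qed.

(** For an integer [n >= a] with [n >= 1], [(1 + t)^n <= n^n (1 + t/n)^n <= n^n e^t]. *)
Lemma exp_dominates_pow a : exists2 C : R, 0 < C &
  forall t, 0 <= t -> expR (- t) * (1 + t) `^ a <= C.
Proof.
pose n := (Num.truncn a).+1.
have an : a <= n%:R by rewrite ltW// truncnS_gt.
exists (n%:R ^+ n); first by rewrite exprn_gt0.
move=> t t0; have t1 : 1 <= 1 + t by rewrite lerDl.
rewrite expRN mulrC ler_pdivrMr ?expR_gt0//.
apply: (le_trans (ler_powR t1 an)); rewrite powR_mulrn ?(le_trans ler01)//.
have -> : expR t = expR (t / n%:R) ^+ n.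
  by rewrite -expRM_natl mulrCA divff ?mulr1 ?pnatr_eq0.
rewrite -exprMn lerXn2r ?nnegrE ?mulr_ge0 ?expR_ge0 ?addr_ge0 ?ler0n//.
have le1 : 1 + t <= n%:R * (1 + t / n%:R).
  by rewrite mulrDr mulr1 mulrCA divff ?pnatr_eq0// mulr1 lerD2r ler1n.
by apply: (le_trans le1); rewrite ler_pM2l ?ltr0n// expR_ge1Dx.
Qed.

End PositiveIntegrals.

(** * The Gamma function *)

Section GammaIntegrals.
Context {R : realType}.
Local Notation leb := (@lebesgue_measure R).
Local Notation pos := (`]0%R, +oo[%classic : set R).
Implicit Types (f g : R -> R) (c t s lambda : R).

Lemma ge0_integrable d (T : measurableType d) (m : {measure set T -> \bar R})
    (D : set T) (f : T -> R) : measurable D -> measurable_fun D f ->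
  (forall x : T, D x -> 0 <= f x) -> (\int[m]_(x in D) (f x)%:E < +oo)%E ->
  m.-integrable D (EFin \o f).
Proof.
move=> mD mf f0 foo; apply/integrableP; split; first exact/measurable_EFinP.
rewrite (eq_integral (EFin \o f))// => t; rewrite inE => Dt.
by rewrite gee0_abs// lee_fin f0.
Qed.

(** A convergence test at both ends at once: the comparison function is the derivative of a bounded
    function. *)
Lemma integrable_bounded_antiderivative F f g (C m M : R) :
  measurable_fun pos f -> (forall t, 0 < t -> 0 <= f t <= C * g t) ->
  (forall x : R, 0 < x -> is_derive x 1 F (g x)) ->
  (forall x, 0 < x -> {for x, continuous g}) ->
  (forall x, 0 < x -> 0 <= g x) ->
  (forall x, 0 < x -> m <= F x <= M) ->
  leb.-integrable pos (EFin \o f).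
Proof.
move=> mf fg dF cg g0 mM.
have mpos : measurable (pos : set (measurableTypeR R)) by [].
have mg : measurable_fun pos g by exact: measurable_pos_continuous.
have ig : leb.-integrable pos (EFin \o g).
  apply: ge0_integrable => //; first by move=> t /pos_gt0; exact: g0.
  by rewrite (le_lt_trans (integral_bounded_antiderivative dF cg g0 mM)) ?ltry.
apply: (dominated_integrable mpos mf _ (integrable_scale C mpos ig)).
by move=> t /pos_gt0 t0; have /andP[f0 fC] := fg t t0; rewrite ger0_norm.
Qed.

Lemma integral_pos_gt0 f (e : R) : measurable_fun pos f ->
  (forall t, 0 < t -> 0 <= f t) -> 0 < e ->
  (forall t, 1 <= t <= 2 -> e <= f t) -> (0 < \int[leb]_(t in pos) (f t)%:E)%E.
Proof.
move=> mf f0 e0 ef.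
pose D : set R := `[1%R, 2%R]%classic.
have lebD : leb D = 1%:E.
  by rewrite /D lebesgue_measure_itv/= lte_fin ltr1n -EFinB; congr EFin; ring.
have mD : measurable D by exact: measurable_itv.
have Dpos : D `<=` pos.
  by move=> x; rewrite /D/= !in_itv/= andbT => /andP[+ _]; exact: lt_le_trans.
apply: (@lt_le_trans _ _ (\int[leb]_(t in D) e%:E)%E).
  by rewrite integral_cst//= lebD mule1 lte_fin.
apply: (@le_trans _ _ (\int[leb]_(t in D) (f t)%:E)%E).
  apply: ge0_le_integral => //.
  - by move=> x _; rewrite lee_fin ltW.
  - by apply/measurable_EFinP; apply: measurable_funS mf.
apply: ge0_subset_integral => //; first exact/measurable_EFinP.
by move=> x /pos_gt0 /f0; rewrite lee_fin.
Qed.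

Lemma measurable_gamma c (a : R) (D : set R) :
  measurable_fun D (fun t => expR (- (c * t)) * t `^ a).
Proof. by apply: measurable_funTS; prove_measurable. Qed.

Lemma gamma_kernel_ge0 c (a t : R) : 0 <= expR (- (c * t)) * t `^ a.
Proof. by rewrite mulr_ge0 ?expR_ge0 ?powR_ge0. Qed.

Let integrable_gamma1 lambda : 0 < lambda ->
  leb.-integrable pos (EFin \o (fun t => expR (- (1 * t)) * t `^ (lambda - 1))).
Proof.
move=> l0.
have [C C0 expC] := @exp_dominates_pow R (lambda + 1).
(* [F] is [(t / (1 + t))^lambda / lambda], with values between 0 and [1 / lambda]. Its derivative
   [g] has the same singularity at 0 as the integrand, and its polynomial decay at infinity
   dominates the exponential one. *)
pose F t := lambda^-1 * (t `^ lambda * (1 + t) `^ (- lambda)).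
pose g t := t `^ (lambda - 1) * (1 + t) `^ (- (lambda + 1)).
have dg t : 0 < t -> derivable g t 1.
  move=> t0; have t10 : 0 < 1 + t by rewrite addr_gt0.
  have d1 := is_derive1_powR (lambda - 1) t0.
  have d2 := is_derive_powR_addl (- (lambda + 1)) t10.
  by apply: derivableM; [case: d1|case: d2].
apply: (@integrable_bounded_antiderivative F _ g C 0 lambda^-1).
- exact: measurable_gamma.
- move=> t t0; rewrite gamma_kernel_ge0/= /g mulrCA [leRHS]mulrC.
  rewrite ler_wpM2r ?powR_ge0// mul1r powRN ler_pdivlMr ?powR_gt0 ?addr_gt0//.
  by rewrite expC// ltW.
- move=> t t0; have t10 : 0 < 1 + t by rewrite addr_gt0.
  have d1 := is_derive1_powR lambda t0.
  have d2 := is_derive_powR_addl (- lambda) t10.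
  apply: (is_derive_eq (is_derive_scale lambda^-1 (is_deriveM d1 d2))).
  rewrite /g /GRing.scale/= -opprD.
  have -> : (1 + t) `^ (- lambda) = (1 + t) * (1 + t) `^ (- (lambda + 1)).
    rewrite -[X in _ = X * _](powRr1 (ltW t10)) -powRD_gt0//.
    by congr (_ `^ _); ring.
  have -> : t `^ lambda = t * t `^ (lambda - 1) by rewrite mulr_powRB1// ltW.
  by field; rewrite gt_eqF.
- by move=> t t0; exact/derivable_continuous_at/dg.
- by move=> t t0; rewrite /g mulr_ge0 ?powR_ge0.
- move=> t t0; have t10 : 0 < 1 + t by rewrite addr_gt0.
  rewrite /F mulr_ge0 ?invr_ge0 ?mulr_ge0 ?powR_ge0 ?(ltW l0)//=.
  rewrite ler_piMr ?invr_ge0 ?(ltW l0)// powRN ler_pdivrMr ?powR_gt0// mul1r.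
  by rewrite ge0_ler_powR ?nnegrE ?(ltW l0) ?(ltW t0) ?(ltW t10)// lerDr.
Qed.

Let GammaE lambda : 0 < lambda ->
  (\int[leb]_(t in pos) (expR (- (1 * t)) * t `^ (lambda - 1))%:E = (Gamma lambda)%:E)%E.
Proof.
move=> l0; have := integrable_gamma1 l0.
have e : (fun t => expR (- (1 * t)) * t `^ (lambda - 1)) =
    (fun t => expR (- t) * t `^ (lambda - 1)).
  by apply/funext => t; rewrite mul1r.
rewrite e => ig; under eq_integral do rewrite mul1r.
by rewrite /Gamma /Rintegral fineK//; exact: integrable_fin_num ig.
Qed.

Lemma integral_gamma lambda c : 0 < lambda -> 0 < c ->
  (\int[leb]_(t in pos) (expR (- (c * t)) * t `^ (lambda - 1))%:E =
   (Gamma lambda * c `^ (- lambda))%:E)%E.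
Proof.
move=> l0 c0.
rewrite EFinM -(GammaE l0).
rewrite (@ge0_integral_scale _ c (fun t => (expR (- (1 * t)) * t `^ (lambda - 1))%:E))//; last 2 first.
- by apply/measurable_EFinP; exact: measurable_gamma.
- by move=> t _; rewrite lee_fin gamma_kernel_ge0.
rewrite muleC muleA -EFinM -ge0_integralZl//=; last 3 first.
- apply/measurable_EFinP.
  by apply: measurable_funTS; prove_measurable.
- by move=> t _; rewrite lee_fin mulr_ge0 ?expR_ge0 ?powR_ge0.
- by rewrite lee_fin mulr_ge0 ?powR_ge0 ?(ltW c0).
apply: eq_integral => t; rewrite inE => /pos_gt0 t0.
rewrite -EFinM; congr EFin; rewrite mul1r powRM ?(ltW c0) ?(ltW t0)//.
have e : c `^ (- lambda) * c * c `^ (lambda - 1) = 1.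
  by rewrite -mulrA mulr_powRB1 ?(ltW c0)// powRN mulVf// gt_eqF// powR_gt0.
by rewrite [RHS]mulrCA [X in _ = _ * X]mulrA e mul1r.
Qed.

Lemma integrable_gamma lambda c : 0 < lambda -> 0 < c ->
  leb.-integrable pos (EFin \o (fun t => expR (- (c * t)) * t `^ (lambda - 1))).
Proof.
move=> l0 c0; apply: ge0_integrable => //; first exact: measurable_gamma.
  by move=> t _; exact: gamma_kernel_ge0.
by rewrite integral_gamma// ltry.
Qed.

Lemma Rintegral_gamma lambda c : 0 < lambda -> 0 < c ->
  \int[leb]_(t in pos) (expR (- (c * t)) * t `^ (lambda - 1)) =
  Gamma lambda * c `^ (- lambda).
Proof. by move=> l0 c0; rewrite /Rintegral integral_gamma. Qed.

Lemma Gamma_gt0 lambda : 0 < lambda -> 0 < Gamma lambda.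
Proof.
move=> l0; rewrite -lte_fin -GammaE//.
apply: (@integral_pos_gt0 _ (expR (- 2) * 2^-1)).
- exact: measurable_gamma.
- by move=> t _; exact: gamma_kernel_ge0.
- by rewrite mulr_gt0 ?expR_gt0.
move=> t /andP[t1 t2]; have t0 := lt_le_trans ltr01 t1.
apply: ler_pM; rewrite ?expR_ge0 ?invr_ge0//.
  by rewrite ler_expR lerN2 mul1r.
(* On [[1, 2]], [t^(lambda - 1) = t^lambda / t >= 1/2], whatever the sign of [lambda - 1]. *)
rewrite powRB_gt0// powRr1 ?(ltW t0)// ler_pdivlMr//.
apply: (@le_trans _ _ 1); first by rewrite mulrC ler_pdivrMr ?mul1r.
have : 1 `^ lambda <= t `^ lambda.
  by rewrite ge0_ler_powR// ?nnegrE ?ler01 ?(ltW l0) ?(ltW t0).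
by rewrite powR1.
Qed.

(* Both sides are [- d/dc] at [c = 1] of
   [int e^(-ct) t^(lambda - 1) dt = Gamma(lambda) c^(-lambda)]. *)
Lemma GammaS lambda : 0 < lambda -> Gamma (lambda + 1) = lambda * Gamma lambda.
Proof.
move=> l0; have l10 : 0 < lambda + 1 by rewrite addr_gt0.
pose F (c t : R) : R := expR (- (c * t)) * t `^ (lambda - 1).
(* The factor [t] produced by differentiation raises the power to [lambda]; the exponential rate 1/2
   dominates all rates [c > 1/2] around 1. *)
pose G (t : R) : R := expR (- (2^-1 * t)) * t `^ (lambda + 1 - 1).
have dF (c t : R) : is_derive c 1 (F ^~ t) (- t * F c t).
  have d1 : is_derive c 1 (fun c : R => - t * c) (- t * 1).
    exact: is_derive_scale (is_derive_id c (1 : R)).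
  have d2 := is_derive1_comp (is_derive_expR (- t * c)) d1.
  have := is_derive_scale (t `^ (lambda - 1)) d2.
  have -> : (fun y : R => t `^ (lambda - 1) * (expR \o (fun c0 : R => - t * c0)) y) = F ^~ t.
    by apply/funext => y; rewrite /F /= mulrC mulNr [t * y]mulrC.
  move=> d3; apply: (is_derive_eq d3).
  by rewrite /F mulNr [t * c]mulrC; ring.
have mpos : measurable (pos : set (measurableTypeR R)) by [].
have I1 : `]2^-1, 2[%classic (1 : R).
  by rewrite /= in_itv/= invf_lt1// !ltr1n.
have I0 (c : R) : `]2^-1, 2[%classic c -> 0 < c.
  by rewrite /= in_itv/= => /andP[+ _]; exact: lt_trans.
have iF (c : R) : `]2^-1, 2[%classic c -> leb.-integrable pos (EFin \o F c).
  by move=> /I0 c0; exact: integrable_gamma.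
have derF (c t : R) : `]2^-1, 2[%classic c -> pos t -> derivable (F ^~ t) c 1.
  by move=> _ _; case: (dF c t).
have G0 (t : R) : 0 <= G t by exact: gamma_kernel_ge0.
have iG : leb.-integrable pos (EFin \o G).
  by apply: integrable_gamma => //; rewrite invr_gt0.
have dFE (c t : R) : partial1of2 F c t = - t * F c t.
  by rewrite partial1of2E; have := dF c t => ?; rewrite derive_val.
have FG (c t : R) : `]2^-1, 2[%classic c -> pos t -> `|partial1of2 F c t| <= G t.
  rewrite /= !in_itv/= andbT => /andP[c2 _] t0.
  rewrite dFE mulNr normrN ger0_norm; last by rewrite mulr_ge0 ?gamma_kernel_ge0// ltW.
  rewrite /F /G addrK mulrCA mulr_powRB1 ?(ltW t0)// ler_wpM2r ?powR_ge0//.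
  by rewrite ler_expR lerN2 ler_wpM2r ?(ltW t0)// ltW.
have e1 := @differentiation_under_integral R _ (measurableTypeR R) leb F pos mpos
  1 _ _ I1 iF derF G G0 iG FG.
have e2 : is_derive (1 : R) 1 (fun c => Gamma lambda * c `^ (- lambda))
    (Gamma lambda * (- lambda * 1 `^ (- lambda - 1))).
  exact/is_derive_scale/is_derive1_powR.
have e3 := is_derive_eq_pos
  (fun c (c0 : 0 < c) => esym (Rintegral_gamma l0 c0)) ltr01 e2.
have := @derive_val _ _ _ _ _ _ _ e3; rewrite -derive1E.
rewrite [X in X = _ -> _]e1 powR1 mulr1 => e4.
suff e5 : \int[leb]_(t in pos) partial1of2 F 1 t = - Gamma (lambda + 1).
  by apply: oppr_inj; rewrite -e5 e4; ring.
have := Rintegral_gamma l10 ltr01; rewrite powR1 mulr1 => <-.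
rewrite -[RHS]mulN1r -RintegralZl//; last exact: (integrable_gamma l10 ltr01).
apply: eq_Rintegral => t; rewrite inE => /pos_gt0 t0.
by rewrite dFE /F addrK -(mulr_powRB1 (ltW t0) l0); ring.
Qed.

Lemma Gamma_rising lambda k : 0 < lambda ->
  Gamma (lambda + k%:R) = rising lambda k * Gamma lambda.
Proof.
move=> l0; elim: k => [|k IH]; first by rewrite addr0 rising0 mul1r.
rewrite -natr1 addrA GammaS ?IH ?risingS; first by ring.
by rewrite ltr_wpDr.
Qed.

End GammaIntegrals.

(** * Calculus on the closed half-line and Laplace moments *)

Section OneSidedDerivatives.
Context {R : realType}.
Local Notation halfline := (`[0, +oo[%classic : set R).
Implicit Types (g : R -> R) (X : nat -> R -> R) (x y : R) (n : nat).

Lemma within_halfline_proper x : 0 <= x -> ProperFilter (within halfline x^').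
Proof.
move=> x0; apply: Build_ProperFilter_ex => A.
move=> /nbhs_ballP[e /= e0 xA]; exists (x + e / 2).
apply: xA; rewrite /ball/=.
- by rewrite opprD addNKr normrN gtr0_norm ?divr_gt0// gtr_pMr// invf_lt1// ltr1n.
- by rewrite -subr_eq0 addrC addKr gt_eqF// divr_gt0.
- by rewrite in_itv/= andbT addr_ge0// ltW// divr_gt0.
Qed.

Definition nneg_derivative_sequence X : Prop := forall n x, 0 <= x ->
  dquot (X n) x y @[y --> within halfline x^'] --> X n.+1 x.

Lemma eq_dquot_cvg g1 g2 x (l : R) : (forall y, 0 <= y -> g1 y = g2 y) -> 0 <= x ->
  dquot g1 x y @[y --> within halfline x^'] --> l ->
  dquot g2 x y @[y --> within halfline x^'] --> l.
Proof.
move=> gg x0; apply: cvg_trans; apply: near_eq_cvg.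
rewrite near_withinE; apply: nearW => y; rewrite /= in_itv/= andbT => y0.
by rewrite /dquot !gg.
Qed.

Lemma derivn_nnegE g X : nneg_derivative_sequence X ->
  (forall x, 0 <= x -> g x = X 0%N x) ->
  forall n x, 0 <= x -> derivn_nneg n g x = X n x.
Proof.
move=> dX gX; elim=> [|n IH] x x0; first exact: gX.
rewrite /derivn_nneg iterS -/(derivn_nneg n g) /deriv_nneg.
have pf := within_halfline_proper x0.
apply: cvg_lim => //; apply: eq_dquot_cvg (dX n x x0) => // y y0.
by rewrite IH.
Qed.

Lemma smooth_on_nnegP g X : nneg_derivative_sequence X ->
  (forall x, 0 <= x -> g x = X 0%N x) -> smooth_on_nneg g.
Proof.
move=> dX gX n x x0; apply/cvg_ex; exists (X n.+1 x).
apply: eq_dquot_cvg (dX n x x0) => // y y0.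
by rewrite (derivn_nnegE dX gX).
Qed.

(** A quadratic error bound on the half-line treats the endpoint 0 and the interior points alike,
    with no separate argument for the right derivative. *)
Lemma dquot_quadratic_cvg g x (l C : R) : 0 <= x ->
  (forall y, 0 <= y -> `|g y - g x - l * (y - x)| <= C * (y - x) ^+ 2) ->
  dquot g x y @[y --> within halfline x^'] --> l.
Proof.
move=> x0 gC; apply/cvgrPdist_lt => /= e e0.
pose d := e / (`|C| + 1).
have d0 : 0 < d by rewrite divr_gt0// ltr_wpDl.
apply/nbhs_ballP; exists d => //= y; rewrite /ball/= => xy yx.
rewrite in_itv/= andbT => y0; have yx0 : y - x != 0 by rewrite subr_eq0.
have -> : l - dquot g x y = - ((y - x)^-1 * (g y - g x - l * (y - x))).
  by rewrite /dquot; field.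
rewrite normrN normrM normfV ltr_pdivrMl ?normr_gt0//.
apply: (le_lt_trans (gC y y0)).
apply: (@le_lt_trans _ _ ((`|C| + 1) * `|y - x| * `|y - x|)).
  rewrite -mulrA -expr2 real_normK ?num_real// ler_wpM2r ?sqr_ge0//.
  by rewrite (le_trans (ler_norm _))// lerDl.
rewrite mulrC ltr_pM2l ?normr_gt0// mulrC -ltr_pdivlMr ?ltr_wpDl//.
by rewrite distrC.
Qed.

Lemma nneg_derivative_sequenceD X Y :
  nneg_derivative_sequence X -> nneg_derivative_sequence Y ->
  nneg_derivative_sequence (fun n x => X n x + Y n x).
Proof.
move=> dX dY n x x0; have pf := within_halfline_proper x0.
apply: cvg_trans (cvgD (dX n x x0) (dY n x x0)); apply: near_eq_cvg; apply: nearW => y.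
by rewrite /dquot/= ?fctE; ring.
Qed.

Lemma nneg_derivative_sequenceZ (c : R) X :
  nneg_derivative_sequence X ->
  nneg_derivative_sequence (fun n x => c * X n x).
Proof.
move=> dX n x x0; have pf := within_halfline_proper x0.
apply: cvg_trans (cvgM (cvg_cst c) (dX n x x0)); apply: near_eq_cvg; apply: nearW => y.
by rewrite /dquot/= ?fctE; ring.
Qed.

Lemma is_derive_dquot g x (l : R) : is_derive x 1 g l ->
  dquot g x y @[y --> within halfline x^'] --> l.
Proof.
move=> dg; have [dgx gl] := dg.
have gl' : h^-1 *: (g (h + x) - g x) @[h --> 0^'] --> l.
  have := dgx; rewrite /derivable -gl /derive => dgx'.
  rewrite [X in X @ _ --> _](_ : _ = (fun h : R => h^-1 *: (g (h *: (1 : R) + x) - g x))).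
    exact: dgx'.
  by apply/funext => h; rewrite [h *: 1]mulr1.
apply/cvgrPdist_lt => /= e e0.
move/cvgrPdist_lt : gl' => /(_ e e0) /nbhs_ballP[d /= d0 H].
apply/nbhs_ballP; exists d => //= y; rewrite /ball/= => xy yx y0.
have := H (y - x); rewrite /ball/= sub0r normrN subrK; apply.
  by rewrite distrC.
by rewrite subr_eq0.
Qed.

Lemma nneg_derivative_sequence_horner (p : {poly R}) :
  nneg_derivative_sequence (fun n x => (p^`(n)).[x]).
Proof.
move=> n x _; apply: is_derive_dquot; rewrite derivnS.
exact: is_derive_poly.
Qed.

End OneSidedDerivatives.

Section LaplaceOfMeasure.
Context {R : realType}.
Variable mu : {measure set R -> \bar R}.
Hypothesis moments : has_all_moments mu.
Local Notation halfline := (`[0, +oo[%classic : set R).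
Local Notation leb := (@lebesgue_measure R).
Local Notation pos := (`]0%R, +oo[%classic : set R).
Implicit Types (s t u x y : R) (k n : nat).

(** Taylor's inequality with constant 1, derived from [1 + z <= e^z] alone: the larger of [e^(-a)]
    and [e^(-b)], which is at most 1, is factored out, and the other exponential is estimated
    relative to it. *)
Lemma expRN_taylor_le (a b : R) : 0 <= a -> 0 <= b ->
  `|expR (- b) - expR (- a) + (b - a) * expR (- a)| <= (b - a) ^+ 2.
Proof.
move=> a0 b0; have eN1 (c : R) : 0 <= c -> expR (- c) <= 1.
  by move=> c0; rewrite -expR0 ler_expR oppr_le0.
have -> : expR (- b) - expR (- a) + (b - a) * expR (- a) =
    expR (- a) * (expR (a - b) - 1 + (b - a)).
  have -> : expR (- b) = expR (- a) * expR (a - b).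
    by rewrite -expRD; congr expR; ring.
  by ring.
rewrite normrM ger0_norm ?expR_ge0// [X in _ * X]ger0_norm; last first.
  by have := expR_ge1Dx (a - b); lra.
have [ab|ba] := leP a b.
  apply: (@le_trans _ _ (expR (a - b) - 1 + (b - a))).
    by rewrite ler_piMl ?eN1//; have := expR_ge1Dx (a - b); lra.
  have e1 := expR_ge1Dx (b - a).
  have d0 : 0 <= b - a by rewrite subr_ge0.
  have : expR (a - b) <= (1 + (b - a))^-1.
    rewrite -opprB expRN lef_pV2 ?posrE ?expR_gt0//.
    by rewrite ltr_wpDr.
  set d := b - a in d0 *; set E := expR (a - b) => Ed.
  have d10 : 0 < 1 + d by rewrite ltr_wpDr.
  apply: (@le_trans _ _ ((1 + d)^-1 - 1 + d)); first by rewrite lerD2r lerD2r.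
  rewrite -subr_ge0 [X in 0 <= X](_ : _ = d ^+ 3 / (1 + d)); last by field; rewrite gt_eqF.
  by rewrite divr_ge0 ?exprn_ge0 ?(ltW d10).
have -> : expR (- a) * (expR (a - b) - 1 + (b - a)) =
    expR (- b) * (1 - expR (- (a - b)) * (1 + (a - b))).
  have -> : expR (- b) = expR (- a) * expR (a - b).
    by rewrite -expRD; congr expR; ring.
  have -> : expR (- (a - b)) = (expR (a - b))^-1 by rewrite expRN.
  by field; rewrite gt_eqF// expR_gt0.
have e1 := expR_ge1Dx (- (a - b)).
have ab0 : 0 < a - b by rewrite subr_gt0.
apply: (@le_trans _ _ (expR (- b) * (b - a) ^+ 2)).
  rewrite ler_wpM2l ?expR_ge0// lerBlDr -lerBlDl.
  apply: (@le_trans _ _ ((1 + - (a - b)) * (1 + (a - b)))); last first.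
    by rewrite ler_wpM2r// ltW// ltr_wpDr// ltW.
  by rewrite le_eqVlt; apply/orP; left; apply/eqP; ring.
by rewrite ler_piMl ?sqr_ge0// eN1.
Qed.

(** Up to the sign [(-1)^k], the [k]-th derivative of the Laplace transform of [mu]; finite moments
    make it meaningful at [s = 0] too. *)
Definition laplace_moment k s : R :=
  \int[mu]_(t in halfline) (t ^+ k * expR (- (s * t))).

Lemma integrable_laplace_moment k s : 0 <= s ->
  mu.-integrable halfline (EFin \o (fun t => t ^+ k * expR (- (s * t)))).
Proof.
move=> s0; have mD : measurable halfline by [].
apply: (dominated_integrable mD _ _ (integrable_exprn moments k)).
  by apply: measurable_funTS; prove_measurable.
move=> t /halfline_ge0 t0.
rewrite ger0_norm ?mulr_ge0 ?exprn_ge0 ?expR_ge0// ler_piMr ?exprn_ge0//.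
by rewrite -expR0 ler_expR oppr_le0 mulr_ge0.
Qed.

Lemma laplace_moment_ge0 k s : 0 <= laplace_moment k s.
Proof.
apply: Rintegral_ge0 => t /halfline_ge0 t0.
by rewrite mulr_ge0 ?exprn_ge0 ?expR_ge0.
Qed.

Lemma laplace_moment_le k s : 0 <= s -> laplace_moment k s <= moment mu k.
Proof.
move=> s0; apply: le_Rintegral => //.
- exact: integrable_laplace_moment.
- exact: integrable_exprn.
move=> t /halfline_ge0 t0; rewrite ler_piMr ?exprn_ge0//.
by rewrite -expR0 ler_expR oppr_le0 mulr_ge0.
Qed.

Lemma laplace_moment0 k : laplace_moment k 0 = moment mu k.
Proof. by apply: eq_Rintegral => t _; rewrite mul0r oppr0 expR0 mulr1. Qed.

(** Integrating the Taylor inequality for the exponential against [t^k dmu] gives a quadratic error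
    whose constant is the moment of order [k + 2], uniformly down to [s = 0]. *)
Lemma dquot_laplace_moment k s : 0 <= s ->
  dquot (laplace_moment k) s y @[y --> within halfline s^'] --> - laplace_moment k.+1 s.
Proof.
move=> s0; apply: (@dquot_quadratic_cvg _ _ _ _ (moment mu k.+2)) => // y y0.
have mD : measurable halfline by [].
have i0 z : 0 <= z -> _ := @integrable_laplace_moment k z.
have i1 := integrable_laplace_moment k.+1 s0.
have i2 := integrable_scale (y - s) mD i1.
have i3 := integrableB mD (i0 y y0) (i0 s s0).
rewrite mulNr opprK mulrC /laplace_moment -RintegralZl// -RintegralB//; [|exact: i0|exact: i0].
rewrite -RintegralD//.
apply: (le_trans (le_normr_Rintegral mD (integrableD mD i3 i2))).
rewrite /moment mulrC -RintegralZl//; last exact: integrable_exprn.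
apply: le_Rintegral => //.
- exact: (integrable_norm (integrableD mD i3 i2)).
- exact/integrable_scale/integrable_exprn.
move=> t /halfline_ge0 t0 /=.
have := @expRN_taylor_le (s * t) (y * t) (mulr_ge0 s0 t0) (mulr_ge0 y0 t0).
rewrite -mulrBl exprMn => H.
have -> : t ^+ k * expR (- (y * t)) - t ^+ k * expR (- (s * t)) +
    (y - s) * (t ^+ k.+1 * expR (- (s * t))) =
  t ^+ k * (expR (- (y * t)) - expR (- (s * t)) + (y - s) * t * expR (- (s * t))).
  by rewrite exprS; ring.
rewrite normrM ger0_norm ?exprn_ge0// (le_trans (ler_wpM2l (exprn_ge0 k t0) H))//.
by rewrite le_eqVlt; apply/orP; left; apply/eqP; rewrite !exprS expr0; ring.
Qed.

Lemma nneg_derivative_sequence_laplace :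
  nneg_derivative_sequence (fun j s => (-1) ^+ j * laplace_moment j s).
Proof.
move=> j s s0; have pf := within_halfline_proper s0.
have -> : (-1) ^+ j.+1 * laplace_moment j.+1 s =
    (-1) ^+ j * - laplace_moment j.+1 s by rewrite exprS; ring.
have H := cvgM (cvg_cst ((-1) ^+ j : R)) (@dquot_laplace_moment j s s0).
apply: cvg_trans (H _ _); apply: near_eq_cvg; apply: nearW => y.
by rewrite /dquot/= ?fctE; ring.
Qed.

End LaplaceOfMeasure.

(** * The functions [xi] and the Laplace representation of the remainders *)

Section RemainderRepresentation.
Context {R : realType}.
Variable mu : {measure set R -> \bar R}.
Hypothesis moments : has_all_moments mu.
Local Notation halfline := (`[0, +oo[%classic : set R).
Local Notation leb := (@lebesgue_measure R).
Local Notation pos := (`]0%R, +oo[%classic : set R).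
Implicit Types (s t u x y : R) (j k n : nat).

Definition laplace_taylor n : {poly R} :=
  \poly_(k < n) ((-1) ^+ k * moment mu k / k`!%:R).

Variables (lambda : R) (f : R -> R).
Hypothesis lambda_gt0 : 0 < lambda.
Hypothesis fE : forall x, 0 < x ->
  f x = \int[mu]_(t in halfline) ((x + t) `^ (- lambda)).

Definition xi n t : R :=
  (-1) ^+ n / Gamma lambda * (laplace_moment mu 0 t - (laplace_taylor n).[t]).

Let xi_derivs n j t : R := (-1) ^+ n / Gamma lambda *
  ((-1) ^+ j * laplace_moment mu j t + -1 * ((laplace_taylor n)^`(j)).[t]).

Let nneg_derivative_sequence_xi n : nneg_derivative_sequence (xi_derivs n).
Proof.
apply: nneg_derivative_sequenceZ; apply: nneg_derivative_sequenceD.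
  exact: nneg_derivative_sequence_laplace.
by apply: nneg_derivative_sequenceZ; exact: nneg_derivative_sequence_horner.
Qed.

Let xi_derivs0 n t : 0 <= t -> xi n t = xi_derivs n 0 t.
Proof. by move=> _; rewrite /xi /xi_derivs expr0 mul1r mulN1r derivn0. Qed.

Lemma smooth_xi n : smooth_on_nneg (xi n).
Proof. exact: smooth_on_nnegP (@nneg_derivative_sequence_xi n) (@xi_derivs0 n). Qed.

Lemma derivn_xi_at0 n j : (j < n)%N -> derivn_nneg j (xi n) 0 = 0.
Proof.
move=> jn.
rewrite (derivn_nnegE (@nneg_derivative_sequence_xi n) (@xi_derivs0 n))//.
rewrite /xi_derivs laplace_moment0 horner_coef0 coef_derivn addn0 ffactnn.
rewrite coef_poly jn -[_ / _ *+ _]mulr_natr divfK ?pnatr_eq0 -?lt0n ?fact_gt0//.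
by rewrite mulN1r subrr mulr0.
Qed.

(** The [n]-th derivative annihilates the Taylor polynomial, of degree below [n], and the two signs
    cancel; [laplace_moment mu n t / Gamma lambda] remains. *)
Lemma derivn_xi_bounds n t : 0 <= t ->
  0 <= derivn_nneg n (xi n) t <= moment mu n / Gamma lambda.
Proof.
move=> t0; have G0 := Gamma_gt0 lambda_gt0.
rewrite (derivn_nnegE (@nneg_derivative_sequence_xi n) (@xi_derivs0 n))//.
rewrite /xi_derivs derivn_poly0 ?size_poly// horner0 mulr0 addr0.
rewrite mulrACA -expr2 sqrr_sign mul1r mulrC.
rewrite divr_ge0 ?laplace_moment_ge0 ?(ltW G0)//=.
by rewrite ler_pM2r ?invr_gt0// laplace_moment_le.
Qed.

Let mpos : measurable (pos : set (measurableTypeR R)). Proof. by []. Qed.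

Let D_finite : (mu halfline < +oo)%E.
Proof.
have /integrableP[_] := integrable_exprn moments 0.
rewrite (eq_integral (cst 1%E))//; last by move=> t _; rewrite /= expr0 normr1.
by rewrite integral_cst// mul1e.
Qed.

Let measurable_laplace : measurable_fun pos (laplace_moment mu 0).
Proof.
(* Clamping the argument at 0 makes the function monotone on the whole line; at negative arguments
   the integral need not converge. *)
have maxE : {in pos, (fun t => laplace_moment mu 0 (Num.max 0 t)) =1 laplace_moment mu 0}.
  by move=> t; rewrite inE => /pos_gt0 t0; rewrite max_r// ltW.
apply: (eq_measurable_fun _ maxE).
apply: nonincreasing_measurable => // s t st.
apply: le_Rintegral => //.
- by apply: integrable_laplace_moment => //; rewrite le_max lexx.
- by apply: integrable_laplace_moment => //; rewrite le_max lexx.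
move=> u /halfline_ge0 u0; rewrite ler_wpM2l ?exprn_ge0//.
by rewrite ler_expR lerN2 ler_wpM2r// ge_max !le_max lexx st orbT.
Qed.

(* Tonelli applied to [e^(-(x + u) t) t^(lambda - 1)]. *)
Let integral_laplace x : 0 < x ->
  (\int[leb]_(t in pos)
    (expR (- (x * t)) * t `^ (lambda - 1) * laplace_moment mu 0 t)%:E =
   (Gamma lambda * f x)%:E)%E.
Proof.
move=> x0.
have mD : measurable halfline by [].
(* Tonelli's theorem asks for a sigma-finite measure. On the half-line [mu] is finite, its moment of
   order 0 being finite; nothing is known of it elsewhere. *)
pose nu := mfrestr mD D_finite.
have toN (g : R -> \bar R) :
    (\int[mu]_(u in halfline) g u = \int[nu]_(u in halfline) g u)%E.
  by apply: eq_measure_integral => A mA AD; rewrite /nu /= /mfrestr /mrestr setIidl.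
pose h (t u : R) : \bar R := (expR (- (x * t)) * t `^ (lambda - 1) * expR (- (t * u)))%:E.
have h0 t u : (0 <= h t u)%E by rewrite lee_fin !mulr_ge0 ?expR_ge0 ?powR_ge0.
transitivity (\int[leb]_(t in pos) \int[nu]_(u in halfline) h t u)%E.
  apply: eq_integral => t; rewrite inE => /pos_gt0/ltW t0.
  have i0 := integrable_laplace_moment moments 0 t0.
  rewrite -toN /h EFinM /laplace_moment /Rintegral fineK; last first.
    exact: integrable_fin_num i0.
  rewrite -ge0_integralZl//; last 3 first.
  - by apply/measurable_EFinP; apply: measurable_funTS; prove_measurable.
  - by move=> u /halfline_ge0 u0; rewrite lee_fin mulr_ge0 ?exprn_ge0 ?expR_ge0.
  - by rewrite lee_fin mulr_ge0 ?expR_ge0 ?powR_ge0.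
  by apply: eq_integral => u _; rewrite -EFinM expr0 mul1r.
rewrite tonelli_setX//; last first.
  by apply/measurable_EFinP; apply: measurable_funTS; prove_measurable.
transitivity (\int[nu]_(u in halfline) (Gamma lambda * (x + u) `^ (- lambda))%:E)%E.
  apply: eq_integral => u; rewrite inE => /halfline_ge0 u0.
  have xu0 : 0 < x + u by rewrite ltr_wpDr.
  rewrite -integral_gamma//; apply: eq_integral => t _.
  rewrite /h mulrAC -expRD; congr ((expR _ * _)%:E); ring.
have := integrable_stieltjes x0 (ltW lambda_gt0) (integrable_exprn moments 0).
move=> /(integrable_scale (Gamma lambda) mD)/integrable_fin_num.
rewrite -toN fE// => fin.
have is0 : mu.-integrable halfline (EFin \o (fun t => (x + t) `^ (- lambda))).
  have := integrable_stieltjes x0 (ltW lambda_gt0) (integrable_exprn moments 0).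
  by apply: eq_integrable => // t _; rewrite /= expr0 mul1r.
rewrite -RintegralZl// /Rintegral fineK//.
exact: integrable_fin_num (integrable_scale (Gamma lambda) mD is0).
Qed.

Let laplace_kernel x t := expR (- (x * t)) * t `^ (lambda - 1).

Let integrable_laplace x : 0 < x -> leb.-integrable pos
  (EFin \o (fun t => laplace_kernel x t * laplace_moment mu 0 t)).
Proof.
move=> x0; apply: ge0_integrable => //.
- by apply: measurable_funM => //; exact: measurable_gamma.
- by move=> t _; rewrite mulr_ge0 ?gamma_kernel_ge0 ?laplace_moment_ge0.
- by rewrite integral_laplace ?ltry.
Qed.

Let laplace_kernelX x t k : 0 < t ->
  laplace_kernel x t * t ^+ k = expR (- (x * t)) * t `^ (lambda + k%:R - 1).
Proof.
move=> t0; rewrite /laplace_kernel -mulrA -powR_mulrn ?(ltW t0)// -powRD_gt0//.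
by congr (_ * _ `^ _); ring.
Qed.

Let coeff k : R := (-1) ^+ k * moment mu k / k`!%:R.

Let integrable_laplace_pow x k : 0 < x -> leb.-integrable pos
  (EFin \o (fun t => coeff k * (laplace_kernel x t * t ^+ k))).
Proof.
move=> x0; apply: integrable_scale => //.
have lk : 0 < lambda + k%:R by rewrite ltr_wpDr.
have := integrable_gamma lk x0; apply: eq_integrable => // t; rewrite inE => /pos_gt0 t0.
by rewrite /= laplace_kernelX.
Qed.

Let laplace_xiE n x t : expR (- (x * t)) * (t `^ (lambda - 1) * xi n t) =
  (-1) ^+ n / Gamma lambda * (laplace_kernel x t * laplace_moment mu 0 t
    - \sum_(k < n) coeff k * (laplace_kernel x t * t ^+ k)).
Proof.
rewrite /xi horner_poly.
have -> : \sum_(k < n) coeff k * (laplace_kernel x t * t ^+ k) =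
    laplace_kernel x t * \sum_(k < n) coeff k * t ^+ k.
  by rewrite mulr_sumr; apply: eq_bigr => k _; rewrite mulrCA.
by rewrite /laplace_kernel /coeff; ring.
Qed.

Let integrable_laplace_xi_pos n x : 0 < x -> leb.-integrable pos
  (EFin \o (fun t => expR (- (x * t)) * (t `^ (lambda - 1) * xi n t))).
Proof.
move=> x0; rewrite (funext (laplace_xiE n x)); apply: integrable_scale => //.
have i2 : leb.-integrable pos (EFin \o (fun t =>
    \sum_(k < n) coeff k * (laplace_kernel x t * t ^+ k))).
  apply: (@integrable_sum_ord _ _ (measurableTypeR R) leb pos n (fun k t =>
    coeff k * (laplace_kernel x t * t ^+ k))) => // k _.
  exact: integrable_laplace_pow.
exact: (integrableB mpos (integrable_laplace x0) i2).
Qed.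

Lemma integrable_laplace_xi n x : 0 < x -> leb.-integrable halfline
  (EFin \o (fun t => expR (- (x * t)) * (t `^ (lambda - 1) * xi n t))).
Proof.
move=> /(integrable_laplace_xi_pos n)/integrableP[mf foo].
apply/integrableP; split; first exact/emeasurable_fun_itv_obnd_cbndP.
by rewrite -integral_itv_obnd_cbnd//; exact: measurableT_comp.
Qed.

(** Term by term, as in Watson's lemma but as an identity: [Gamma (lambda + k) = rising lambda k *
    Gamma lambda] turns the Taylor coefficients at 0 of the Laplace transform of [mu] into the
    coefficients of the expansion of [f] at infinity. *)
Lemma Laplace_xi n x : 0 < x ->
  remainder lambda f (stieltjes_coeff mu lambda) n x =
  (-1) ^+ n * x `^ (lambda - 1) * Laplace (fun t => t `^ (lambda - 1) * xi n t) x.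
Proof.
move=> x0; have G0 := Gamma_gt0 lambda_gt0.
rewrite /Laplace -Rintegral_itv_obnd_cbnd; last exact: integrable_laplace_xi_pos.
under eq_Rintegral do rewrite laplace_xiE.
have i2 k : (k < n)%N -> leb.-integrable pos (EFin \o (fun t =>
    coeff k * (laplace_kernel x t * t ^+ k))).
  by move=> _; exact: integrable_laplace_pow.
have i3 := @integrable_sum_ord _ _ (measurableTypeR R) leb pos n (fun k t =>
    coeff k * (laplace_kernel x t * t ^+ k)) mpos i2.
have i1 := integrable_laplace x0.
rewrite RintegralZl//; last exact: (integrableB mpos i1 i3).
rewrite RintegralB// (@Rintegral_sum_ord _ _ (measurableTypeR R) leb pos n (fun k t =>
    coeff k * (laplace_kernel x t * t ^+ k)))//.
have -> : \sum_(k < n) \int[leb]_(t in pos) (coeff k * (laplace_kernel x t * t ^+ k)) =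
    \sum_(k < n) Gamma lambda *
      (stieltjes_coeff mu lambda k / x ^+ k * x `^ (- lambda)).
  apply: eq_bigr => k _.
  have lk : 0 < lambda + k%:R by rewrite ltr_wpDr.
  have ig := integrable_gamma lk x0.
  transitivity (\int[leb]_(t in pos) (coeff k *
      (expR (- (x * t)) * t `^ (lambda + k%:R - 1)))).
    by apply: eq_Rintegral; move=> t; rewrite inE => /pos_gt0 t0; rewrite laplace_kernelX.
  rewrite RintegralZl// Rintegral_gamma// Gamma_rising// opprD powRD_gt0//.
  rewrite (powRN x k%:R) powR_mulrn ?(ltW x0)// /stieltjes_coeff /coeff.
  by field; rewrite pnatr_eq0 -lt0n fact_gt0 expf_neq0 ?gt_eqF.
have -> : \int[leb]_(t in pos) (laplace_kernel x t * laplace_moment mu 0 t) =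
    Gamma lambda * f x by rewrite /Rintegral integral_laplace.
rewrite -mulr_sumr -mulr_suml -mulrBr.
have ss := sqrr_sign R n; rewrite expr2 in ss.
rewrite [RHS](_ : _ = (-1) ^+ n * (-1) ^+ n * x `^ (lambda - 1) * (f x -
  (\sum_(k < n) stieltjes_coeff mu lambda k / x ^+ k) * x `^ (- lambda))); last first.
  by field; rewrite gt_eqF.
rewrite ss mul1r mulrBr /remainder; congr (_ - _).
rewrite mulrCA -powRD_gt0// addrAC subrr add0r powR_inv1 ?(ltW x0)// mulr_suml.
by apply: eq_bigr => k _; rewrite exprS; field; rewrite expf_neq0 ?gt_eqF.
Qed.

End RemainderRepresentation.

(** * What an asymptotic expansion says of [c_op] and of the additive constant *)

Section RemainderDerivative.
Context {R : realType}.
Implicit Types (lambda x y c : R) (f : R -> R) (alpha : nat -> R) (n : nat).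

Lemma derivative_sequence_horner (p : {poly R}) :
  derivative_sequence (fun n x => (p^`(n)).[x]).
Proof. by move=> n x _; rewrite derivnS; exact: is_derive_poly. Qed.

(* [y^(lambda - 1 + n) f(y) - y^n r_n(y)] is a polynomial of degree less than
   [n]. *)
Lemma c_op_remainder lambda f alpha n x : smooth_on_pos f -> 0 < x ->
  c_op lambda n f x = x `^ (1 - lambda) *
    derive1n n (fun y => y ^+ n * remainder lambda f alpha n y) x.
Proof.
move=> sf x0; rewrite /c_op; congr (_ * _).
(* Since [y^n / y^(j+1) = y^(n-1-j)], the coefficients appear in reverse order. *)
pose p : {poly R} := - \poly_(k < n) alpha (n - k.+1)%N.
have sp : smooth_on_pos (fun y => p.[y]).
  by apply: derivative_sequence_smooth (derivative_sequence_horner p) _ => y _; rewrite derivn0.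
have pn : derive1n n (fun y => p.[y]) x = 0.
  rewrite (derivative_sequenceP (derivative_sequence_horner p))//.
  by rewrite derivn_poly0 ?horner0// size_polyN size_poly.
rewrite (@eq_derive1n_pos _ (fun y => y ^+ n * remainder lambda f alpha n y)
  ((fun y => y `^ (lambda - 1 + n%:R) * f y) \+ (fun y => p.[y])))//.
  rewrite derive1nD_pos//; last exact: smooth_c_base.
  by rewrite pn addr0.
move=> y y0; rewrite /= /remainder mulrBr; congr (_ + _).
  by rewrite (powRD_gt0 (lambda - 1) n%:R y0) powR_mulrn ?(ltW y0)//; ring.
rewrite hornerN horner_poly; congr (- _).
rewrite mulr_sumr (reindex_inj rev_ord_inj)/=; apply: eq_bigr => k _.
rewrite mulrCA; congr (_ * _).
rewrite subnSK// -[in y ^+ n](subnK (ltnW (ltn_ord k))) exprD -mulrA.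
by rewrite mulrCA divff ?mulr1// expf_neq0// gt_eqF.
Qed.

(** The expansion keeps [x^lambda f(x)] bounded near infinity, while [f >= c] makes it at least
    [c x^lambda]. *)
Lemma stieltjes_constant_eq0 (mu : {measure set R -> \bar R}) lambda c f alpha :
  0 < lambda -> generalized_Stieltjes lambda mu c f ->
  asymptotic_expansion lambda f alpha -> c = 0.
Proof.
move=> l0 [c0 fE] fa; apply/eqP; rewrite eq_le c0 andbT leNgt; apply/negP => cgt0.
have := @asymptotic_coeff_cvg _ _ _ _ 0 fa.
move/cvgrPdist_lt => /(_ 1 ltr01) H.
pose B := `|alpha 0%N| + 1.
have : \forall x \near +oo, c * (x : R) `^ lambda < B.
  near=> x.
  have x0 : 0 < x by near: x; exact: nbhs_pinfty_gt.
  have Hx : `|alpha 0%N - x ^+ 1 * remainder lambda f alpha 0 x| < 1 by near: x.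
  apply: (@le_lt_trans _ _ (x ^+ 1 * remainder lambda f alpha 0 x)).
    rewrite /remainder big_ord0 subr0 expr1 mulrA mulr_powRB1 ?(ltW x0)//.
    rewrite mulrC ler_wpM2l ?powR_ge0//.
    have [_ ->] := fE x x0; rewrite lerDr.
    by apply: Rintegral_ge0 => t _; exact: powR_ge0.
  move: Hx; rewrite ltr_norml => /andP[Hx _].
  have := ler_norm (alpha 0%N); rewrite /B; lra.
move=> H2.
have H3 : \forall x \near +oo, B / c < (x : R) `^ lambda.
  exists ((B / c) `^ lambda^-1); split; first by rewrite num_real.
  move=> x Bx; have x0 : 0 < x by exact: le_lt_trans (powR_ge0 _ _) Bx.
  have y0 : 0 <= B / c by rewrite divr_ge0// addr_ge0.
  have -> : B / c = ((B / c) `^ lambda^-1) `^ lambda.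
    by rewrite -powRrM mulVf ?gt_eqF// powRr1.
  by apply: gt0_ltr_powR; rewrite ?nnegrE ?powR_ge0 ?(ltW x0).
have [x [+ xB]] := filter_ex (filterI H2 H3).
by move: xB; rewrite ltr_pdivrMr// mulrC => /lt_trans h /h; rewrite ltxx.
Unshelve. all: by end_near. Qed.

End RemainderDerivative.

Section RemainderOfStieltjes.
Context {R : realType}.
Variables (lambda : R) (f : R -> R) (mu : {measure set R -> \bar R}).
Variables (c : R) (alpha : nat -> R).
Hypotheses (lambda_gt0 : 0 < lambda) (fmu : generalized_Stieltjes lambda mu c f).
Hypotheses (moments : has_all_moments mu).
Hypotheses (falpha : asymptotic_expansion lambda f alpha).

Let fE (x : R) : 0 < x -> f x = \int[mu]_(t in `[0, +oo[) ((x + t) `^ (- lambda)).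
Proof.
move=> x0; have c0 := stieltjes_constant_eq0 lambda_gt0 fmu falpha.
by have [_ /(_ x x0)[_ ->]] := fmu; rewrite c0 addr0.
Qed.

Lemma asymptotic_coeffE : alpha = stieltjes_coeff mu lambda.
Proof.
apply: asymptotic_expansion_unique falpha _.
apply: asymptotic_expansion_stieltjes => //; exact: integrable_exprn.
Qed.

(** Both sides differentiate the same function: by the representation of the remainder, [x^n r_n(x)]
    is [x^(lambda - 1 + n)] times this Laplace transform. *)
Lemma c_op_Laplace_xi n (x : R) : 0 < x -> c_op lambda n f x = c_op lambda n
  (Laplace (fun t => t `^ (lambda - 1) * ((-1) ^+ n * xi mu lambda n t))) x.
Proof.
move=> x0; have sf := smooth_stieltjes moments lambda_gt0 fE.
rewrite (@c_op_remainder _ _ _ alpha n _ sf x0); congr (_ * _).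
apply: eq_derive1n_pos => // y y0.
rewrite asymptotic_coeffE (Laplace_xi moments lambda_gt0 fE)//.
have -> : Laplace (fun t => t `^ (lambda - 1) * ((-1) ^+ n * xi mu lambda n t)) y =
    (-1) ^+ n * Laplace (fun t => t `^ (lambda - 1) * xi mu lambda n t) y.
  rewrite /Laplace -RintegralZl//; last exact: (integrable_laplace_xi moments lambda_gt0 fE).
  by apply: eq_Rintegral => t _; ring.
by rewrite (powRD_gt0 (lambda - 1) n%:R y0) powR_mulrn ?(ltW y0)//; ring.
Qed.

End RemainderOfStieltjes.

(** * Completely monotone functions *)

Section TaylorAtInfinity.
Context {R : realType}.
Local Notation leb := (@lebesgue_measure R).
Local Notation pos := (`]0%R, +oo[%classic : set R).
Implicit Types (A G : nat -> R -> R) (x s t : R) (n : nat).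

(** The signs are absorbed: [A n] is [(-1)^n] times the [n]-th derivative of [A 0]. All entries are
    then nonnegative, and dropping the first one leaves a sequence of the same kind. *)
Definition cm_sequence A : Prop :=
  (forall n (x : R), 0 < x -> is_derive x 1 (A n) (- A n.+1 x)) /\
  (forall n x, 0 < x -> 0 <= A n x).

Lemma cm_sequence_shift A : cm_sequence A -> cm_sequence (fun n => A n.+1).
Proof. by move=> [dA A0]; split=> [n x|n x]; [exact: dA|exact: A0]. Qed.

Lemma cm_sequence_alternating G : derivative_sequence G ->
  (forall n x, 0 < x -> 0 <= (-1) ^+ n * G n x) ->
  cm_sequence (fun n x => (-1) ^+ n * G n x).
Proof.
move=> dG G0; split=> // n x x0.
apply: (is_derive_eq (is_derive_scale ((-1) ^+ n) (dG n x x0))).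
by rewrite exprS; ring.
Qed.

Section Bounds.
Variable A : nat -> R -> R.
Hypothesis cmA : cm_sequence A.
Let dA := cmA.1.
Let A0 := cmA.2.

Lemma cm_continuous n x : 0 < x -> {for x, continuous (A n)}.
Proof. by move=> x0; apply: derivable_continuous_at; case: (dA n x0). Qed.

Lemma measurable_cm n : measurable_fun pos (A n).
Proof. by apply: measurable_pos_continuous => x; exact: cm_continuous. Qed.

Lemma cm_nonincreasing n x y : 0 < x -> x <= y -> A n y <= A n x.
Proof.
move=> x0 xy; rewrite -lerN2.
apply: (@derive_ge0_le _ (fun z => - A n z) (A n.+1)) => // z /andP[xz _].
  have z0 := lt_le_trans x0 xz.
  by apply: (is_derive_eq (is_deriveN (dA n z0))); rewrite opprK.
exact/A0/(lt_le_trans x0).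
Qed.

(** The mean value theorem on [[x/2, x]], where [A n.+1] is smallest at the right end. *)
Lemma cm_derivative_le n x : 0 < x -> A n.+1 x <= 2 / x * A n (x / 2).
Proof.
move=> x0; have x20 : 0 < x / 2 by rewrite divr_gt0.
have x2x : x / 2 < x by rewrite ltr_pdivrMr// ltr_pMr// ltr1n.
have [c /andP[xc cx]] := @MVT_closed _ (A n) (fun z => - A n.+1 z) _ _ x2x
  (fun z zI => dA n (lt_le_trans x20 (proj1 (andP zI)))).
have c0 := lt_trans x20 xc.
have Ac := cm_nonincreasing n.+1 c0 (ltW cx).
have Ax := A0 n x0.
have -> : x - x / 2 = x / 2 by field.
move=> e; rewrite mulrAC ler_pdivlMr// mulrC.
have : x / 2 * A n.+1 x <= x / 2 * A n.+1 c by rewrite ler_pM2l.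
lra.
Qed.

Lemma cm_derivative_cvg0 n :
  A n x @[x --> +oo] --> (0 : R) -> A n.+1 x @[x --> +oo] --> (0 : R).
Proof.
move=> /cvgrPdist_lt H; apply/cvgrPdist_lt => e e0.
have [M [Mreal HM]] := H e e0.
exists (Num.max 2 (2 * M)); split; first by rewrite num_real.
move=> x; rewrite gt_max => /andP[x2 Mx].
have x0 : 0 < x by exact: lt_trans x2.
have := HM (x / 2); rewrite ltr_pdivlMr// mulrC => /(_ Mx).
rewrite /= !sub0r !normrN !ger0_norm ?A0 ?divr_gt0//.
apply: le_lt_trans; apply: (le_trans (cm_derivative_le n x0)).
by rewrite ler_piMl ?A0 ?divr_gt0// ler_pdivrMr// mul1r ltW.
Qed.

(** Each use of [cm_derivative_le] costs [2/x], and evaluating [x^(-n)] at [x/2] costs [2^n] more;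
    hence the factor [2^(n+1)]. *)
Lemma cm_bound M : (forall x, 0 < x -> A 0%N x <= M) ->
  forall n, exists2 C, 0 <= C & forall x, 0 < x -> A n x <= C / x ^+ n.
Proof.
move=> A0M; elim=> [|n [C C0 IH]].
  exists M => [|x x0]; last by rewrite expr0 divr1 A0M.
  exact: le_trans (A0 0%N ltr01) (A0M _ ltr01).
exists (2 ^+ n.+1 * C) => [|x x0]; first by rewrite mulr_ge0 ?exprn_ge0.
apply: (le_trans (cm_derivative_le n x0)).
have x20 : 0 < x / 2 by rewrite divr_gt0.
have x2 : 0 <= 2 / x by rewrite divr_ge0// ltW.
apply: (le_trans (ler_wpM2l x2 (IH _ x20))).
rewrite expr_div_n !exprS le_eqVlt; apply/orP; left; apply/eqP.
by field; rewrite expf_neq0 ?gt_eqF// expf_neq0.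
Qed.

End Bounds.

Lemma cm_taylor0 A x : cm_sequence A -> A 0%N y @[y --> +oo] --> (0 : R) ->
  0 < x -> ((A 0%N x)%:E = \int[leb]_(s in `[x, +oo[) (A 1%N s)%:E)%E.
Proof.
move=> cmA Ay x0; have dA := cmA.1; have A0 := cmA.2.
have -> : A 0%N x = 0 - (- A 0%N x) by rewrite opprK add0r.
rewrite EFinB -(@ge0_continuous_FTC2y _ (A 1%N) (fun y => - A 0%N y) x 0)//.
- by move=> y xy; exact/A0/(lt_le_trans x0).
- apply: continuous_in_subspaceT => y; rewrite inE/= in_itv/= andbT => xy.
  by apply: (cm_continuous cmA); exact: lt_le_trans xy.
- by rewrite -oppr0; exact: cvgN.
- by move=> y xy; have /is_deriveN[] := dA 0%N y (lt_trans x0 xy).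
- apply: cvg_at_right_filter; apply: cvgN.
  exact: (cm_continuous cmA).
- move=> y; rewrite in_itv/= andbT => xy; rewrite derive1E.
  have d1 := is_deriveN (dA 0%N y (lt_trans x0 xy)).
  by rewrite derive_val opprK.
Qed.

(* Integrating the Taylor formula of order [n] for [A 1] over [x, oo) and
   exchanging the integrals raises the order by one. *)
Lemma cm_taylor n A x : cm_sequence A -> A 0%N y @[y --> +oo] --> (0 : R) ->
  0 < x -> ((A 0%N x)%:E =
    \int[leb]_(s in `[x, +oo[) (A n.+1 s * ((s - x) ^+ n / n`!%:R))%:E)%E.
Proof.
elim: n A x => [|n IH] A x cmA Ay x0.
  by under eq_integral do rewrite expr0 fact0 divr1 mulr1; exact: cm_taylor0.
pose D : set R := `[x, +oo[%classic.
have mD : measurable (D : set (measurableTypeR R)) by exact: measurable_itv.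
have Dx t : D t -> x <= t by rewrite /D/= in_itv/= andbT.
have Dpos t : D t -> 0 < t by move=> /Dx; exact: lt_le_trans.
have cmA1 := cm_sequence_shift cmA.
have A1 := cm_derivative_cvg0 cmA Ay.
pose B s := (A n.+2 \_ pos) s.
have BE s : 0 < s -> B s = A n.+2 s.
  by move=> s0; rewrite /B patchE mem_set//= in_itv/= s0.
have B0 s : 0 <= B s.
  rewrite /B patchE; case: ifPn => // /set_mem/pos_gt0; exact: cmA.2.
have mB : measurable_fun [set: R] B.
  by apply/(measurable_restrictT _ _).1 => //; exact: (measurable_cm cmA).
(* The triangle [x <= t <= s] becomes a square with an integrand vanishing for [s < t], to which
   Tonelli's theorem on products applies. *)
pose h t s : R := if t <= s then B s * ((s - t) ^+ n / n`!%:R) else 0.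
have h0 t s : 0 <= h t s.
  rewrite /h; case: ifPn => // ts; rewrite mulr_ge0// divr_ge0//.
  by rewrite exprn_ge0// subr_ge0.
have mh : measurable_fun [set: measurableTypeR R * measurableTypeR R] (fun z => (h z.1 z.2)%:E).
  apply/measurable_EFinP/measurable_fun_ifT => //.
    by apply: measurable_fun_ler; prove_measurable.
  apply: measurable_funM; first exact: (measurableT_comp mB measurable_snd).
  by prove_measurable.
transitivity (\int[leb]_(t in D) \int[leb]_(s in D) (h t s)%:E)%E.
  rewrite (cm_taylor0 cmA Ay x0); apply: eq_integral => t; rewrite inE => Dt.
  rewrite (IH _ _ cmA1 A1 (Dpos _ Dt)).
  rewrite integral_mkcond [RHS]integral_mkcond; apply: eq_integral => s _.
  rewrite !patchE /h; have [ts|st] := leP t s.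
    have Ds : D s by rewrite /D/= in_itv/= andbT (le_trans (Dx _ Dt)).
    by rewrite !mem_set//= ?in_itv/= ?ts// BE//; exact: Dpos.
  rewrite memNset/=; last by rewrite in_itv/= andbT leNgt st.
  by case: ifPn.
rewrite tonelli_setX//.
- apply: eq_integral => s; rewrite inE => Ds; have s0 := Dpos _ Ds.
  transitivity (\int[leb]_(t in `[x, s]) (B s * ((s - t) ^+ n / n`!%:R))%:E)%E.
    rewrite integral_mkcond [RHS]integral_mkcond; apply: eq_integral => t _.
    rewrite !patchE /h; have [ts|st] := leP t s.
      case: ifPn => [/set_mem Dt|nDt]; first by rewrite mem_set//= in_itv/= Dx.
      rewrite memNset//= in_itv/= => /andP[xt _]; move/negP: nDt; apply.
      by rewrite mem_set// /D/= in_itv/= xt.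
    rewrite if_same memNset//=.
    by rewrite in_itv/= => /andP[_]; rewrite leNgt st.
  have := Dx _ Ds; rewrite le_eqVlt => /predU1P[xs|xs].
    by rewrite -xs set_itv1 integral_set1 subrr expr0n mul0r mulr0.
  have dF (t : R) : is_derive t 1 (fun t => - (B s / n.+1`!%:R) * (s - t) ^+ n.+1)
      (B s * ((s - t) ^+ n / n`!%:R)).
    have d1 : is_derive t 1 (fun t : R => s - t) (- 1).
      have := is_deriveB (is_derive_cst s t (1 : R)) (is_derive_id t (1 : R)).
      by rewrite sub0r.
    have := is_derive_scale (- (B s / n.+1`!%:R)) (@is_deriveX _ _ _ n.+1 t 1 _ d1).
    rewrite exprfctE /GRing.scale/= => d2; apply: (is_derive_eq d2).
    rewrite /= factS natrM; field.
    by rewrite nat1r !pnatr_eq0 -lt0n fact_gt0.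
  have dF2 (t : R) : derivable (fun t => B s * ((s - t) ^+ n / n`!%:R)) t 1.
    have d1 : is_derive t 1 (fun t : R => s - t) (- 1).
      have := is_deriveB (is_derive_cst s t (1 : R)) (is_derive_id t (1 : R)).
      by rewrite sub0r.
    have := is_derive_scale (B s / n`!%:R) (@is_deriveX _ _ _ n t 1 _ d1).
    rewrite exprfctE.
    have -> : (fun y => B s / n`!%:R * (s - y) ^+ n) =
        (fun t => B s * ((s - t) ^+ n / n`!%:R)) by apply/funext => y; ring.
    by case.
  rewrite (integral_is_derive xs (fun t _ => dF t)); last first.
    by move=> t _; exact/derivable_continuous_at/dF2.
  rewrite subrr expr0n mulr0 -EFinB sub0r mulNr opprK BE//; congr EFin.
  by rewrite mulrAC mulrA.
- exact: measurable_funTS.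
- by move=> t s _ _; rewrite lee_fin.
Qed.

End TaylorAtInfinity.

(** * The truncated kernel *)

Section TruncatedPowers.
Context {R : realType}.
Implicit Types (x y : R) (n : nat).

Definition truncated_power n y : R := Num.max 0 (1 - y) ^+ n.

Lemma truncated_power_ge0 n y : 0 <= truncated_power n y.
Proof. by rewrite exprn_ge0// le_max lexx. Qed.

Lemma truncated_power_le_exp n y : truncated_power n y <= expR (- (n%:R * y)).
Proof.
have -> : - (n%:R * y) = n%:R * (- y) by ring.
rewrite expRM_natl lerXn2r ?nnegrE ?expR_ge0 ?le_max ?lexx//.
by rewrite ge_max expR_ge0/= expR_ge1Dx.
Qed.

Lemma bernoulli_ineq n (a : R) : 0 <= a <= 1 -> 1 - n%:R * a <= (1 - a) ^+ n.
Proof.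
move=> /andP[a0 a1]; elim: n => [|n IH]; first by rewrite mul0r subr0 expr0.
have a10 : 0 <= 1 - a by rewrite subr_ge0.
rewrite exprS; apply: le_trans (ler_wpM2l a10 IH).
rewrite -natr1 -subr_ge0 [X in 0 <= X](_ : _ = n%:R * a ^+ 2); last by ring.
by rewrite mulr_ge0// sqr_ge0.
Qed.

(** From [1 + y <= e^y], [e^(-y) (1 - y^2) <= 1 - y]; for [y <= 1] the [n]-th power and Bernoulli's
    inequality give the bound, and for [y > 1] its left side is not positive. The relative error
    [n y^2] is of order [1/n] on the relevant scale [y = O(1/n)]. *)
Lemma exp_le_truncated_power n y : (0 < n)%N -> 0 <= y ->
  expR (- (n%:R * y)) * (1 - n%:R * y ^+ 2) <= truncated_power n y.
Proof.
move=> n0 y0; have [y1|y1] := leP y 1; last first.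
  apply: le_trans (truncated_power_ge0 _ _).
  rewrite mulr_ge0_le0 ?expR_ge0// subr_le0.
  have y2 : 1 <= y ^+ 2 by rewrite exprn_ege1// ltW.
  by rewrite (le_trans y2)// ler_peMl ?sqr_ge0// ler1n.
have y01 : 0 <= 1 - y by rewrite subr_ge0.
rewrite /truncated_power max_r//.
have ey : expR (- y) * (1 - y ^+ 2) <= 1 - y.
  rewrite expRN mulrC ler_pdivrMr ?expR_gt0//.
  have -> : 1 - y ^+ 2 = (1 - y) * (1 + y) by ring.
  by rewrite ler_wpM2l// expR_ge1Dx.
have y2 : 0 <= y ^+ 2 <= 1 by rewrite sqr_ge0/= exprn_ile1.
apply: (@le_trans _ _ ((expR (- y) * (1 - y ^+ 2)) ^+ n)).
  rewrite exprMn -expRM_natl mulrN ler_wpM2l ?expR_ge0//.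
  exact: bernoulli_ineq.
rewrite lerXn2r ?nnegrE// mulr_ge0 ?expR_ge0// subr_ge0.
by case/andP: y2.
Qed.

(** Unless the left side is at most 0, both one-variable lower bounds are nonnegative and can be
    multiplied; then [(1 - p) (1 - q) >= 1 - p - q] with [p = n x^2] and [q = n y^2]. *)
Lemma exp_le_truncated_powerM n x y : (0 < n)%N -> 0 <= x -> 0 <= y ->
  expR (- (n%:R * (x + y))) * (1 - n%:R * (x + y) ^+ 2) <=
  truncated_power n x * truncated_power n y.
Proof.
move=> n0 x0 y0.
have [xy|xy] := leP (1 - n%:R * (x + y) ^+ 2) 0.
  apply: (@le_trans _ _ 0); first by rewrite mulr_ge0_le0 ?expR_ge0.
  by rewrite mulr_ge0 ?truncated_power_ge0.
have n0' : 0 <= n%:R :> R by [].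
have nx : 0 <= n%:R * x ^+ 2 by rewrite mulr_ge0 ?sqr_ge0.
have ny : 0 <= n%:R * y ^+ 2 by rewrite mulr_ge0 ?sqr_ge0.
have nxy : 0 <= n%:R * (x * y) by rewrite !mulr_ge0.
have e : n%:R * (x + y) ^+ 2 = n%:R * x ^+ 2 + n%:R * y ^+ 2 + (n%:R * (x * y)) *+ 2.
  by rewrite mulr2n; ring.
move: xy; rewrite e mulr2n => xy.
have ex := exp_le_truncated_power n0 x0; have ey := exp_le_truncated_power n0 y0.
have px : 0 <= expR (- (n%:R * x)) * (1 - n%:R * x ^+ 2).
  by rewrite mulr_ge0 ?expR_ge0//; lra.
have py : 0 <= expR (- (n%:R * y)) * (1 - n%:R * y ^+ 2).
  by rewrite mulr_ge0 ?expR_ge0//; lra.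
apply: le_trans (ler_pM px py ex ey).
rewrite mulrACA -expRD.
have -> : - (n%:R * x) + - (n%:R * y) = - (n%:R * (x + y)) by ring.
rewrite ler_wpM2l ?expR_ge0//.
have nn := mulr_ge0 nx ny.
have -> : (1 - n%:R * x ^+ 2) * (1 - n%:R * y ^+ 2) = 1 - n%:R * x ^+ 2 -
  n%:R * y ^+ 2 + n%:R * x ^+ 2 * (n%:R * y ^+ 2) by ring.
lra.
Qed.

End TruncatedPowers.

(** * The inverse Gamma integral and the asymptotics of the truncated kernel *)

Section InverseGammaKernel.
Context {R : realType}.
Local Notation leb := (@lebesgue_measure R).
Local Notation pos := (`]0%R, +oo[%classic : set R).
Implicit Types (c s u v x y lambda : R) (n : nat).

Definition inverse_gamma_kernel lambda c s : R :=
  s `^ (- (lambda + 1)) * expR (- (c / s)).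

(** The substitution [s -> 1/s] identifies it with [Gamma lambda]; the argument treats it as a
    positive constant. *)
Definition inverse_gamma lambda : R :=
  \int[leb]_(s in pos) inverse_gamma_kernel lambda 1 s.

Lemma inverse_gamma_kernel_ge0 lambda c s : 0 <= inverse_gamma_kernel lambda c s.
Proof. by rewrite mulr_ge0 ?powR_ge0 ?expR_ge0. Qed.

Lemma measurable_inv (D : set R) : D `<=` pos -> measurable D ->
  measurable_fun D (fun s : R => s^-1).
Proof.
move=> Dpos mD; apply: (@measurable_funS _ _ _ _ pos) => //.
apply: measurable_pos_continuous => x x0; apply: inv_continuous.
by rewrite gt_eqF.
Qed.

Lemma measurable_inverse_gamma_kernel lambda c :
  measurable_fun pos (inverse_gamma_kernel lambda c).
Proof.
apply: measurable_funM; first by apply: measurable_funTS; prove_measurable.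
apply: (measurableT_comp (@measurable_expR _)); apply: measurable_funN.
by apply: measurable_funM => //; exact: measurable_inv.
Qed.

Let integrable_kernel1 lambda : 0 < lambda ->
  leb.-integrable pos (EFin \o inverse_gamma_kernel lambda 1).
Proof.
move=> l0.
have [C C0 expC] := @exp_dominates_pow R (lambda + 1).
(* Here [s^(-lambda-1) = (1 + s)^(-lambda-1) (1 + 1/s)^(lambda+1)], and [e^(-1/s)] absorbs the last
   factor. *)
pose F s := - lambda^-1 * (1 + s) `^ (- lambda).
pose g s := (1 + s) `^ (- (lambda + 1)).
apply: (@integrable_bounded_antiderivative _ F _ g C (- lambda^-1) 0).
- exact: measurable_inverse_gamma_kernel.
- move=> s s0; rewrite inverse_gamma_kernel_ge0/= /inverse_gamma_kernel /g.
  have s10 : 0 < 1 + s by rewrite addr_gt0.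
  rewrite [in leRHS]powRN ler_pdivlMr ?powR_gt0//.
  have := expC s^-1; rewrite invr_ge0 => /(_ (ltW s0)).
  have -> : 1 + s^-1 = (1 + s) * s^-1 by field; rewrite gt_eqF.
  rewrite powRM ?invr_ge0 ?(ltW s0) ?(ltW s10)// -(powR_inv1 (ltW s0)) -powRrM mulN1r.
  apply: le_trans; rewrite le_eqVlt; apply/orP; left; apply/eqP.
  by rewrite powR_inv1 ?(ltW s0)// mul1r; ring.
- move=> s s0; have s10 : 0 < 1 + s by rewrite addr_gt0.
  apply: (is_derive_eq (is_derive_scale (- lambda^-1) (is_derive_powR_addl (- lambda) s10))).
  rewrite /g opprD; field; by rewrite gt_eqF.
- move=> s s0; have s10 : 0 < 1 + s by rewrite addr_gt0.
  by apply: derivable_continuous_at; case: (is_derive_powR_addl (- (lambda + 1)) s10).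
- by move=> s _; exact: powR_ge0.
- move=> s s0; have s10 : 0 < 1 + s by rewrite addr_gt0.
  rewrite /F mulNr lerN2 oppr_le0 mulr_ge0 ?invr_ge0 ?(ltW l0) ?powR_ge0// andbT.
  rewrite ler_piMr ?invr_ge0 ?(ltW l0)// powRN invf_le1 ?powR_gt0//.
  have : 1 `^ lambda <= (1 + s) `^ lambda.
    by rewrite ge0_ler_powR// ?nnegrE ?ler01 ?(ltW l0) ?(ltW s10)// lerDl ltW.
  by rewrite powR1.
Qed.

Lemma integral_inverse_gamma lambda c : 0 < lambda -> 0 < c ->
  (\int[leb]_(s in pos) (inverse_gamma_kernel lambda c s)%:E =
   (inverse_gamma lambda * c `^ (- lambda))%:E)%E.
Proof.
move=> l0 c0; have ci : 0 < c^-1 by rewrite invr_gt0.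
have -> : ((inverse_gamma lambda * c `^ (- lambda))%:E =
    \int[leb]_(s in pos) (inverse_gamma_kernel lambda 1 s)%:E * (c `^ (- lambda))%:E)%E.
  rewrite EFinM /inverse_gamma /Rintegral fineK//.
  exact: integrable_fin_num (integrable_kernel1 l0).
rewrite (@ge0_integral_scale _ c^-1 (fun s => (inverse_gamma_kernel lambda 1 s)%:E))//; last 2 first.
- by apply/measurable_EFinP; exact: measurable_inverse_gamma_kernel.
- by move=> s _; rewrite lee_fin inverse_gamma_kernel_ge0.
rewrite muleC muleA -EFinM -ge0_integralZl//=; last 3 first.
- apply/measurable_EFinP; apply: measurable_funM.
    by apply: measurable_funTS; prove_measurable.
  apply: (measurableT_comp (@measurable_expR _)); apply: measurable_funN.
  apply: measurable_funM => //; apply: measurable_pos_continuous => x x0.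
  apply: derivable_continuous_at; apply: derivableV.
    by rewrite mulf_neq0 ?gt_eqF.
  exact: derivableM.
- by move=> s _; rewrite lee_fin inverse_gamma_kernel_ge0.
- by rewrite lee_fin mulr_ge0 ?powR_ge0 ?(ltW ci).
apply: eq_integral => s; rewrite inE => /pos_gt0 s0; congr EFin.
rewrite /inverse_gamma_kernel powRM ?(ltW ci) ?(ltW s0)// mulrA; congr (_ * _).
  have -> : c^-1 `^ (- (lambda + 1)) = c `^ lambda * c.
    by rewrite -(powR_inv1 (ltW c0)) -powRrM mulN1r opprK powRD_gt0// powRr1 ?(ltW c0).
  rewrite [c `^ (- lambda)]powRN; field.
  by rewrite !gt_eqF// powR_gt0.
by congr (expR (- _)); rewrite invfM invrK mul1r mulrC.
Qed.

Lemma integrable_inverse_gamma lambda c : 0 < lambda -> 0 < c ->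
  leb.-integrable pos (EFin \o inverse_gamma_kernel lambda c).
Proof.
move=> l0 c0; apply: ge0_integrable => //.
- exact: measurable_inverse_gamma_kernel.
- by move=> s _; exact: inverse_gamma_kernel_ge0.
- by rewrite integral_inverse_gamma// ltry.
Qed.

Lemma inverse_gamma_gt0 lambda : 0 < lambda -> 0 < inverse_gamma lambda.
Proof.
move=> l0; rewrite -lte_fin /inverse_gamma /Rintegral fineK; last first.
  exact: integrable_fin_num (integrable_kernel1 l0).
apply: (@integral_pos_gt0 _ _ (2 `^ (- (lambda + 1)) * expR (- 1))).
- exact: measurable_inverse_gamma_kernel.
- by move=> s _; exact: inverse_gamma_kernel_ge0.
- by rewrite mulr_gt0 ?powR_gt0 ?expR_gt0.
move=> s /andP[s1 s2]; have s0 := lt_le_trans ltr01 s1.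
apply: ler_pM; rewrite ?powR_ge0 ?expR_ge0//.
  by rewrite ler_powRN// addr_ge0// ltW.
by rewrite ler_expR lerN2 mul1r invf_le1.
Qed.

Definition truncated_kernel lambda n u v s : R :=
  s `^ (- (lambda + 1)) * (truncated_power n (u / s) * truncated_power n (v / s)).

Lemma truncated_kernel_ge0 lambda n u v s : 0 <= truncated_kernel lambda n u v s.
Proof. by rewrite !mulr_ge0 ?powR_ge0 ?truncated_power_ge0. Qed.

(** The error factor [n ((u + v)/s)^2] changes [lambda] into [lambda + 2]. Its integral contributes
    [n (u + v)^2 (n (u + v))^(-lambda-2)], which is the main power divided by [n]. *)
Lemma truncated_kernel_bounds lambda n u v : 0 < lambda -> (0 < n)%N ->
  0 < u -> 0 < v -> measurable_fun pos (truncated_kernel lambda n u v) ->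
  (((inverse_gamma lambda - inverse_gamma (lambda + 2) / n%:R) *
     (n%:R * (u + v)) `^ (- lambda))%:E <=
   \int[leb]_(s in pos) (truncated_kernel lambda n u v s)%:E <=
   (inverse_gamma lambda * (n%:R * (u + v)) `^ (- lambda))%:E)%E.
Proof.
move=> l0 n0 u0 v0 mk.
have uv0 : 0 < u + v by rewrite addr_gt0.
have nR : 0 < n%:R :> R by rewrite ltr0n.
have c0 : 0 < n%:R * (u + v) by rewrite mulr_gt0.
have l20 : 0 < lambda + 2 by rewrite addr_gt0.
have kle s : 0 < s ->
    truncated_kernel lambda n u v s <= inverse_gamma_kernel lambda (n%:R * (u + v)) s.
  move=> s0; rewrite ler_wpM2l ?powR_ge0//.
  apply: (le_trans (ler_pM (truncated_power_ge0 _ _) (truncated_power_ge0 _ _)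
    (truncated_power_le_exp _ _) (truncated_power_le_exp _ _))).
  rewrite -expRD ler_expR le_eqVlt; apply/orP; left; apply/eqP; ring.
apply/andP; split; last first.
  rewrite -integral_inverse_gamma//; apply: ge0_le_integral => //.
  - by move=> s _; rewrite lee_fin truncated_kernel_ge0.
  - exact/measurable_EFinP.
  - by apply/measurable_EFinP; exact: measurable_inverse_gamma_kernel.
  - by move=> s /pos_gt0 s0; rewrite lee_fin kle.
have i1 := integrable_inverse_gamma l0 c0.
have i2 := integrable_scale (n%:R * (u + v) ^+ 2) _ (integrable_inverse_gamma l20 c0).
have mpos : measurable (pos : set (measurableTypeR R)) by [].
have ik : leb.-integrable pos (EFin \o truncated_kernel lambda n u v).
  apply: (dominated_integrable mpos mk _ i1) => s /pos_gt0 s0.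
  by rewrite ger0_norm ?truncated_kernel_ge0 ?kle.
rewrite -(fineK (integrable_fin_num mpos ik)) lee_fin -/(Rintegral _ _ _).
have -> : (inverse_gamma lambda - inverse_gamma (lambda + 2) / n%:R) *
     (n%:R * (u + v)) `^ (- lambda) =
   \int[leb]_(s in pos) inverse_gamma_kernel lambda (n%:R * (u + v)) s -
   (n%:R * (u + v) ^+ 2) *
     \int[leb]_(s in pos) inverse_gamma_kernel (lambda + 2) (n%:R * (u + v)) s.
  rewrite /Rintegral !integral_inverse_gamma//= mulrBl; congr (_ - _).
  rewrite opprD powRB_gt0// [_ `^ 2]powR_mulrn ?(ltW c0)//.
  by field; rewrite !gt_eqF.
rewrite -RintegralZl//; last exact: integrable_inverse_gamma.
rewrite -RintegralB//; last exact: i2.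
apply: le_Rintegral => //; first exact: (integrableB mpos i1 (i2 _)).
move=> s /pos_gt0 s0.
have us : 0 <= u / s by rewrite divr_ge0 ?(ltW u0) ?(ltW s0).
have vs : 0 <= v / s by rewrite divr_ge0 ?(ltW v0) ?(ltW s0).
apply: le_trans (ler_wpM2l (powR_ge0 s _) (exp_le_truncated_powerM n0 us vs)).
rewrite le_eqVlt; apply/orP; left; apply/eqP.
rewrite /inverse_gamma_kernel.
have -> : - (lambda + 2 + 1) = - (lambda + 1) - 2 by ring.
rewrite powRB_gt0// [s `^ 2]powR_mulrn ?(ltW s0)// -mulrDl [n%:R * (_ / s)]mulrA.
by field; rewrite gt_eqF.
Qed.

End InverseGammaKernel.

(** * Densities approximating a completely monotone function *)

Section StieltjesApproximants.
Context {R : realType}.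
Local Notation leb := (@lebesgue_measure R).
Local Notation pos := (`]0%R, +oo[%classic : set R).
Implicit Types (r s u v x : R) (k n : nat).

Lemma truncated_powerE n x s : 0 < s -> x <= s ->
  s ^+ n * truncated_power n (x / s) = (s - x) ^+ n.
Proof.
move=> s0 xs; rewrite /truncated_power max_r; last first.
  by rewrite subr_ge0 ler_pdivrMr// mul1r.
by rewrite -exprMn mulrBr mulr1 mulrCA divff ?gt_eqF// mulr1.
Qed.

Lemma truncated_power_eq0 n x s : (0 < n)%N -> 0 < s -> s < x ->
  truncated_power n (x / s) = 0.
Proof.
move=> n0 s0 sx; rewrite /truncated_power max_l ?expr0n ?gtn_eqF//.
by rewrite subr_le0 ler_pdivlMr// mul1r ltW.
Qed.

(** Truncation replaces the moving domain by a fixed one. A positive [n] matters: the truncated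
    factor has to vanish for [s < x], and [0 ^+ 0] is 1. *)
Lemma integral_truncated_tail n x (g : R -> R) : (0 < n)%N -> 0 < x ->
  (\int[leb]_(s in `[x, +oo[) (g s * ((s - x) ^+ n / n`!%:R))%:E =
   \int[leb]_(s in pos) (g s * (s ^+ n * truncated_power n (x / s) / n`!%:R))%:E)%E.
Proof.
move=> n0 x0.
rewrite integral_mkcond [RHS]integral_mkcond; apply: eq_integral => s _.
rewrite !patchE; have [s0|s0] := ltP 0 s; last first.
  rewrite !memNset//= in_itv/= andbT; first by apply/negP; rewrite -leNgt.
  by apply/negP; rewrite -ltNge; exact: le_lt_trans x0.
rewrite [in RHS]mem_set; last by rewrite /= in_itv/= s0.
have [xs|sx] := leP x s.
  by rewrite mem_set/= ?in_itv/= ?xs// truncated_powerE.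
rewrite memNset/= ?in_itv/= ?andbT; last by apply/negP; rewrite -ltNge.
by rewrite truncated_power_eq0// mulr0 mul0r mulr0.
Qed.

Lemma measurable_truncated_power d (T : measurableType d) (D : set T) n (g : T -> R) :
  measurable_fun D g -> measurable_fun D (fun z : T => truncated_power n (g z)).
Proof.
move=> mg; apply: measurable_funX; apply: measurable_maxr.
  exact: measurable_cst.
by apply: measurable_funB; [exact: measurable_cst|].
Qed.

Lemma measurable_truncated_kernel lambda n u v :
  measurable_fun pos (truncated_kernel lambda n u v).
Proof.
apply: measurable_funM; first by apply: measurable_funTS; prove_measurable.
have mi : measurable_fun pos (fun s : R => s^-1) by exact: measurable_inv.
by apply: measurable_funM; apply: measurable_truncated_power;
  apply: measurable_funM => //; exact: measurable_cst.
Qed.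

(** [A] stands for [H] and its signed derivatives, [B k] for [c_op lambda k f] and its own. [AB]
    concerns [k > 0] only because in the application the limit at infinity is subtracted from
    [A 0]. *)
Variables (lambda : R) (A : nat -> R -> R) (B : nat -> nat -> R -> R).
Hypothesis lambda_gt0 : 0 < lambda.
Hypotheses (cmA : cm_sequence A) (A_cvg0 : A 0%N x @[x --> +oo] --> (0 : R)).
Hypothesis cmB : forall k, (0 < k)%N -> cm_sequence (B k).
Hypothesis B_cvg0 : forall k, (0 < k)%N -> B k 0%N x @[x --> +oo] --> (0 : R).
Hypothesis AB : forall k s, (0 < k)%N -> 0 < s ->
  A k s = s `^ (- (lambda + k%:R)) * B k 0%N s^-1.

(** Each Taylor formula contributes one [1/n!], and [r^n] is pulled out of [(r - 1/s)^n]. *)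
Let q n r : R := B n.+1 n.+1 r / (n`!%:R ^+ 2) * r ^+ n.

Let q_ge0 n r : 0 < r -> 0 <= q n r.
Proof.
move=> r0; rewrite /q mulr_ge0 ?exprn_ge0 ?(ltW r0)// divr_ge0 ?sqr_ge0//.
exact: (cmB (ltn0Sn n)).2.
Qed.

Let measurable_q n : measurable_fun pos (q n).
Proof.
apply: measurable_funM; last by apply: measurable_funTS; prove_measurable.
apply: measurable_funM; last exact: measurable_cst.
exact: (measurable_cm (cmB (ltn0Sn n))).
Qed.

Let h n u s r : R := q n r * truncated_kernel lambda n u r^-1 s.

Let h0 n u s r : 0 < r -> 0 <= h n u s r.
Proof. by move=> r0; rewrite mulr_ge0 ?q_ge0 ?truncated_kernel_ge0. Qed.

Let mpos : measurable (pos : set (measurableTypeR R)). Proof. by []. Qed.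

(* On the quadrant, [s^-1] is [s `^ (- 1)], which is measurable everywhere. *)
Let measurable_h n u :
  measurable_fun (pos `*` pos) (fun z : measurableTypeR R * measurableTypeR R =>
    (h n u z.1 z.2)%:E).
Proof.
pose g (z : measurableTypeR R * measurableTypeR R) : R := (q n \_ pos) z.2 *
  (z.1 `^ (- (lambda + 1)) * (truncated_power n (u * z.1 `^ (- 1)) *
     truncated_power n (z.2 `^ (- 1) * z.1 `^ (- 1)))).
have hg : {in pos `*` pos, EFin \o g =1 (fun z => (h n u z.1 z.2)%:E)}.
  move=> [s r]; rewrite inE => -[/= /pos_gt0 s0 /pos_gt0 r0].
  rewrite /g /h /truncated_kernel /= patchE mem_set/= ?in_itv/= ?r0//.
  by rewrite !powR_inv1// ltW.
apply: (eq_measurable_fun _ hg); apply: measurable_funTS.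
apply/measurable_EFinP; apply: measurable_funM.
  apply: (measurableT_comp _ measurable_snd).
  by apply/(measurable_restrictT _ _).1 => //; exact: measurable_q.
apply: measurable_funM; first by prove_measurable.
by apply: measurable_funM; apply: measurable_truncated_power; prove_measurable.
Qed.

Let integral_h n u r : 0 < r -> (\int[leb]_(s in pos) (h n u s r)%:E =
  (q n r)%:E * \int[leb]_(s in pos) (truncated_kernel lambda n u r^-1 s)%:E)%E.
Proof.
move=> r0; rewrite /h -ge0_integralZl//.
- by apply/measurable_EFinP; exact: measurable_truncated_kernel.
- by move=> s _; rewrite lee_fin truncated_kernel_ge0.
- by rewrite lee_fin q_ge0.
Qed.

Let double_integral n u : (0 < n)%N -> 0 < u ->
  ((A 0%N u)%:E = \int[leb]_(r in pos) \int[leb]_(s in pos) (h n u s r)%:E)%E.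
Proof.
move=> n0 u0.
rewrite (cm_taylor n cmA A_cvg0 u0) integral_truncated_tail//.
transitivity (\int[leb]_(s in pos) \int[leb]_(r in pos) (h n u s r)%:E)%E.
  apply: eq_integral => s; rewrite inE => /pos_gt0 s0.
  have si0 : 0 < s^-1 by rewrite invr_gt0.
  have -> : A n.+1 s * (s ^+ n * truncated_power n (u / s) / n`!%:R) =
      (s `^ (- (lambda + 1)) * truncated_power n (u / s) / n`!%:R) * B n.+1 0%N s^-1.
    rewrite AB//.
    (* The [s^n] of the first Taylor factor cancels against the exponent [n] split off here. *)
    have -> : - (lambda + n.+1%:R) = - (lambda + 1) - n%:R by rewrite -natr1; ring.
    rewrite powRB_gt0// powR_mulrn ?(ltW s0)//; field.
    by rewrite pnatr_eq0 -lt0n fact_gt0 expf_neq0 ?gt_eqF.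
  rewrite EFinM (cm_taylor n (cmB (ltn0Sn n)) (B_cvg0 (ltn0Sn n)) si0).
  rewrite integral_truncated_tail// -ge0_integralZl//; last 3 first.
  - apply/measurable_EFinP; apply: measurable_funM.
      exact: (measurable_cm (cmB (ltn0Sn n))).
    apply: measurable_funM; last exact: measurable_cst.
    apply: measurable_funM; first by apply: measurable_funTS; prove_measurable.
    apply: measurable_truncated_power; apply: measurable_funM.
      exact: measurable_cst.
    exact: measurable_inv.
  - move=> r /pos_gt0 r0; rewrite lee_fin mulr_ge0 ?(cmB (ltn0Sn n)).2//.
    by rewrite divr_ge0// mulr_ge0 ?truncated_power_ge0// exprn_ge0// ltW.
  - by rewrite lee_fin divr_ge0// mulr_ge0 ?truncated_power_ge0 ?powR_ge0.
  apply: eq_integral => r; rewrite inE => /pos_gt0 r0.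
  rewrite -EFinM; congr EFin; rewrite /h /q /truncated_kernel.
  have -> : s^-1 / r = r^-1 / s by rewrite mulrC.
  by field; rewrite pnatr_eq0 -lt0n fact_gt0.
rewrite tonelli_setX//; first exact: measurable_h.
by move=> s r _ /pos_gt0 r0; rewrite lee_fin h0.
Qed.

(** [q n r] times the part independent of [u] in [inverse_gamma lambda * (n (u + 1/r))^(-lambda)],
    where [(n (u + 1/r))^(-lambda) = n^(-lambda) r^lambda (1 + u r)^(-lambda)]. *)
Definition stieltjes_density n r : R :=
  inverse_gamma lambda * n%:R `^ (- lambda) * (B n.+1 n.+1 r / (n`!%:R ^+ 2) * r ^+ n * r `^ lambda).

Lemma stieltjes_density_ge0 n r : 0 < r -> 0 <= stieltjes_density n r.
Proof.
move=> r0; apply: mulr_ge0.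
  by rewrite mulr_ge0 ?powR_ge0// ltW// inverse_gamma_gt0.
by apply: mulr_ge0; [exact: q_ge0|exact: powR_ge0].
Qed.

Lemma measurable_stieltjes_density n : measurable_fun pos (stieltjes_density n).
Proof.
apply: measurable_funM; first exact: measurable_cst.
by apply: measurable_funM; [exact: measurable_q|apply: measurable_funTS; prove_measurable].
Qed.

Let density_kernel n u r : 0 < r -> 0 < u -> (0 < n)%N ->
  q n r * (inverse_gamma lambda * (n%:R * (u + r^-1)) `^ (- lambda)) =
  stieltjes_density n r * (1 + u * r) `^ (- lambda).
Proof.
move=> r0 u0 n0; have ur : 0 < 1 + u * r by rewrite addr_gt0 ?mulr_gt0.
have -> : u + r^-1 = (1 + u * r) * r^-1 by field; rewrite gt_eqF.
rewrite !powRM ?mulr_ge0 ?invr_ge0 ?(ltW ur) ?(ltW r0)//.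
have -> : r^-1 `^ (- lambda) = r `^ lambda.
  by rewrite -(powR_inv1 (ltW r0)) -powRrM mulN1r opprK.
by rewrite /stieltjes_density -/(q n r); ring.
Qed.

(** The two bounds on the truncated kernel, integrated against [q n]. The lower bound on [n] makes
    the factor in the second inequality nonnegative. The statement is in the extended reals because
    the finiteness of the integral will be deduced from that inequality. *)
Lemma stieltjes_approx n u : (0 < n)%N -> 0 < u ->
  inverse_gamma (lambda + 2) / inverse_gamma lambda <= n%:R ->
  ((A 0%N u)%:E <=
     \int[leb]_(r in pos) (stieltjes_density n r * (1 + u * r) `^ (- lambda))%:E)%E /\
  ((1 - inverse_gamma (lambda + 2) / inverse_gamma lambda / n%:R)%:E *
     \int[leb]_(r in pos) (stieltjes_density n r * (1 + u * r) `^ (- lambda))%:E <=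
   (A 0%N u)%:E)%E.
Proof.
move=> n0 u0 nD; have IG0 := inverse_gamma_gt0 lambda_gt0.
have nR : 0 < n%:R :> R by rewrite ltr0n.
have mk u' v' := @measurable_truncated_kernel lambda n u' v'.
have mF : measurable_fun pos (fun r => stieltjes_density n r * (1 + u * r) `^ (- lambda)).
  apply: measurable_funM; first exact: measurable_stieltjes_density.
  by apply: measurable_funTS; prove_measurable.
have F0 r : 0 < r -> 0 <= stieltjes_density n r * (1 + u * r) `^ (- lambda).
  by move=> r0; rewrite mulr_ge0 ?stieltjes_density_ge0 ?powR_ge0.
pose J r := (\int[leb]_(s in pos) (truncated_kernel lambda n u r^-1 s)%:E)%E.
have J0 r : (0 <= J r)%E.
  by apply: integral_ge0 => s _; rewrite lee_fin truncated_kernel_ge0.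
have J_bounds r : 0 < r ->
    (((1 - inverse_gamma (lambda + 2) / inverse_gamma lambda / n%:R) *
      (inverse_gamma lambda * (n%:R * (u + r^-1)) `^ (- lambda)))%:E <= J r <=
     (inverse_gamma lambda * (n%:R * (u + r^-1)) `^ (- lambda))%:E)%E.
  move=> r0; have ri : 0 < r^-1 by rewrite invr_gt0.
  have -> : (1 - inverse_gamma (lambda + 2) / inverse_gamma lambda / n%:R) *
      (inverse_gamma lambda * (n%:R * (u + r^-1)) `^ (- lambda)) =
      (inverse_gamma lambda - inverse_gamma (lambda + 2) / n%:R) *
      (n%:R * (u + r^-1)) `^ (- lambda).
    by field; rewrite !gt_eqF.
  exact: truncated_kernel_bounds lambda_gt0 n0 u0 ri (mk _ _).
have mJ : measurable_fun pos (fun r => \int[leb]_(s in pos) (h n u s r)%:E)%E.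
  apply: (@measurable_integral_setX _ _ (measurableTypeR R) (measurableTypeR R) R
    leb pos pos (fun s r => (h n u s r)%:E)) => //; first exact: measurable_h.
  by move=> s r _ /pos_gt0 r0; rewrite lee_fin h0.
have qJ0 r : pos r -> (0 <= \int[leb]_(s in pos) (h n u s r)%:E)%E.
  by move=> /pos_gt0 r0; rewrite integral_h//; apply: mule_ge0; [rewrite lee_fin q_ge0|exact: J0].
rewrite (double_integral n0 u0); split.
  apply: ge0_le_integral => //.
  - exact/measurable_EFinP.
  - move=> r /pos_gt0 r0; rewrite integral_h// -density_kernel// (EFinM (q n r)).
    apply: lee_wpmul2l; first by rewrite lee_fin q_ge0.
    by have /andP[] := J_bounds r r0.
have e0 : 0 <= 1 - inverse_gamma (lambda + 2) / inverse_gamma lambda / n%:R.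
  by rewrite subr_ge0 ler_pdivrMr// mul1r.
rewrite -ge0_integralZl//; last 2 first.
- exact/measurable_EFinP.
- by move=> r /pos_gt0 r0; rewrite lee_fin F0.
apply: ge0_le_integral => //.
- by move=> r /pos_gt0 r0; rewrite -EFinM lee_fin mulr_ge0// F0.
- by apply: measurable_funeM; exact/measurable_EFinP.
move=> r /pos_gt0 r0; rewrite integral_h// -EFinM -density_kernel// mulrCA (EFinM (q n r)).
apply: lee_wpmul2l; first by rewrite lee_fin q_ge0.
by have /andP[] := J_bounds r r0.
Qed.

End StieltjesApproximants.

(** * Helly's selection theorem *)

Section UltrafilterLimits.

Lemma fmap_ultra T1 T2 (U : set_system T1) (f : T1 -> T2) :
  UltraFilter U -> UltraFilter (f @ U).
Proof.
move=> UU; have PU : ProperFilter U := ultra_proper.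
constructor; first exact: fmap_proper_filter.
move=> G PG UG; rewrite eqEsubset; split=> // A GA.
have [//|nA] := in_ultra_setVsetC (f @^-1` A) UU.
have GnA : G (~` A) by apply: UG.
by have [x []] := filter_ex (filterI GA GnA).
Qed.

(** Along an ultrafilter every bounded sequence converges, so one filter serves all real arguments
    at once, in place of a diagonal subsequence. *)
Lemma ultra_bounded_cvg {R : realType} (U : set_system nat) (u : nat -> R) (a b : R) :
  UltraFilter U -> (forall n, a <= u n <= b) ->
  exists2 l, a <= l <= b & u n @[n --> U] --> l.
Proof.
move=> UU uab; have PU : ProperFilter U := ultra_proper.
have cab : compact `[a, b]%classic by exact: segment_compact.
rewrite compact_ultra in cab.
have [] := cab _ (fmap_ultra u UU).
  by apply: nearW => n; rewrite /= in_itv/=.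
by move=> l [/= lab ul]; exists l; rewrite ?in_itv in lab *.
Qed.

End UltrafilterLimits.

Section HellySelection.
Context {R : realType}.
Local Notation halfline := (`[0, +oo[%classic : set R).
Implicit Types (s t : R) (n : nat).

Section RightContinuousVersion.
Variables (Phi : R -> R) (M : R).
Hypothesis Phi_nd : {homo Phi : s t / s <= t}.
Hypothesis Phi_bd : forall s, 0 <= Phi s <= M.

Definition right_version s : R := inf [set Phi t | t in `]s, +oo[%classic].

Let lb0 s : lbound [set Phi t | t in `]s, +oo[%classic] 0.
Proof. by move=> _ [t _ <-]; have /andP[] := Phi_bd t. Qed.

Let has_inf_right s : has_inf [set Phi t | t in `]s, +oo[%classic].
Proof.
split; last by exists 0; exact: lb0.
by exists (Phi (s + 1)); exists (s + 1) => //; rewrite /= in_itv/= andbT ltrDl.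
Qed.

Lemma right_version_le s t : s < t -> right_version s <= Phi t.
Proof.
move=> st; apply: ge_inf; first by exists 0; exact: lb0.
by exists t => //; rewrite /= in_itv/= st.
Qed.

Lemma le_right_version s : Phi s <= right_version s.
Proof.
apply: lb_le_inf; first by case: (has_inf_right s).
by move=> _ [t + <-]; rewrite /= in_itv/= andbT => /ltW; exact: Phi_nd.
Qed.

Lemma right_version_nd : {homo right_version : s t / s <= t}.
Proof.
move=> s t st; apply: lb_le_inf; first by case: (has_inf_right t).
move=> _ [r + <-]; rewrite /= in_itv/= andbT => tr.
by apply: right_version_le; exact: le_lt_trans tr.
Qed.

Lemma right_version_rc : right_continuous right_version.
Proof.
move=> s; apply/cvgrPdist_le => e e0.
have [_ [t + <-]] := inf_adherent e0 (has_inf_right s).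
rewrite /= in_itv/= andbT => st Phit.
near=> r.
have sr : s <= r by near: r; exact: nbhs_right_ge.
have rt : r < t by near: r; exact: nbhs_right_lt.
rewrite ler0_norm ?subr_le0 ?right_version_nd// opprB lerBlDr addrC.
by apply: le_trans (right_version_le rt) _; exact: ltW.
Unshelve. all: by end_near. Qed.

Lemma right_version_bd s : 0 <= right_version s <= M.
Proof.
rewrite (le_trans _ (le_right_version s))//=; last by have /andP[] := Phi_bd s.
have s1 : s < s + 1 by rewrite ltrDl.
by rewrite (le_trans (right_version_le s1))//; have /andP[] := Phi_bd (s + 1).
Qed.

End RightContinuousVersion.

(* [measurableTypeR R] and [R] have the same measurable sets but different
   displays. *)
Let borel_measure (m : {measure set (measurableTypeR R) -> \bar R}) :
  {measure set R -> \bar R}.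
Proof.
apply: (pushforward m (fun x : measurableTypeR R => x : R)).
by move=> _ A mA; rewrite setTI.
Defined.

Let lebesgue_stieltjes_measure_itvoc (f : cumulative R R) (a b : R) : a <= b ->
  lebesgue_stieltjes_measure f `]a, b]%classic = (f b - f a)%:E.
Proof.
move=> ab; rewrite /lebesgue_stieltjes_measure/= /measure_extension/=.
rewrite measurable_mu_extE; last exact: is_ocitv.
exact: (wlength_itv_bnd f false false ab).
Qed.

(** Intervals start at -1, where [G] vanishes, so that a jump of [G] at 0 becomes an atom counted in
    [[0, s]]; the remaining piece []-1, 0[] is null. *)
Lemma cumulative_measure (G : R -> R) (M : R) :
  {homo G : s t / s <= t} -> right_continuous G ->
  (forall s, s < 0 -> G s = 0) -> (forall s, G s <= M) ->
  exists nu : {measure set R -> \bar R},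
    (forall s, 0 <= s -> nu `[0, s]%classic = (G s)%:E) /\ (nu halfline <= M%:E)%E.
Proof.
move=> Gnd Grc G0 GM.
pose GG : cumulative R R := HB.pack G (isCumulative.Build _ _ _ G Gnd Grc).
pose m := lebesgue_stieltjes_measure GG.
have m_oc (b : R) : -1 <= b -> m `]-1, b]%classic = (G b)%:E.
  by move=> b1; rewrite /m lebesgue_stieltjes_measure_itvoc//= (G0 (-1))// subr0.
have mI (i : interval R) : measurable ([set` i] : set (measurableTypeR R)).
  exact: measurable_itv.
have m_neg : m `]-1, 0[%classic = 0%E.
  rewrite itv_bnd_open_bigcup.
  pose I n : set (measurableTypeR R) := `]-1, (0 - n.+1%:R^-1)]%classic.
  have I0 n : m (I n) = 0%E.
    have n0 : 0 - n.+1%:R^-1 < 0 :> R by rewrite sub0r oppr_lt0 invr_gt0.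
    by rewrite m_oc ?G0// sub0r lerN2 invf_le1// ler1n.
  have mIn n : measurable (I n) by exact: mI.
  have cI : m \o I @ \oo --> m (\bigcup_n I n).
    apply: nondecreasing_cvg_mu => //; first exact: bigcupT_measurable.
    move=> i j ij; rewrite subsetEset => x; rewrite /I/= !in_itv/= => /andP[->/= xi].
    by rewrite (le_trans xi)// lerD2l lerN2 lef_pV2 ?posrE// ler_nat.
  rewrite -(cvg_lim _ cI)//.
  have -> : m \o I = cst 0%E by apply/funext.
  exact: lim_cst.
exists (borel_measure m); split.
  move=> s s0; rewrite -[LHS]/(m `[0, s]%classic) -m_oc; last first.
    by rewrite (le_trans _ s0)// oppr_le0.
  have -> : `]-1, s]%classic = `]-1, 0[ `|` `[0, s] :> set R.
    by rewrite -itv_bndbnd_setU// bnd_simp// ltrN10.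
  have disj : `]-1, 0[ `&` `[0, s] = set0 :> set (measurableTypeR R).
    apply/seteqP; split=> // x [] /=; rewrite !in_itv/= => /andP[_ x0] /andP[x1 _].
    by move: x0; rewrite ltNge x1.
  rewrite -[LHS]add0e -m_neg; apply: esym.
  exact: (measureU m (mI `]-1, 0[) (mI `[0, s]) disj).
rewrite -[X in (X <= _)%E]/(m halfline).
apply: (@le_trans _ _ (m `]-1, +oo[%classic)).
  apply: le_measure; rewrite ?inE//.
  by move=> x /=; rewrite !in_itv/= !andbT => x0; rewrite (lt_le_trans _ x0)// ltrN10.
rewrite itv_bndy_bigcup_BRight.
pose I n : set (measurableTypeR R) := `]-1, (-1 + n%:R)]%classic.
have mIn n : measurable (I n) by exact: mI.
have cI : m \o I @ \oo --> m (\bigcup_n I n).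
  apply: nondecreasing_cvg_mu => //; first exact: bigcupT_measurable.
  move=> i j ij; rewrite subsetEset => x; rewrite /I/= !in_itv/= => /andP[->/= xi].
  by rewrite (le_trans xi)// lerD2l ler_nat.
rewrite -(cvg_lim _ cI)//; apply: lime_le; first exact: cvgP cI.
by apply: nearW => n /=; rewrite m_oc ?lerDl// lee_fin.
Qed.

(* Helly's selection theorem along an ultrafilter: the limit [Phi] exists
   everywhere by compactness, and [nu] is the Lebesgue-Stieltjes measure of its
   right-continuous version. *)
Lemma helly_selection (F : nat -> R -> R) (M : R) :
  (forall n, {homo F n : s t / s <= t}) -> (forall n s, 0 <= F n s <= M) ->
  (forall n s, s < 0 -> F n s = 0) ->
  exists U : set_system nat, exists Phi : R -> R, exists nu : {measure set R -> \bar R},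
  [/\ ProperFilter U /\ \oo `<=` U,
      forall s, F n s @[n --> U] --> Phi s,
      (nu halfline <= M%:E)%E,
      forall s, 0 <= s -> ((Phi s)%:E <= nu `[0%R, s]%classic)%E &
      forall s t, 0 <= s -> s < t -> (nu `[0%R, s]%classic <= (Phi t)%:E)%E].
Proof.
move=> Fnd Fbd F0.
have [U [UU ooU]] := @ultraFilterLemma nat \oo _.
have PU : ProperFilter U := ultra_proper.
have /choice[Phi PhiP] : forall s, exists l, 0 <= l <= M /\ F n s @[n --> U] --> l.
  move=> s; have [l lM Fl] := @ultra_bounded_cvg R U (fun n => F n s) 0 M UU (fun n => Fbd n s).
  by exists l.
have Phi_bd s : 0 <= Phi s <= M by have [] := PhiP s.
have Phi_nd : {homo Phi : s t / s <= t}.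
  move=> s t st; have [_ Fs] := PhiP s; have [_ Ft] := PhiP t.
  by apply: (ler_cvg_to Fs Ft); apply: nearW => n; exact: Fnd.
have Phi0 s : s < 0 -> Phi s = 0.
  move=> s0; have [_ Fs] := PhiP s; apply: (norm_cvg_unique Fs).
  rewrite (_ : (fun n => F n s) = cst 0); first exact: cvg_cst.
  by apply/funext => n; rewrite F0.
have [||nu [nuE nuM]] := @cumulative_measure (right_version Phi) M
  (right_version_nd Phi_bd) (right_version_rc Phi_bd).
- move=> s s0; apply/eqP; rewrite eq_le.
  have /andP[-> _] := right_version_bd Phi_nd Phi_bd s; rewrite andbT.
  (* For [s < 0], [s / 2] is an argument beyond [s] at which [Phi] still vanishes. *)
  have s2 : s < s / 2 by rewrite ltr_pdivlMr//; lra.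
  rewrite (le_trans (right_version_le Phi_bd s2))// Phi0//; lra.
- by move=> s; have /andP[] := right_version_bd Phi_nd Phi_bd s.
exists U, Phi, nu; split => //.
- by split; [exact: PU|exact ooU].
- by move=> s; have [] := PhiP s.
- by move=> s s0; rewrite nuE// lee_fin (le_right_version Phi_nd Phi_bd).
- by move=> s t s0 st; rewrite nuE// lee_fin (right_version_le Phi_bd).
Qed.

End HellySelection.

(** * Limits of Stieltjes integrals *)

Section Staircase.
Context {R : realType}.
Implicit Types (z : R) (N : nat).

(** The sum counts the positive integers up to [z]: it is the integer part of [z]. *)
Lemma staircase_count N z : 0 <= z <= N%:R ->
  \sum_(i < N) (i.+1%:R <= z)%R%:R <= z <= 1 + \sum_(i < N) (i.+1%:R <= z)%R%:R.
Proof.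
move=> /andP[z0 +]; have sum_ge0 n : 0 <= \sum_(i < n) (i.+1%:R <= z)%R%:R :> R.
  by apply: sumr_ge0.
elim: N => [|N IH] zN.
  by rewrite big_ord0 z0 addr0 (le_trans zN).
rewrite big_ord_recr/=; have [zN'|zN'] := leP z N%:R.
  have /andP[lo hi] := IH zN'.
  rewrite (@lt_geF _ _ z N.+1%:R) ?addr0 ?lo//.
  by rewrite (le_lt_trans zN')// ltr_nat.
have sumE : \sum_(i < N) (i.+1%:R <= z)%R%:R = N%:R :> R.
  rewrite (eq_bigr (fun=> 1)) => [|i _]; first by rewrite sumr_const card_ord.
  by rewrite (le_trans _ (ltW zN')) ?ler_nat ?ltn_ord.
rewrite sumE; have [zS|zS] := leP N.+1%:R z.
  by rewrite natr1 zS/= (le_trans zN)// lerDr.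
by rewrite addr0 (ltW zN')/= nat1r.
Qed.

Lemma staircase_bounds N z : (0 < N)%N -> 0 <= z <= 1 ->
  N%:R^-1 * \sum_(i < N) (i.+1%:R / N%:R <= z)%R%:R <= z <=
  N%:R^-1 + N%:R^-1 * \sum_(i < N) (i.+1%:R / N%:R <= z)%R%:R.
Proof.
move=> N0 /andP[z0 z1]; have NR : 0 < N%:R :> R by rewrite ltr0n.
have zN : 0 <= z * N%:R <= N%:R by rewrite mulr_ge0//= ler_piMl.
have /andP[lo hi] := staircase_count zN.
have -> : \sum_(i < N) (i.+1%:R / N%:R <= z)%R%:R =
    \sum_(i < N) (i.+1%:R <= z * N%:R)%R%:R :> R.
  by apply: eq_bigr => i _; rewrite ler_pdivrMr.
by rewrite ler_pdivrMl// [N%:R * z]mulrC lo/= -[X in X + _]mulr1 -mulrDr ler_pdivlMl// mulrC.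
Qed.

Lemma measurable_fun_le_indicator d (T : measurableType d) (D : set T) (f g : T -> R) :
  measurable D -> measurable_fun D f -> measurable_fun D g ->
  measurable_fun D (fun x => (f x <= g x)%R%:R : R).
Proof.
move=> mD mf mg; rewrite (_ : (fun x => _) = (fun x => if f x <= g x then 1 else 0 : R)).
  apply: measurable_fun_if => //; [|exact: measurable_cst..].
  exact: measurable_fun_ler.
by apply/funext => x; case: ifP.
Qed.

(** A discrete layer-cake formula: rounding [K] down to multiples of [1/N] costs at most [1/N] of
    the mass and leaves only the weights of superlevel sets. For a decreasing [K] these are initial
    intervals, so distribution functions suffice. *)
Lemma integral_staircase d (T : measurableType d) (m : {measure set T -> \bar R})
    (D : set T) (w K : T -> R) N :
  measurable D -> (forall x, D x -> 0 <= w x) -> m.-integrable D (EFin \o w) ->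
  measurable_fun D K -> (forall x, D x -> 0 <= K x <= 1) -> (0 < N)%N ->
  N%:R^-1 * \sum_(i < N) \int[m]_(x in D) (w x * (i.+1%:R / N%:R <= K x)%R%:R) <=
    \int[m]_(x in D) (w x * K x) <=
  N%:R^-1 * \int[m]_(x in D) w x +
  N%:R^-1 * \sum_(i < N) \int[m]_(x in D) (w x * (i.+1%:R / N%:R <= K x)%R%:R).
Proof.
move=> mD w0 iw mK K01 N0.
have mw : measurable_fun D w by apply/measurable_EFinP/(measurable_int m).
have mb (i : nat) : measurable_fun D (fun x => (i.+1%:R / N%:R <= K x)%R%:R : R).
  by apply: measurable_fun_le_indicator => //; exact: measurable_cst.
have ib (i : nat) : m.-integrable D (EFin \o (fun x => w x * (i.+1%:R / N%:R <= K x)%R%:R)).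
  apply: (dominated_integrable mD _ _ iw); first exact: measurable_funM.
  move=> x Dx; rewrite ger0_norm ?mulr_ge0 ?w0//.
  by rewrite ler_piMr ?w0// lern1 leq_b1.
have iK : m.-integrable D (EFin \o (fun x => w x * K x)).
  apply: (dominated_integrable mD _ _ iw); first exact: measurable_funM.
  move=> x Dx; have /andP[k0 k1] := K01 x Dx.
  by rewrite ger0_norm ?mulr_ge0 ?w0// ler_piMr ?w0.
have isum := integrable_sum_ord (h := fun i x => w x * (i.+1%:R / N%:R <= K x)%R%:R)
  mD (fun i (_ : (i < N)%N) => ib i).
have isumN := integrable_scale N%:R^-1 mD isum.
rewrite -(Rintegral_sum_ord (h := fun i x => w x * (i.+1%:R / N%:R <= K x)%R%:R) mD
  (fun i (_ : (i < N)%N) => ib i)).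
rewrite -RintegralZl// -RintegralZl// -RintegralD//; last exact: integrable_scale.
apply/andP; split; apply: le_Rintegral => //.
- move=> x Dx; have /andP[lo _] := staircase_bounds N0 (K01 x Dx).
  by rewrite -mulr_sumr mulrCA ler_wpM2l ?w0.
- exact: (integrableD mD (integrable_scale N%:R^-1 mD iw) isumN).
- move=> x Dx; have /andP[_ hi] := staircase_bounds N0 (K01 x Dx).
  by rewrite -mulr_sumr mulrCA [_ * w x]mulrC -mulrDr ler_wpM2l ?w0.
Qed.

End Staircase.

Section StieltjesKernelLevels.
Context {R : realType}.
Variables (lambda u : R).
Hypotheses (lambda_gt0 : 0 < lambda) (u_gt0 : 0 < u).
Implicit Types (r y : R).

(** The inverse function of the kernel [r -> (1 + u r)^(-lambda)]. *)
Definition level y : R := (y `^ (- lambda^-1) - 1) / u.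

Lemma le_level y r : 0 < y -> 0 <= r -> (y <= (1 + u * r) `^ (- lambda)) = (r <= level y).
Proof.
move=> y0 r0; have ur : 0 < 1 + u * r by rewrite ltr_wpDr// mulr_ge0// ltW.
have yE : y = (y `^ (- lambda^-1)) `^ (- lambda).
  by rewrite -powRrM mulrNN mulVf ?gt_eqF// powRr1// ltW.
have w0 : 0 < y `^ (- lambda^-1) by rewrite powR_gt0.
rewrite /level ler_pdivlMr// lerBrDl [r * u]mulrC.
rewrite {1}yE !(powRN _ lambda) lef_pV2 ?posrE ?powR_gt0//.
have [h|h] := leP (1 + u * r) (y `^ (- lambda^-1)).
  by rewrite ge0_ler_powR// ?nnegrE ?(ltW ur) ?(ltW w0) ?(ltW lambda_gt0).
apply/negbTE; rewrite -ltNge.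
by rewrite gt0_ltr_powR// ?nnegrE ?(ltW ur) ?(ltW w0).
Qed.

Lemma level_ge0 y : 0 < y <= 1 -> 0 <= level y.
Proof. by move=> /andP[y0 y1]; rewrite -le_level// mulr0 addr0 powR1. Qed.

Lemma level_lt y1 y2 : 0 < y1 -> y1 < y2 -> level y2 < level y1.
Proof.
move=> y10 y12; have y20 := lt_trans y10 y12.
rewrite /level ltr_pM2r ?invr_gt0// ltrD2r !powRN ltf_pV2 ?posrE ?powR_gt0//.
by rewrite gt0_ltr_powR ?invr_gt0// ?nnegrE ltW.
Qed.

End StieltjesKernelLevels.

Section LimitRepresentation.
Context {R : realType}.
Local Notation leb := (@lebesgue_measure R).
Local Notation pos := (`]0%R, +oo[%classic : set R).
Local Notation halfline := (`[0, +oo[%classic : set R).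
Variables (lambda M : R) (p : nat -> R -> R) (H : R -> R).
Hypotheses (lambda_gt0 : 0 < lambda).
Hypothesis mp : forall n, measurable_fun pos (p n).
Hypothesis p0 : forall n (r : R), 0 < r -> 0 <= p n r.
Hypothesis pM : forall n, (\int[leb]_(r in pos) (p n r)%:E <= M%:E)%E.
Hypothesis pH : forall u : R, 0 < u ->
  \int[leb]_(r in pos) (p n r * (1 + u * r) `^ (- lambda)) @[n --> \oo] --> H u.

Let mpos : measurable (pos : set (measurableTypeR R)). Proof. by []. Qed.

Let ip n : leb.-integrable pos (EFin \o p n).
Proof.
apply: (ge0_integrable mpos (mp n)) => [r /pos_gt0|]; first exact: p0.
by rewrite (le_lt_trans (pM n))// ltry.
Qed.

Let F n (s : R) : R := \int[leb]_(r in pos) (p n r * (r <= s)%R%:R).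

Let iF n s : leb.-integrable pos (EFin \o (fun r => p n r * (r <= s)%R%:R)).
Proof.
apply: (dominated_integrable mpos _ _ (ip n)).
  apply: (measurable_funM (mp n)); apply: (measurable_fun_le_indicator mpos).
    exact: measurable_id.
  exact: measurable_cst.
move=> r /pos_gt0 r0; rewrite ger0_norm ?mulr_ge0 ?p0//.
by rewrite ler_piMr ?p0// lern1 leq_b1.
Qed.

Let F_nd n : {homo F n : s t / s <= t}.
Proof.
move=> s t st; apply: le_Rintegral => // r /pos_gt0 r0.
rewrite ler_wpM2l ?p0// ler_nat; case: (leP r s) => // rs.
by rewrite (le_trans rs st).
Qed.

Let intp_le n : \int[leb]_(r in pos) p n r <= M.
Proof.
by rewrite -lee_fin /Rintegral fineK//; exact: integrable_fin_num (ip n).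
Qed.

Let F_bd n s : 0 <= F n s <= M.
Proof.
rewrite Rintegral_ge0/=; last by move=> r /pos_gt0 r0; rewrite mulr_ge0 ?p0.
apply: le_trans (intp_le n); apply: le_Rintegral => // r /pos_gt0 r0.
by rewrite ler_piMr ?p0// lern1 leq_b1.
Qed.

Let F_neg n s : s < 0 -> F n s = 0.
Proof.
move=> s0; have -> : F n s = \int[leb]_(r in pos) (0 : R); last by rewrite Rintegral_cst// mul0r.
apply: eq_Rintegral => r; rewrite inE => /pos_gt0 r0.
by rewrite (lt_geF (lt_trans s0 r0)) mulr0.
Qed.

(** The kernel decreases, so its step approximations see the densities only through [F n] at
    finitely many points. There [F n] tends along [U] to [Phi], which may jump at these points; the
    gap between [Phi] and [nu] then costs one level. *)
Lemma stieltjes_limit_measure : exists nu : {measure set R -> \bar R},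
  (nu halfline <= M%:E)%E /\
  forall u : R, 0 < u -> H u = \int[nu]_(t in halfline) ((1 + u * t) `^ (- lambda)).
Proof.
have [U [Phi [nu [[PU ooU] FPhi nuM Phi_le le_Phi]]]] := helly_selection F_nd F_bd F_neg.
exists nu; split=> // u u0.
have mD : measurable halfline by [].
have M0 : 0 <= M by have /andP[] := F_bd 0 0; exact: le_trans.
have nu_fin : (nu halfline < +oo)%E by rewrite (le_lt_trans nuM)// ltry.
pose K (r : R) := (1 + u * r) `^ (- lambda).
have K01 (r : R) : 0 <= r -> 0 <= K r <= 1.
  move=> r0; have ur : 0 <= u * r by rewrite mulr_ge0// ltW.
  have ur1 : 0 < 1 + u * r by rewrite ltr_wpDr.
  rewrite powR_ge0/= /K powRN invf_le1 ?powR_gt0//.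
  have one : 1 = 1 `^ lambda :> R by rewrite powR1.
  rewrite [X in X <= _]one.
  by rewrite ge0_ler_powR ?nnegrE ?ler01 ?(ltW lambda_gt0) ?(ltW ur1)// lerDl.
have mK (D : set R) : measurable_fun D K by apply: measurable_funTS; prove_measurable.
have i1 : nu.-integrable halfline (EFin \o (fun=> 1)).
  apply: ge0_integrable => //.
  by rewrite integral_cst// mul1e.
pose I := \int[nu]_(t in halfline) K t; rewrite -/(I).
(* Both [H u] and the integral lie within [2 M / N] of the same sum. *)
suff close N : (0 < N)%N -> `|H u - I| <= 2 * M / N%:R.
  have : `|H u - I| <= 0; last by rewrite normr_le0 subr_eq0 => /eqP.
  apply/ler_addgt0Pr => e e0; rewrite add0r.
  pose N := (Num.truncn (2 * M / e)).+1.
  apply: (le_trans (close N (ltn0Sn _))).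
  by rewrite ler_pdivrMr// -ler_pdivrMl// mulrC ltW// truncnS_gt.
move=> N0; have NR : 0 < N%:R :> R by rewrite ltr0n.
pose s (i : nat) := level lambda u (i.+1%:R / N%:R).
have y0 (i : nat) : 0 < i.+1%:R / N%:R :> R by rewrite divr_gt0.
have s0 (i : nat) : (i < N)%N -> 0 <= s i.
  move=> iN; apply: level_ge0 => //; rewrite y0/= ler_pdivrMr// mul1r ler_nat.
  exact: iN.
pose S := N%:R^-1 * \sum_(i < N) Phi (s i).
have S_H : S <= H u <= N%:R^-1 * M + S.
  have SU : N%:R^-1 * \sum_(i < N) F n (s i) @[n --> U] --> S.
    apply: cvgM; first exact: cvg_cst.
    have cvg_sum k : \sum_(i < k) F n (s i) @[n --> U] --> \sum_(i < k) Phi (s i).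
      elim: k => [|k IH].
        by under eq_cvg do rewrite big_ord0; rewrite big_ord0; exact: cvg_cst.
      under eq_cvg do rewrite big_ord_recr/=.
      by rewrite big_ord_recr/=; apply: cvgD; [exact: IH|exact: FPhi].
    exact: cvg_sum.
  have HU : \int[leb]_(r in pos) (p n r * K r) @[n --> U] --> H u.
    exact: cvg_trans (cvg_app _ ooU) (pH u0).
  have bnd n : N%:R^-1 * \sum_(i < N) F n (s i) <=
      \int[leb]_(r in pos) (p n r * K r) <=
      N%:R^-1 * M + N%:R^-1 * \sum_(i < N) F n (s i).
    have K01' r : pos r -> 0 <= K r <= 1 by move=> /pos_gt0/ltW; exact: K01.
    have p0' r : pos r -> 0 <= p n r by move=> /pos_gt0; exact: p0.
    have := integral_staircase mpos p0' (ip n) (mK pos) K01' N0.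
    have -> : \sum_(i < N) \int[leb]_(r in pos) (p n r * (i.+1%:R / N%:R <= K r)%R%:R) =
        \sum_(i < N) F n (s i).
      apply: eq_bigr => i _; apply: eq_Rintegral => r; rewrite inE => /pos_gt0 r0.
      by rewrite le_level// ltW.
    move=> /andP[-> hi] /=; apply: (le_trans hi).
    by rewrite lerD2r ler_pM2l ?invr_gt0.
  apply/andP; split.
    by apply: (ler_cvg_to SU HU); apply: nearW => n; have /andP[] := bnd n.
  apply: (ler_cvg_to HU (cvgD (cvg_cst _) SU)).
  by apply: nearW => n; have /andP[] := bnd n.
pose W (i : nat) := \int[nu]_(t in halfline) (1 * (i.+1%:R / N%:R <= K t)%R%:R).
have WE (i : nat) : (i < N)%N -> (W i)%:E = nu `[0, s i]%classic.
  move=> iN; have sD : `[0, s i]%classic `<=` halfline.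
    by move=> x /=; rewrite !in_itv/= andbT => /andP[].
  have nus : nu `[0, s i]%classic \is a fin_num.
    rewrite ge0_fin_numE//; apply: le_lt_trans nu_fin.
    by apply: le_measure => //; rewrite inE//; exact: measurable_itv.
  rewrite -(fineK nus); congr EFin; rewrite /W /Rintegral; congr fine.
  have -> : nu `[0, s i]%classic = (\int[nu]_(t in halfline) (\1_(`[0, s i]%classic) t)%:E)%E.
    by rewrite integral_indic// (setIidl sD).
  apply: eq_integral => t; rewrite inE => /halfline_ge0 t0.
  rewrite mul1r indicE le_level//; congr ((nat_of_bool _)%:R%:E).
  by apply/idP/idP => [ts|/set_mem]; [rewrite inE/= in_itv/= t0|rewrite /= in_itv/= t0].
have := integral_staircase mD (fun _ _ => ler01) i1 (mK halfline)
  (fun t Dt => K01 t (halfline_ge0 Dt)) N0.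
have -> : \int[nu]_(t in halfline) (1 * K t) = I.
  by apply: eq_Rintegral => t _; rewrite mul1r.
rewrite -[X in X <= _]/(N%:R^-1 * \sum_(i < N) W i).
have WM (i : nat) : (i < N)%N -> W i <= M.
  move=> iN; rewrite -lee_fin WE//; apply: le_trans nuM.
  apply: le_measure; rewrite ?inE//.
  by move=> x /=; rewrite !in_itv/= andbT => /andP[].
have int1M : \int[nu]_(t in halfline) 1 <= M.
  by rewrite Rintegral_cst// mul1r -lee_fin fineK// ge0_fin_numE.
have SW : \sum_(i < N) Phi (s i) <= \sum_(i < N) W i.
  by apply: ler_sum => i _; rewrite -lee_fin WE// Phi_le// s0.
(* The points [s i] decrease strictly, so [nu [0, s (i+1)] <= Phi (s i)]: the sums are compared
   after a shift of the index, and the unmatched first term is at most [M]. *)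
have WS : \sum_(i < N) W i <= M + \sum_(i < N) Phi (s i).
  have Phi0 (i : nat) : (i < N)%N -> 0 <= Phi (s i).
    move=> _; have := FPhi (s i) => c; rewrite -(cvg_lim _ c)//.
    apply: limr_ge; first exact: cvgP c.
    by apply: nearW => n; have /andP[] := F_bd n (s i).
  have step k : (k < N)%N -> \sum_(i < k.+1) W i <= M + \sum_(i < k) Phi (s i).
    elim: k => [N1|k IH kN]; first by rewrite big_ord1 big_ord0 addr0 WM.
    rewrite big_ord_recr/= [X in _ <= _ + X]big_ord_recr/= addrA.
    rewrite lerD ?IH ?(ltnW kN)// -lee_fin WE// le_Phi ?s0 ?(ltnW kN)//.
    by apply: level_lt => //; rewrite ltr_pM2r ?invr_gt0// ltr_nat.
  suff last_step k : k.+1 = N -> \sum_(i < k.+1) W i <= M + \sum_(i < k.+1) Phi (s i).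
    by have := last_step N.-1; rewrite prednK//; exact.
  move=> kN; rewrite (le_trans (step _ _)) -?kN//.
  by rewrite [X in _ <= _ + X]big_ord_recr/= lerD2l lerDl Phi0// -kN.
move=> /andP[lo hi]; have /andP[Slo Shi] := S_H.
have Ninv : 0 < N%:R^-1 :> R by rewrite invr_gt0.
have loI : S <= I by apply: le_trans lo; rewrite ler_pM2l.
have hiI : I <= N%:R^-1 * M + N%:R^-1 * M + S.
  apply: (le_trans hi); rewrite -addrA; apply: lerD.
    by rewrite ler_pM2l.
  by rewrite -mulrDr ler_pM2l.
rewrite ler_norml.
have -> : 2 * M / N%:R = N%:R^-1 * M + N%:R^-1 * M by ring.
have NM : 0 <= N%:R^-1 * M by rewrite mulr_ge0// ltW.
by apply/andP; split; lra.
Qed.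

End LimitRepresentation.

(** * Existence of the measure *)

Section ReciprocalSequence.
Context {R : realType}.
Variables (lambda : R) (f : R -> R) (alpha : nat -> R).
Implicit Types (u x : R) (n k : nat).

(* [(-1)^n reciprocal n] is the [n]-th derivative of [u^(-lambda) f(1/u)]. *)
Definition reciprocal n u : R :=
  u `^ (- (lambda + n%:R)) * c_op lambda n f u^-1.

(** The term [(lambda + n) c_n] in the recursion for [c_op] cancels against the derivative of the
    power. *)
Lemma is_derive_reciprocal n u : smooth_on_pos f -> 0 < u ->
  is_derive u 1 (reciprocal n) (- reciprocal n.+1 u).
Proof.
move=> sf u0; have ui : 0 < u^-1 by rewrite invr_gt0.
have dinv : is_derive u 1 (fun y : R => y^-1) (- (u ^+ 2)^-1).
  apply: (is_derive_eq (is_deriveV (lt0r_neq0 u0) (is_derive_id u 1))).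
  by rewrite /GRing.scale/= mulr1.
have dc := is_derive1_comp (is_derive_c_op lambda n sf ui) dinv.
have dp := is_derive1_powR (- (lambda + n%:R)) u0.
apply: (is_derive_eq (is_deriveM dp dc)).
rewrite /reciprocal /GRing.scale/=.
have -> : - (lambda + n.+1%:R) = - (lambda + n%:R) - 1 by rewrite -natr1; ring.
rewrite powRB_gt0// powRr1 ?(ltW u0)//; set p := u `^ _.
by field; rewrite gt_eqF.
Qed.

Hypothesis cm : forall k, completely_monotonic (c_op lambda k f).

Lemma smooth_of_c_op : smooth_on_pos f.
Proof. by apply: smooth_on_pos_eq (cm 0).1 => x; exact: c_op0. Qed.

Lemma c_op_ge0 n x : 0 < x -> 0 <= c_op lambda n f x.
Proof. by move=> x0; have := (cm n).2 0%N x x0; rewrite expr0 mul1r. Qed.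

Lemma cm_reciprocal : cm_sequence reciprocal.
Proof.
split=> n x x0; first exact: is_derive_reciprocal smooth_of_c_op x0.
by rewrite mulr_ge0 ?powR_ge0 ?c_op_ge0 ?invr_gt0.
Qed.

Lemma reciprocalE n x : 0 < x ->
  reciprocal n x^-1 = x `^ (lambda + n%:R) * c_op lambda n f x.
Proof. by move=> x0; rewrite /reciprocal invrK -powR_inv1 ?(ltW x0)// -powRrM mulN1r opprK. Qed.

Lemma c_opE n x : 0 < x ->
  c_op lambda n f x = x `^ (- (lambda + n%:R)) * reciprocal n x^-1.
Proof.
move=> x0; rewrite reciprocalE// mulrA powRN mulVf ?mul1r//.
by rewrite gt_eqF ?powR_gt0.
Qed.

Hypothesis falpha : asymptotic_expansion lambda f alpha.

(** [reciprocal 0] is nonincreasing, and the expansion says that it tends to [alpha 0] as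
    [u -> 0]. *)
Lemma reciprocal_le u : 0 < u -> reciprocal 0 u <= alpha 0%N.
Proof.
move=> u0; apply: (@cvgr_to_ge _ _ _ _ _ _ _ (@asymptotic_coeff_cvg _ _ _ _ 0 falpha)).
near=> x; have x0 : 0 < x by near: x; exact: nbhs_pinfty_gt.
have xu : x^-1 <= u.
  by rewrite invf_ple ?posrE//; near: x; apply: nbhs_pinfty_ge; rewrite num_real.
apply: (le_trans (cm_nonincreasing cm_reciprocal 0 _ xu)); first by rewrite invr_gt0.
rewrite reciprocalE// c_op0// addr0 /remainder big_ord0 subr0 expr1 mulrA.
by rewrite powRB_gt0// powRr1 ?(ltW x0)// mulrCA divff ?gt_eqF// mulr1.
Unshelve. all: by end_near. Qed.

(** Needed for Taylor's formula at infinity to apply to [c_op lambda n f]. In terms of [x = 1/u],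
    the bound [reciprocal n u <= C / u^n] reads [c_op lambda n f x <= C x^(-lambda)]. *)
Lemma c_op_cvg0 n : 0 < lambda -> c_op lambda n f x @[x --> +oo] --> (0 : R).
Proof.
move=> l0; have [C C0 rC] := cm_bound cm_reciprocal reciprocal_le n.
apply/cvgrPdist_le => e e0; near=> x.
have x0 : 0 < x by near: x; exact: nbhs_pinfty_gt.
rewrite sub0r normrN ger0_norm ?c_op_ge0// c_opE//.
have xi : 0 < x^-1 by rewrite invr_gt0.
apply: (@le_trans _ _ (x `^ (- lambda) * C)).
  apply: (le_trans (ler_wpM2l (powR_ge0 _ _) (rC _ xi))).
  rewrite opprD powRB_gt0// powR_mulrn ?(ltW x0)// exprVn invrK.
  rewrite le_eqVlt; apply/orP; left; apply/eqP.
  by field; rewrite expf_neq0 ?gt_eqF.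
rewrite powRN ler_pdivrMl ?powR_gt0// mulrC -ler_pdivrMl//.
have -> : e^-1 * C = ((e^-1 * C) `^ lambda^-1) `^ lambda.
  by rewrite -powRrM mulVf ?gt_eqF// powRr1// mulr_ge0// invr_ge0 ltW.
have xC : (e^-1 * C) `^ lambda^-1 <= x.
  by near: x; apply: nbhs_pinfty_ge; rewrite num_real.
by rewrite ge0_ler_powR ?(ltW l0)// ?nnegrE ?powR_ge0 ?(ltW x0).
Unshelve. all: by end_near. Qed.

End ReciprocalSequence.

Section LimitAtInfinity.
Context {R : realType}.
Variable A : nat -> R -> R.
Hypothesis cmA : cm_sequence A.

Lemma cm_limit : exists2 l : R, 0 <= l & A 0%N x @[x --> +oo] --> l /\
  cm_sequence (fun n x => A n x - (n == 0)%N%:R * l).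
Proof.
pose S := [set A 0%N x | x in `]0, +oo[%classic].
have S0 : lbound S 0 by move=> _ [x /pos_gt0 x0 <-]; exact: cmA.2.
have infS : has_inf S.
  by split; [exists (A 0%N 1), 1; rewrite //= in_itv/= ltr01|exists 0].
have Sle (x : R) : 0 < x -> inf S <= A 0%N x.
  by move=> x0; apply: ge_inf; [exact: infS.2|exists x => //=; rewrite in_itv/= x0].
exists (inf S); first exact: lb_le_inf infS.1 S0.
split.
  apply/cvgrPdist_lt => e e0.
  have [_ [x /pos_gt0 x0 <-] xe] := inf_adherent e0 infS.
  near=> y; have xy : x <= y by near: y; apply: nbhs_pinfty_ge; rewrite num_real.
  rewrite ler0_norm ?subr_le0 ?Sle ?(lt_le_trans x0)// opprB ltrBlDl.
  exact: le_lt_trans (cm_nonincreasing cmA _ x0 xy) xe.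
split=> n x x0; last first.
  case: n => [|n] /=; first by rewrite mul1r subr_ge0 Sle.
  by rewrite mul0r subr0; exact: cmA.2.
apply: (is_derive_eq (is_deriveB (cmA.1 n x x0) (is_derive_cst _ x 1))).
by rewrite /= mul0r !subr0.
Unshelve. all: by end_near. Qed.

End LimitAtInfinity.

Lemma fatou_cvg_le {R : realType} d (T : measurableType d) (m : {measure set T -> \bar R})
    (D : set T) (g : nat -> T -> R) (h : T -> R) (c : nat -> R) (l : R) :
  measurable D -> (forall n, measurable_fun D (g n)) ->
  (forall n x, D x -> 0 <= g n x) ->
  (forall x, D x -> g n x @[n --> \oo] --> h x) ->
  (forall n, (\int[m]_(x in D) (g n x)%:E <= (c n)%:E)%E) -> c n @[n --> \oo] --> l ->
  (\int[m]_(x in D) (h x)%:E <= l%:E)%E.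
Proof.
move=> mD mg g0 gh gc cl.
have hE x : D x -> (h x)%:E = limn_einf (fun n => (g n x)%:E).
  move=> Dx; have /cvg_limn_einf_sup[-> _]// : (g n x)%:E @[n --> \oo] --> (h x)%:E.
  by apply: cvg_EFin; [exact: nearW|exact: gh].
rewrite (eq_integral (fun x => limn_einf (fun n => (g n x)%:E))); last first.
  by move=> x; rewrite inE; exact: hE.
have mg' n : measurable_fun D (EFin \o g n) by exact/measurable_EFinP.
have g0' n x : D x -> (0 <= (EFin \o g n) x)%E by move=> Dx; rewrite lee_fin g0.
apply: (le_trans (fatou m mD mg' g0')).
rewrite limn_einf_lim; set u := fun n => _.
have cl' : (c n)%:E @[n --> \oo] --> l%:E by apply: cvg_EFin => //; exact: nearW.
rewrite -(cvg_lim _ cl')//; apply: lee_lim; [exact: is_cvg_einfs|exact: cvgP cl'|].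
apply: nearW => n.
by apply: le_trans (gc n); apply: ereal_inf_lbound; exists n => /=.
Qed.

(** * The mass bound and the passage to the limit *)

Section FiniteMeasure.
Context {R : realType}.
Local Notation leb := (@lebesgue_measure R).
Local Notation pos := (`]0%R, +oo[%classic : set R).
Local Notation halfline := (`[0%R, +oo[%classic : set R).
Implicit Types (lambda l u x M : R).

Let mpos : measurable (pos : set (measurableTypeR R)). Proof. by []. Qed.

(** Fatou's lemma along [u = 1/(n+1)], where the kernel tends to 1: a bound uniform in [u] becomes a
    bound on the mass. *)
Lemma integral_le_of_kernel lambda M (p : R -> R) : 0 < lambda ->
  measurable_fun pos p -> (forall r : R, 0 < r -> 0 <= p r) ->
  (forall u, 0 < u -> (\int[leb]_(r in pos) (p r * (1 + u * r) `^ (- lambda))%:E <= M%:E)%E) ->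
  (\int[leb]_(r in pos) (p r)%:E <= M%:E)%E.
Proof.
move=> l0 mp p0 pM.
pose g (n : nat) (r : R) := p r * (1 + n.+1%:R^-1 * r) `^ (- lambda).
apply: (@fatou_cvg_le _ _ _ leb pos g p (fun=> M) M) => //.
- move=> n; apply: (measurable_funM mp); apply: measurable_funTS; prove_measurable.
- by move=> n r /pos_gt0 r0; rewrite mulr_ge0 ?p0 ?powR_ge0.
- move=> r /pos_gt0 r0; rewrite -[X in _ --> X]mulr1; apply: cvgMr.
  have c : 1 + n.+1%:R^-1 * r @[n --> \oo] --> (1 : R).
    rewrite -[X in _ --> X]addr0 -[X in _ --> _ + X](mul0r r).
    by apply: cvgD; [exact: cvg_cst|apply: cvgMl; exact: cvg_harmonic].
  have cont : {for (1 : R), continuous (fun z : R => z `^ (- lambda))}.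
    by apply: derivable_continuous_at; case: (is_derive1_powR (- lambda) ltr01).
  have := continuous_cvg _ cont c; rewrite powR1; exact.
- by move=> n; apply: pM; rewrite invr_gt0.
- exact: cvg_cst.
Qed.

Section Existence.
Variables (lambda : R) (f : R -> R) (alpha : nat -> R).
Hypothesis lambda_gt0 : 0 < lambda.
Hypothesis cm : forall k, completely_monotonic (c_op lambda k f).
Hypothesis falpha : asymptotic_expansion lambda f alpha.

Let dcop k j (x : R) : R := (-1) ^+ j * derive1n j (c_op lambda k f) x.

Let cm_dcop k : cm_sequence (dcop k).
Proof.
apply: cm_sequence_alternating; last exact: (cm k).2.
exact: smooth_derivative_sequence (cm k).1.
Qed.

Lemma reciprocal_representation (A : nat -> R -> R) : cm_sequence A ->
  A 0%N x @[x --> +oo] --> (0 : R) ->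
  (forall k u, (0 < k)%N -> A k u = reciprocal lambda f k u) ->
  (forall u, 0 < u -> A 0%N u <= alpha 0%N) ->
  exists nu : {measure set R -> \bar R}, (nu halfline < +oo)%E /\
    forall u : R, 0 < u -> A 0%N u = \int[nu]_(t in halfline) ((1 + u * t) `^ (- lambda)).
Proof.
move=> cmA A_cvg0 Ar Aalpha.
have B_cvg0 k : (0 < k)%N -> dcop k 0%N x @[x --> +oo] --> (0 : R).
  move=> _; rewrite (_ : dcop k 0%N = c_op lambda k f); first exact: c_op_cvg0 cm falpha k lambda_gt0.
  by apply/funext => x; rewrite /dcop expr0 mul1r.
have AB k (s : R) : (0 < k)%N -> 0 < s ->
    A k s = s `^ (- (lambda + k%:R)) * dcop k 0%N s^-1.
  by move=> k0 s0; rewrite Ar// /dcop expr0 mul1r.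
have approx := stieltjes_approx lambda_gt0 cmA A_cvg0 (fun k _ => cm_dcop k) B_cvg0 AB.
pose D := inverse_gamma (lambda + 2) / inverse_gamma lambda.
have D0 : 0 < D by rewrite divr_gt0 ?inverse_gamma_gt0 ?addr_gt0.
(* The shift makes the relative error [D / N n] at most 1/2 for every [n], whence the uniform bound
   [2 alpha_0]. *)
pose N n := (n + (Num.truncn (2 * D)).+1)%N.
have N0 n : (0 < N n)%N by rewrite /N addnS.
have NR n : 0 < (N n)%:R :> R by rewrite ltr0n.
have DN n : D / (N n)%:R <= 2^-1.
  rewrite ler_pdivrMr// -ler_pdivrMl// invrK ltW// (lt_le_trans (truncnS_gt _))//.
  by rewrite ler_nat leq_addl.
have DN' n : D <= (N n)%:R.
  have := DN n; rewrite ler_pdivrMr// => /le_trans; apply.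
  by rewrite ler_piMl ?invf_le1 ?ler1n// ltW.
pose p n := stieltjes_density lambda dcop (N n).
have mp n : measurable_fun pos (p n) := measurable_stieltjes_density lambda (fun k _ => cm_dcop k) (N n).
have p0 n (r : R) : 0 < r -> 0 <= p n r.
  exact: stieltjes_density_ge0 lambda_gt0 (fun k _ => cm_dcop k) _ _.
pose E n (u : R) := (\int[leb]_(r in pos) (p n r * (1 + u * r) `^ (- lambda))%:E)%E.
have E0 n u : (0 <= E n u)%E.
  by apply: integral_ge0 => r /pos_gt0 r0; rewrite lee_fin mulr_ge0 ?p0 ?powR_ge0.
have alpha0 : 0 <= alpha 0%N by apply: le_trans (Aalpha _ ltr01); exact: cmA.2.
have E_le n u : 0 < u -> (E n u <= (2 * alpha 0%N)%:E)%E.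
  move=> u0; have [_ hi] := approx _ _ (N0 n) u0 (DN' n).
  have half : (2^-1%:E * E n u <= (alpha 0%N)%:E)%E.
    apply: le_trans (le_trans hi _); last by rewrite lee_fin Aalpha.
    apply: lee_wpmul2r; [exact: E0|rewrite lee_fin -/D].
    by have := DN n; lra.
  by rewrite -(@lee_pmul2l _ 2^-1%:E)// -EFinM mulrA mulVf// mul1r.
have E_fin n u : 0 < u -> E n u \is a fin_num.
  by move=> u0; rewrite ge0_fin_numE// (le_lt_trans (E_le n u u0))// ltry.
have pH (u : R) : 0 < u ->
    \int[leb]_(r in pos) (p n r * (1 + u * r) `^ (- lambda)) @[n --> \oo] --> A 0%N u.
  move=> u0; apply/cvgrPdist_le => e e0; near=> n.
  have [lo hi] := approx _ _ (N0 n) u0 (DN' n).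
  rewrite -/(p n) -/(E n u) -/D in lo hi; have := E_le n u u0.
  rewrite /Rintegral -/(E n u); move: lo hi; rewrite -(fineK (E_fin n u u0)) !lee_fin /=.
  set F := fine _ => lo hi FM; rewrite ler0_norm ?subr_le0// opprB.
  have Fe : F * (D / (N n)%:R) <= e.
    have F0 : 0 <= F by apply: le_trans lo; exact: cmA.2.
    rewrite mulrA ler_pdivrMr// -ler_pdivrMl//.
    apply: (@le_trans _ _ (e^-1 * (2 * alpha 0%N * D))).
      by rewrite ler_pM2l ?invr_gt0// ler_pM2r.
    apply: (@le_trans _ _ n%:R); last by rewrite ler_nat leq_addr.
    by near: n; exact: nbhs_infty_ger.
  by apply: le_trans Fe; lra.
have [nu [nuM nuE]] := @stieltjes_limit_measure R lambda (2 * alpha 0%N) p (A 0%N) lambda_gt0 mp p0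
  (fun n => integral_le_of_kernel lambda_gt0 (mp n) (p0 n) (E_le n)) pH.
exists nu; split=> //; exact: le_lt_trans nuM (ltry _).
Unshelve. all: by end_near. Qed.

End Existence.

End FiniteMeasure.

Section FiniteRepresentation.
Context {R : realType}.
Local Notation halfline := (`[0%R, +oo[%classic : set R).
Implicit Types (mu nu : {measure set R -> \bar R}) (x t : R).

Lemma integrable_expr0 mu : (mu halfline < +oo)%E ->
  mu.-integrable halfline (EFin \o (fun t => t ^+ 0)).
Proof.
move=> mufin; apply: ge0_integrable => //.
by under eq_integral do rewrite expr0; rewrite integral_cst// mul1e.
Qed.

Lemma integrable_powRN mu lambda x : 0 < lambda -> 0 < x -> (mu halfline < +oo)%E ->
  mu.-integrable halfline (fun t => ((x + t) `^ (- lambda))%:E).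
Proof.
move=> l0 x0 mufin.
have := integrable_stieltjes x0 (ltW l0) (integrable_expr0 mufin).
by apply: eq_integrable => // t _; rewrite /= expr0 mul1r.
Qed.

Lemma stieltjes_representation lambda (f : R -> R) (alpha : nat -> R) : 0 < lambda ->
  (forall k, completely_monotonic (c_op lambda k f)) ->
  asymptotic_expansion lambda f alpha ->
  exists mu, (mu halfline < +oo)%E /\
    forall x, 0 < x -> f x = \int[mu]_(t in halfline) ((x + t) `^ (- lambda)).
Proof.
move=> l0 cm falpha; have mD : measurable halfline by [].
have [l lge0 [rl cmA]] := cm_limit (cm_reciprocal cm).
have [||u u0|nu [nufin nuE]] := @reciprocal_representation _ _ f alpha l0 cm falpha _ cmA.
- rewrite -(subrr l); apply: cvgB; first exact: rl.
  by rewrite mul1r; exact: cvg_cst.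
- by move=> [//|k] u _; rewrite mul0r subr0.
- by rewrite mul1r lerBlDr (le_trans (reciprocal_le cm falpha u0))// lerDl.
(* As [f x = x^(-lambda) H (1/x)], the limit [l] of [H] contributes [l x^(-lambda)], which is [l]
   times the kernel at [t = 0]. *)
pose atom : {measure set R -> \bar R} := mscale (NngNum lge0) (\d_(0 : R)).
pose mu : {measure set R -> \bar R} := measure_add nu atom; exists mu.
have mk x : measurable_fun halfline (fun t => ((x + t) `^ (- lambda))%:E).
  by apply/measurable_EFinP; apply: measurable_funTS; prove_measurable.
split.
  have -> : mu halfline = (nu halfline + atom halfline)%E by exact: measure_addE.
  rewrite lte_add_pinfty// /atom /= /mscale/= diracE.
  by rewrite -EFinM ltry.
move=> x x0; have xi : 0 < x^-1 by rewrite invr_gt0.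
rewrite /Rintegral ge0_integral_measure_add//; last by move=> t _; rewrite lee_fin powR_ge0.
rewrite ge0_integral_mscale//; last by move=> t _; rewrite lee_fin powR_ge0.
rewrite integral_dirac// diracE mem_set ?mul1e; last by rewrite /= in_itv/= lexx.
have nufin_num : (\int[nu]_(t in halfline) ((x + t) `^ (- lambda))%:E)%E \is a fin_num.
  exact: integrable_fin_num (integrable_powRN l0 x0 nufin).
rewrite fineD// -[X in X + _]/(\int[nu]_(t in halfline) ((x + t) `^ (- lambda))) /= addr0.
have -> : \int[nu]_(t in halfline) ((x + t) `^ (- lambda)) =
    x `^ (- lambda) * \int[nu]_(t in halfline) ((1 + x^-1 * t) `^ (- lambda)).
  rewrite -RintegralZl//.
    apply: eq_Rintegral => t; rewrite inE => /halfline_ge0 t0.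
    have xt : 0 <= 1 + x^-1 * t by rewrite addr_ge0// mulr_ge0// ltW.
    by rewrite -powRM ?(ltW x0)// mulrDr mulr1 mulrA divff ?gt_eqF// mul1r.
  have := integrable_scale (x `^ lambda) mD (integrable_powRN l0 x0 nufin).
  apply: eq_integrable => // t; rewrite inE => /halfline_ge0 t0.
  have xt : 0 <= 1 + x^-1 * t by rewrite addr_ge0// mulr_ge0// ltW.
  rewrite /=; have -> : x + t = x * (1 + x^-1 * t) by field; rewrite gt_eqF.
  by rewrite powRM ?(ltW x0)// mulrA -powRD_gt0// subrr powRr0 mul1r.
have := c_opE lambda f 0 x0; rewrite c_op0// addr0 => ->.
by rewrite -nuE// mul1r; ring.
Qed.

End FiniteRepresentation.

(** * Moments *)

Section MomentsFromExpansion.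
Context {R : realType}.
Local Notation halfline := (`[0%R, +oo[%classic : set R).
Variables (mu : {measure set R -> \bar R}) (lambda : R) (f : R -> R) (alpha : nat -> R).
Hypothesis lambda_gt0 : 0 < lambda.
Hypothesis mu_fin : (mu halfline < +oo)%E.
Hypothesis fE : forall x : R, 0 < x ->
  f x = \int[mu]_(t in halfline) ((x + t) `^ (- lambda)).
Hypothesis falpha : asymptotic_expansion lambda f alpha.

Let mD : measurable (halfline : set R). Proof. by []. Qed.

(* [n^m (remainder of order m at t/n)] is nonnegative, is at most
   [binomial_coeff m * t^m], and converges to it: Fatou's lemma bounds the
   [m]-th moment by [(-1)^m alpha m], and the upper bound gives the reverse
   inequality. *)
Lemma moment_of_expansion m :
  (forall k, (k < m)%N -> mu.-integrable halfline (EFin \o (fun t => t ^+ k)) /\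
                          stieltjes_coeff mu lambda k = alpha k) ->
  mu.-integrable halfline (EFin \o (fun t => t ^+ m)) /\
  stieltjes_coeff mu lambda m = alpha m.
Proof.
move=> IH; have mom k (km : (k < m)%N) := (IH k km).1.
have ic := integrable_binomial_remainder lambda_gt0 (integrable_expr0 mu_fin) mom.
pose b := binomial_coeff lambda m; have b0 : 0 < b := binomial_coeff_gt0 m lambda_gt0.
pose g (n : nat) (t : R) : R := n.+1%:R ^+ m * binomial_remainder lambda m (t / n.+1%:R).
have ig n : mu.-integrable halfline (EFin \o g n).
  by apply: (integrable_scale _ mD); apply: ic.
have mg n : measurable_fun halfline (g n).
  by apply/measurable_EFinP; exact: measurable_int (ig n).
have g0 n t : halfline t -> 0 <= g n t.
  move=> /halfline_ge0 t0; have tn : 0 <= t / n.+1%:R by rewrite divr_ge0.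
  exact: mulr_ge0 (exprn_ge0 _ (ler0n _ _)) (binomial_remainder_ge0 m lambda_gt0 tn).
have g_le n t : halfline t -> g n t <= b * t ^+ m.
  move=> /halfline_ge0 t0; have tn : 0 <= t / n.+1%:R by rewrite divr_ge0.
  apply: (le_trans (ler_wpM2l (exprn_ge0 _ (ler0n _ _)) (binomial_remainder_le m lambda_gt0 tn))).
  rewrite -/b expr_div_n le_eqVlt; apply/orP; left; apply/eqP.
  by field; rewrite expf_neq0// pnatr_eq0.
have g_cvg t : halfline t -> g n t @[n --> \oo] --> b * t ^+ m.
  move=> /halfline_ge0 t0; apply/cvgrPdist_le => e e0; near=> n.
  have tn : 0 <= t / n.+1%:R by rewrite divr_ge0.
  (* The gap to the limit is the remainder of the next order, hence of size [1/n]. *)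
  have -> : b * t ^+ m - g n t = n.+1%:R ^+ m * binomial_remainder lambda m.+1 (t / n.+1%:R).
    rewrite /g binomial_remainderS -/b expr_div_n.
    by field; rewrite expf_neq0// pnatr_eq0.
  rewrite ger0_norm; last first.
    exact: mulr_ge0 (exprn_ge0 _ (ler0n _ _)) (binomial_remainder_ge0 m.+1 lambda_gt0 tn).
  apply: (le_trans (ler_wpM2l (exprn_ge0 _ (ler0n _ _)) (binomial_remainder_le m.+1 lambda_gt0 tn))).
  have -> : n.+1%:R ^+ m * (binomial_coeff lambda m.+1 * (t / n.+1%:R) ^+ m.+1) =
      binomial_coeff lambda m.+1 * t ^+ m.+1 / n.+1%:R.
    rewrite expr_div_n [n.+1%:R ^+ m.+1]exprS; field.
    by rewrite nat1r expf_neq0 pnatr_eq0.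
  rewrite ler_pdivrMr// -ler_pdivrMl//.
  apply: (@le_trans _ _ n%:R); last by rewrite ler_nat.
  by near: n; exact: nbhs_infty_ger.
pose c (n : nat) : R := (-1) ^+ m * (n.+1%:R ^+ m.+1 * remainder lambda f alpha m n.+1%:R).
have c_cvg : c n @[n --> \oo] --> (-1) ^+ m * alpha m.
  apply: cvgMr; have := (cvg_pinftyP _ _).1 (asymptotic_coeff_cvg falpha (n := m)).
  apply; apply/cvgryPge => r; near=> n.
  apply: (@le_trans _ _ n%:R); last by rewrite ler_nat.
  by near: n; exact: nbhs_infty_ger.
have gc n : \int[mu]_(t in halfline) g n t = c n.
  (* Below order [m] the coefficients already agree, so the given remainder is that of the Stieltjes
     transform. *)
  have remE : remainder lambda f alpha m n.+1%:R =
      remainder lambda f (stieltjes_coeff mu lambda) m n.+1%:R.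
    rewrite /remainder; congr (_ - _); apply: eq_bigr => k _.
    by rewrite (IH _ (ltn_ord k)).2.
  rewrite /c remE (remainder_stieltjes lambda_gt0 fE (integrable_expr0 mu_fin) mom)//.
  rewrite RintegralZl//; last exact: ic.
  have := sqrr_sign R m; rewrite expr2 => ss.
  rewrite exprS; set I := Rintegral _ _ _; set s := (-1) ^+ m in ss *.
  rewrite -[LHS]mul1r -ss; field.
  by rewrite nat1r pnatr_eq0 signr_eq0.
have fatou_b := fatou_cvg_le mD mg g0 g_cvg _ c_cvg.
have le_b : (\int[mu]_(t in halfline) (b * t ^+ m)%:E <= ((-1) ^+ m * alpha m)%:E)%E.
  apply: fatou_b => n; rewrite -gc /Rintegral fineK//.
  exact: integrable_fin_num (ig n).
have ib : mu.-integrable halfline (EFin \o (fun t => b * t ^+ m)).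
  apply: ge0_integrable => //.
  - by apply: measurable_funTS; prove_measurable.
  - by move=> t /halfline_ge0 t0; rewrite mulr_ge0 ?exprn_ge0// ltW.
  - by rewrite (le_lt_trans le_b)// ltry.
have im : mu.-integrable halfline (EFin \o (fun t => t ^+ m)).
  have := integrable_scale b^-1 mD ib; apply: eq_integrable => // t _.
  by rewrite /= mulrA mulVf ?mul1r// gt_eqF.
split=> //; rewrite stieltjes_coeffE -/b.
have bE : b * moment mu m = \int[mu]_(t in halfline) (b * t ^+ m).
  by rewrite RintegralZl.
have -> : b * moment mu m = (-1) ^+ m * alpha m.
  apply/eqP; rewrite eq_le bE; apply/andP; split.
    by rewrite -lee_fin /Rintegral fineK//; exact: integrable_fin_num ib.
  apply: (@cvgr_to_le _ _ _ _ _ _ _ c_cvg); apply: nearW => n.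
  by rewrite -gc; apply: le_Rintegral => // t; exact: g_le.
by rewrite mulrA -expr2 sqrr_sign mul1r.
Unshelve. all: by end_near. Qed.

Lemma has_all_moments_of_expansion : has_all_moments mu.
Proof.
have im m : mu.-integrable halfline (EFin \o (fun t => t ^+ m)) /\
    stieltjes_coeff mu lambda m = alpha m.
  by elim/ltn_ind: m => m; exact: moment_of_expansion.
move=> p; have := integrable_sum_ord (n := size p) (h := fun i (t : R) => p`_i * t ^+ i) mD
  (fun i _ => integrable_scale p`_i mD (im i).1).
by apply: eq_integrable => // t _; rewrite /= horner_coef.
Qed.

End MomentsFromExpansion.

(** The constant is 0 in (i) because an expansion forces it. In the affirmative case [c] is left
    arbitrary, and its vanishing is derived. The bound on the [n]-th derivative carries
    [1 / Gamma lambda] because the Laplace transform of [t^(lambda - 1)] is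
    [Gamma lambda * x^(-lambda)]. *)
Theorem corollary1p5 (R : realType) (lambda : R) (lambda_gt0 : 0 < lambda)
    (f : R -> R) :
  ((exists mu : {measure set R -> \bar R},
      generalized_Stieltjes lambda mu 0 f /\ has_all_moments mu)
   <->
   ((forall k : nat, completely_monotonic (c_op lambda k f)) /\
    exists alpha : nat -> R, asymptotic_expansion lambda f alpha))
  /\
  (forall (mu : {measure set R -> \bar R}) (c : R) (alpha : nat -> R),
     generalized_Stieltjes lambda mu c f -> has_all_moments mu ->
     asymptotic_expansion lambda f alpha ->
     (forall k : nat,
        alpha k = (-1) ^+ k * rising lambda k * moment mu k / (k`!)%:R) /\
     (forall n : nat, exists xi : R -> R,
        [/\ smooth_on_nneg xi,
            (forall j : nat, (j < n)%N -> derivn_nneg j xi 0 = 0),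
            (forall t : R, 0 <= t ->
               0 <= derivn_nneg n xi t <= moment mu n / Gamma lambda),
            (forall x : R, 0 < x ->
               (@lebesgue_measure R).-integrable `[0, +oo[
                 (fun t : R =>
                    (expR (- (x * t)) * (t `^ (lambda - 1) * xi t))%:E) /\
               remainder lambda f alpha n x =
                 (-1) ^+ n * x `^ (lambda - 1) *
                 Laplace (fun t : R => t `^ (lambda - 1) * xi t) x) &
            (forall x : R, 0 < x ->
               c_op lambda n f x =
                 x `^ (1 - lambda) *
                 derive1n n (fun y : R => y ^+ n * remainder lambda f alpha n y) x /\
               c_op lambda n f x =
                 c_op lambda n
                   (Laplace (fun t : R =>
                      t `^ (lambda - 1) * ((-1) ^+ n * xi t))) x)])).
Proof.
have fE mu c : generalized_Stieltjes lambda mu c f -> c = 0 -> forall x : R, 0 < x ->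
    f x = \int[mu]_(t in `[0, +oo[) ((x + t) `^ (- lambda)).
  by move=> [_ fmu] c0 x x0; have [_ ->] := fmu x x0; rewrite c0 addr0.
split.
  split=> [[mu [fmu moments]]|[cm [alpha falpha]]].
    have fE0 := fE mu 0 fmu erefl; split=> [k|].
      exact: (completely_monotonic_c_op moments lambda_gt0 fE0).
    exists (stieltjes_coeff mu lambda).
    apply: (asymptotic_expansion_stieltjes lambda_gt0 fE0 _ moments).
    exact: integrable_exprn.
  have [mu [mu_fin fmu]] := stieltjes_representation lambda_gt0 cm falpha.
  exists mu; split; last exact: has_all_moments_of_expansion mu_fin fmu falpha.
  split=> // x x0; split; first exact: integrable_powRN.
  by rewrite addr0; exact: fmu.
move=> mu c alpha fmu moments falpha.
have fE0 := fE mu c fmu (stieltjes_constant_eq0 lambda_gt0 fmu falpha).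
have alphaE := asymptotic_coeffE lambda_gt0 fmu moments falpha.
split=> [k|n]; first by rewrite alphaE.
exists (xi mu lambda n); split.
- exact: smooth_xi.
- exact: derivn_xi_at0.
- exact: derivn_xi_bounds.
- move=> x x0; split; first exact: integrable_laplace_xi fE0 n x x0.
  by rewrite alphaE; exact: Laplace_xi.
- move=> x x0; split; last exact: c_op_Laplace_xi fmu moments falpha n x x0.
  exact: c_op_remainder (smooth_stieltjes moments lambda_gt0 fE0) x0.
Qed.
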